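(* Let $\alpha\in(0,1]$, $\sigma\in(0,1)$, let $k\ge1$ be an integer such that $e_{k-1}(q^{\alpha})\neq0$ for all $q\in\mathbb E$, and let $\mathbf i\in\mathbb S^2$. Then $(\mathfrak D^{\sigma}_{\alpha,k,\mathbf i},\|\cdot\|_{\mathfrak D^{\sigma}_{\alpha,k,\mathbf i}})$ is a quaternionic Banach right-module, i.e. a complete normed right $\mathbb H$-module.
   Context: $\mathbb H$ is the skew field of quaternions, $\mathbb S^2$ the sphere of purely imaginary unit quaternions, $\mathbb C(\mathbf i)=\{x+\mathbf iy: x,y\in\mathbb R\}$ for $\mathbf i\in\mathbb S^2$, $\mathbb B=\{q\in\mathbb H:|q|<1\}$, $\mathbb E=\mathbb B\setminus(-1,0]$ where $(-1,0]$ is the set of real quaternions $q_0$ with $-1<q_0\le0$, and $\mathbb E_{\mathbf i}=\mathbb E\cap\mathbb C(\mathbf i)$. A real differentiable function $f:\mathbb E\to\mathbb H$ is slice regular if $\left(\frac{\partial}{\partial x}+\mathbf i\frac{\partial}{\partial y}\right)f|_{\mathbb E_{\mathbf i}}=0$ on $\mathbb E_{\mathbf i}$ for every $\mathbf i\in\mathbb S^2$; $\mathcal{SR}(\mathbb E)$ is the right $\mathbb H$-module of such functions. For $q\in\mathbb E$, $q^{\alpha}$ is the principal power computed in a complex plane $\mathbb C(I)$, $I\in\mathbb S^2$, containing $q$, and $e_k(q)=\sum_{n=0}^k\frac{q^n}{n!}$. For $f\in\mathcal{SR}(\mathbb E)$ and $z\in\mathbb E_{\mathbf i}$, $$\frac{d^{\sigma}}{dq_{\alpha,k,\mathbf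 i}}f|_{\mathbb E_{\mathbf i}}(z)=(1-\sigma)f(z)+\sigma\lim_{\zeta\to z,\ \zeta\in\mathbb E_{\mathbf i}}\left(e_k(z^{\alpha})-e_k(\zeta^{\alpha})\right)^{-1}\left(f(z)-f(\zeta)\right).$$ $\mathfrak D^{\sigma}_{\alpha,k,\mathbf i}$ is the set of all $f\in\mathcal{SR}(\mathbb E)$ with $$\|f\|^2_{\mathfrak D^{\sigma}_{\alpha,k,\mathbf i}}:=\alpha\left|f\left(\tfrac12\right)\right|^2+\int_{\mathbb E_{\mathbf i}}\left|\frac{d^{\sigma}}{dq_{\alpha,k,\mathbf i}}f|_{\mathbb E_{\mathbf i}}(z)\right|^2d_z\mu<\infty,$$ where $\mu$ is Lebesgue area measure on $\mathbb C(\mathbf i)$ and $|\cdot|$ is the quaternionic modulus. *)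

(* Defs.v *)
From HB Require Import structures.
From mathcomp Require Import all_boot all_order all_algebra.
From mathcomp Require Import ring lra.
From mathcomp Require Import all_classical all_reals all_analysis.

Set Implicit Arguments.
Unset Strict Implicit.
Unset Printing Implicit Defensive.
Import Order.TTheory GRing.Theory Num.Theory.
Import numFieldNormedType.Exports.
Local Open Scope classical_set_scope.
Local Open Scope ring_scope.

Record quat (R : Type) := Quat { qre : R; qi : R; qj : R; qk : R }.

Section QuatRing.
Variable R : realType.
Local Notation H := (quat R).

Definition quat_tuple (q : H) : R * R * R * R := (qre q, qi q, qj q, qk q).
Definition tuple_quat (t : R * R * R * R) : H :=
  Quat t.1.1.1 t.1.1.2 t.1.2 t.2.
Lemma quat_tupleK : cancel quat_tuple tuple_quat. Proof. by case. Qed.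

HB.instance Definition _ := Choice.copy H (can_type quat_tupleK).

Lemma quatP (p q : H) :
  qre p = qre q -> qi p = qi q -> qj p = qj q -> qk p = qk q -> p = q.
Proof. by case: p => ? ? ? ?; case: q => ? ? ? ? /= -> -> -> ->. Qed.

Definition addq (p q : H) : H :=
  Quat (qre p + qre q) (qi p + qi q) (qj p + qj q) (qk p + qk q).
Definition oppq (p : H) : H := Quat (- qre p) (- qi p) (- qj p) (- qk p).
Definition mulq (p q : H) : H :=
  Quat (qre p * qre q - qi p * qi q - qj p * qj q - qk p * qk q)
       (qre p * qi q + qi p * qre q + qj p * qk q - qk p * qj q)
       (qre p * qj q - qi p * qk q + qj p * qre q + qk p * qi q)
       (qre p * qk q + qi p * qj q - qj p * qi q + qk p * qre q).
Definition scaleq (a : R) (p : H) : H :=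
  Quat (a * qre p) (a * qi p) (a * qj p) (a * qk p).

Let addqA : associative addq.
Proof. by move=> p q r; apply: quatP => /=; ring. Qed.
Let addqC : commutative addq.
Proof. by move=> p q; apply: quatP => /=; ring. Qed.
Let add0q : left_id (Quat 0 0 0 0) addq.
Proof. by move=> p; apply: quatP => /=; ring. Qed.
Let addNq : left_inverse (Quat 0 0 0 0) oppq addq.
Proof. by move=> p; apply: quatP => /=; ring. Qed.
HB.instance Definition _ :=
  GRing.isZmodule.Build H addqA addqC add0q addNq.

Let mulqA : associative mulq.
Proof. by move=> p q r; apply: quatP => /=; ring. Qed.
Let mul1q : left_id (Quat 1 0 0 0) mulq.
Proof. by move=> p; apply: quatP => /=; ring. Qed.
Let mulq1 : right_id (Quat 1 0 0 0) mulq.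
Proof. by move=> p; apply: quatP => /=; ring. Qed.
Let mulqDl : left_distributive mulq +%R.
Proof. by move=> p q r; apply: quatP => /=; ring. Qed.
Let mulqDr : right_distributive mulq +%R.
Proof. by move=> p q r; apply: quatP => /=; ring. Qed.
Let oneq_neq0 : Quat 1 0 0 0 != 0 :> H.
Proof. by apply/eqP => -[] /eqP; rewrite oner_eq0. Qed.
HB.instance Definition _ :=
  GRing.Zmodule_isNzRing.Build H mulqA mul1q mulq1 mulqDl mulqDr oneq_neq0.

Let scaleqA (a b : R) (p : H) : scaleq a (scaleq b p) = scaleq (a * b) p.
Proof. by apply: quatP => /=; ring. Qed.
Let scale1q : left_id 1 scaleq.
Proof. by move=> p; apply: quatP => /=; ring. Qed.
Let scaleqDr : right_distributive scaleq +%R.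
Proof. by move=> a p q; apply: quatP => /=; ring. Qed.
Let scaleqDl (p : H) : {morph scaleq^~ p : a b / a + b}.
Proof. by move=> a b; apply: quatP => /=; ring. Qed.
HB.instance Definition _ :=
  GRing.Zmodule_isLmodule.Build R H scaleqA scale1q scaleqDr scaleqDl.

Let scaleqAl (a : R) (p q : H) : a *: (p * q) = a *: p * q.
Proof. by apply: quatP => /=; ring. Qed.
HB.instance Definition _ := GRing.Lmodule_isLalgebra.Build R H scaleqAl.
Let scaleqAr (a : R) (p q : H) : a *: (p * q) = p * (a *: q).
Proof. by apply: quatP => /=; ring. Qed.
HB.instance Definition _ := GRing.Lalgebra_isAlgebra.Build R H scaleqAr.

Definition conjq (p : H) : H := Quat (qre p) (- qi p) (- qj p) (- qk p).
Definition sqnormq (p : H) : R :=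
  qre p ^+ 2 + qi p ^+ 2 + qj p ^+ 2 + qk p ^+ 2.

Lemma sqnormq_ge0 p : 0 <= sqnormq p.
Proof. by rewrite /sqnormq !addr_ge0 ?sqr_ge0. Qed.

Lemma sqnormq_eq0 p : (sqnormq p == 0) = (p == 0).
Proof.
apply/idP/eqP => [|->]; last by rewrite /sqnormq /= !expr0n !addr0.
rewrite /sqnormq !paddr_eq0 ?addr_ge0 ?sqr_ge0// !sqrf_eq0.
by move=> /andP[/andP[/andP[/eqP ? /eqP ?] /eqP ?] /eqP ?]; apply: quatP.
Qed.

Definition invq (p : H) : H := (sqnormq p)^-1 *: conjq p.

Let mulVq : {in [pred p : H | p != 0], left_inverse 1 invq *%R}.
Proof.
move=> p; rewrite inE -sqnormq_eq0 => p0.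
by apply: quatP => /=; rewrite /sqnormq in p0 *; field.
Qed.
Let mulqV : {in [pred p : H | p != 0], right_inverse 1 invq *%R}.
Proof.
move=> p; rewrite inE -sqnormq_eq0 => p0.
by apply: quatP => /=; rewrite /sqnormq in p0 *; field.
Qed.
Let unitqP (p q : H) : q * p = 1 /\ p * q = 1 -> [pred p : H | p != 0] p.
Proof.
by case=> qp1 _ /=; apply/eqP => p0; move/eqP: qp1; rewrite p0 mulr0 eq_sym oner_eq0.
Qed.
Let invq_out : {in [predC [pred p : H | p != 0]], invq =1 id}.
Proof.
move=> p; rewrite !inE negbK => /eqP ->.
by apply: quatP => /=; rewrite ?oppr0 mulr0.
Qed.
HB.instance Definition _ :=
  GRing.NzRing_hasMulInverse.Build H mulVq mulqV unitqP invq_out.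

Definition modq (p : H) : R := Num.sqrt (sqnormq p).

Let modqD (p q : H) : modq (p + q) <= modq p + modq q.
Proof.
have s0 : 0 <= modq p + modq q by rewrite addr_ge0 ?sqrtr_ge0.
rewrite -[leRHS]ger0_norm// -sqrtr_sqr ler_wsqrtr// sqrrD.
rewrite !sqr_sqrtr ?sqnormq_ge0// -sqrtrM ?sqnormq_ge0//.
set s := Num.sqrt _.
set d := qre p * qre q + qi p * qi q + qj p * qj q + qk p * qk q.
suff : d <= s by move=> ds; rewrite /sqnormq /=; rewrite /d in ds; lra.
apply: (le_trans (ler_norm d)); rewrite -sqrtr_sqr ler_wsqrtr//.
rewrite -subr_ge0.
suff -> : sqnormq p * sqnormq q - d ^+ 2 =
    (qre p * qi q - qi p * qre q) ^+ 2 + (qre p * qj q - qj p * qre q) ^+ 2 +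
    (qre p * qk q - qk p * qre q) ^+ 2 + (qi p * qj q - qj p * qi q) ^+ 2 +
    (qi p * qk q - qk p * qi q) ^+ 2 + (qj p * qk q - qk p * qj q) ^+ 2.
  by rewrite !addr_ge0 ?sqr_ge0.
by rewrite /sqnormq /d; ring.
Qed.
Let modqZ (a : R) (p : H) : modq (a *: p) = `|a| * modq p.
Proof.
rewrite /modq -sqrtr_sqr -sqrtrM ?sqr_ge0//; congr Num.sqrt.
by rewrite /sqnormq /=; ring.
Qed.
Let modq_eq0 (p : H) : modq p = 0 -> p = 0.
Proof.
move=> /eqP; rewrite sqrtr_eq0 => p0; apply/eqP.
by rewrite -sqnormq_eq0 eq_le p0 sqnormq_ge0.
Qed.
HB.instance Definition _ := @Lmodule_isNormed.Build R H modq modqD modqZ modq_eq0.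

Lemma normqE (p : H) :
  `|p| = Num.sqrt (qre p ^+ 2 + qi p ^+ 2 + qj p ^+ 2 + qk p ^+ 2).
Proof. by []. Qed.

Lemma normqM (p q : H) : `|p * q| = `|p| * `|q|.
Proof.
rewrite !normqE -sqrtrM ?sqnormq_ge0//; congr Num.sqrt.
by rewrite /=; ring.
Qed.

End QuatRing.

Section SliceRegular.
Variable R : realType.
Local Notation H := (quat R).

Definition qim (q : H) : H := Quat 0 (qi q) (qj q) (qk q).

Definition imag_sphere : set H := [set I | qre I = 0 /\ `|I| = 1].

Definition slice_pt (I : H) (x y : R) : H := x%:A + y *: I.

Definition slice (I : H) : set H := [set q | exists x y, q = slice_pt I x y].

Definition unit_qball : set H := [set q | `|q| < 1].

Definition slit_ball : set H :=
  unit_qball `\` [set x%:A | x in `]-1, 0]%classic].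

Definition slit_slice (I : H) : set H := slit_ball `&` slice I.

(* H-valued functions on the slit ball, as a right H-module: MathComp has left
   modules only, so right H-modules are left modules over the converse ring
   H^c; see slit_fun_scaleE. *)
Definition slit_fun : Type := slit_ball -> (H^c)^o.
HB.instance Definition _ := GRing.Lmodule.on slit_fun.

Lemma slit_fun_scaleE (a : H^c) (f : slit_fun) (q : slit_ball) :
  (a *: f) q = (f q : H) * (a : H).
Proof. by []. Qed.

(* Extension by 0; as slit_ball is open, derivatives and limits at its points
   do not depend on the values outside. *)
Definition slit_ext (f : slit_fun) : H -> H :=
  valL_ (0 : H) (f : slit_ball -> H).

Definition slice_regular (f : slit_fun) : Prop :=
  (forall q, slit_ball q -> differentiable (slit_ext f) q) /\
  (forall I, imag_sphere I -> forall x y, slit_ball (slice_pt I x y) ->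
    derive1 (fun t => slit_ext f (slice_pt I t y)) x +
    I * derive1 (fun t => slit_ext f (slice_pt I x t)) y = 0).

(* principal argument of x + iy, in ]-pi, pi] *)
Definition principal_arg (x y : R) : R :=
  let t := acos (x / Num.sqrt (x ^+ 2 + y ^+ 2)) in if 0 <= y then t else - t.

(* principal power of slice_pt I x y in the complex plane slice I *)
Definition slice_powR (I : H) (x y a : R) : H :=
  let r := Num.sqrt (x ^+ 2 + y ^+ 2) in
  slice_pt I (r `^ a * cos (a * principal_arg x y))
             (r `^ a * sin (a * principal_arg x y)).

(* an imaginary unit whose plane contains q (arbitrary if q is real) *)
Definition qaxis (q : H) : H :=
  if qim q == 0 then Quat 0 1 0 0 else `|qim q|^-1 *: qim q.

Definition qpowR (q : H) (a : R) : H :=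
  slice_powR (qaxis q) (qre q) `|qim q| a.

Lemma qaxis_sphere q : imag_sphere (qaxis q).
Proof.
rewrite /qaxis; case: eqP => [_|/eqP q0].
  by split=> //; rewrite normqE /= !expr0n expr1n !(add0r, addr0) sqrtr1.
split; first by rewrite /= mulr0.
by rewrite normrZ normfV normr_id mulVf// normr_eq0.
Qed.

Lemma qaxisE q : q = slice_pt (qaxis q) (qre q) `|qim q|.
Proof.
rewrite /slice_pt /qaxis; case: eqP => [q0|/eqP q0].
  have [i0 j0 k0] : [/\ qi q = 0, qj q = 0 & qk q = 0] by case: q0.
  by rewrite q0 normr0 scale0r addr0; apply: quatP => /=; rewrite ?mulr1 ?mulr0.
rewrite scalerA divff ?normr_eq0// scale1r.
by apply: quatP => /=; rewrite ?mulr1 ?mulr0 ?addr0 ?add0r.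
Qed.

(* The choice of the plane does not matter off the half-line of nonpositive
   reals. *)
Lemma qpowR_slice (I : H) (x y a : R) : imag_sphere I ->
  (y = 0 -> 0 < x) -> qpowR (slice_pt I x y) a = slice_powR I x y a.
Proof.
move=> [I0 I1] xy.
have reE : qre (slice_pt I x y) = x by rewrite /= I0 mulr1 mulr0 addr0.
have imE : qim (slice_pt I x y) = y *: I.
  by apply: quatP => /=; rewrite ?I0 ?mulr0 ?add0r.
have nE : `|qim (slice_pt I x y)| = `|y| by rewrite imE normrZ I1 mulr1.
rewrite /qpowR reE nE /slice_powR /principal_arg normr_ge0.
rewrite !real_normK ?num_real// /qaxis nE imE.
have [yE|y0] := eqVneq y 0.
  have x0 := xy yE.
  rewrite yE scale0r eqxx lexx expr0n addr0 sqrtr_sqr gtr0_norm//.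
  by rewrite divff ?gt_eqF// acos1 mulr0 sin0 mulr0 /slice_pt !scale0r.
have II : I != 0 by rewrite -normr_eq0 I1 oner_eq0.
rewrite scaler_eq0 (negbTE y0) (negbTE II) /= /slice_pt !scalerA -mulrA.
case: (leP 0 y) => yge; first by rewrite ger0_norm// mulVf// mulr1.
rewrite ltr0_norm// invrN mulNr mulVf// mulrN1 [a * - _]mulrN cosN sinN.
by rewrite mulrN.
Qed.

Definition exp_trunc (k : nat) (q : H) : H :=
  \sum_(0 <= n < k.+1) n`!%:R^-1 *: q ^+ n.

(* the operator d^sigma / dq_(alpha,k,i) at z in slit_slice i *)
Definition frac_deriv (sigma alpha : R) (k : nat) (i : H) (f : slit_fun)
    (z : H) : H :=
  (1 - sigma) *: slit_ext f z +
  sigma *: lim ((exp_trunc k (qpowR z alpha) - exp_trunc k (qpowR zeta alpha))^-1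
                * (slit_ext f z - slit_ext f zeta)
                @[zeta --> within (slit_slice i) (dnbhs z)]).

(* The area measure on the plane slice i is the image of the Lebesgue measure
   of R * R under (x, y) |-> slice_pt i x y. *)
Definition dirichlet_sqnorm (sigma alpha : R) (k : nat) (i : H)
    (f : slit_fun) : \bar R :=
  ((alpha * `|slit_ext f (2^-1)%:A| ^+ 2)%:E +
   \int[(@lebesgue_measure R \x @lebesgue_measure R)]_(p in
       [set p : R * R | slit_slice i (slice_pt i p.1 p.2)])
     (`|frac_deriv sigma alpha k i f (slice_pt i p.1 p.2)| ^+ 2)%:E)%E.

Definition dirichlet_space (sigma alpha : R) (k : nat) (i : H) :
    set slit_fun :=
  [set f | slice_regular f /\ (dirichlet_sqnorm sigma alpha k i f < +oo)%E].

Definition dirichlet_norm (sigma alpha : R) (k : nat) (i : H)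
    (f : slit_fun) : R :=
  Num.sqrt (fine (dirichlet_sqnorm sigma alpha k i f)).

End SliceRegular.

Section BanachRightModule.
Variables (R : realType) (V : lmodType (quat R)^c).

Definition is_right_submodule (D : set V) : Prop :=
  [/\ D 0, (forall u v, D u -> D v -> D (u + v)) &
      (forall (a : (quat R)^c) u, D u -> D (a *: u))].

Definition is_norm_on (D : set V) (N : V -> R) : Prop :=
  [/\ (forall u, D u -> 0 <= N u),
      (forall u, D u -> N u = 0 -> u = 0),
      (forall (a : (quat R)^c) u, D u -> N (a *: u) = N u * `|a : quat R|) &
      (forall u v, D u -> D v -> N (u + v) <= N u + N v)].

Definition is_complete_for (D : set V) (N : V -> R) : Prop :=
  forall u : nat -> V, (forall n, D (u n)) ->
    (forall e : R, 0 < e -> exists n0 : nat, forall m n : nat,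
       (n0 <= m)%N -> (n0 <= n)%N -> N (u m - u n) < e) ->
    exists2 l, D l & N (u n - l) @[n --> \oo] --> (0 : R).

Definition quaternionic_banach_right_module (D : set V) (N : V -> R) : Prop :=
  [/\ is_right_submodule D, is_norm_on D N & is_complete_for D N].

End BanachRightModule.

(* Main.v *)
From HB Require Import structures.
Require Import Defs.
From mathcomp Require Import all_boot all_order all_algebra.
From mathcomp Require Import ring lra.
From mathcomp Require Import all_classical all_reals all_analysis measurable_realfun.

(** Let [F] be the restriction of [f] to the slit disc in the plane of [i] and
    [g(z) = e_k(z^alpha)]. As [g' = alpha z^(alpha - 1) e_(k-1)(z^alpha)] does not
    vanish, the operator is [h = (1 - sigma) F + sigma F' / g'] ([frac_derivE]), a
    first order equation for [F]. With the integrating factor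
    [E = exp ((1 - sigma) / sigma g)] it reads [(E F)' = m h], where
    [m = g' E / sigma] ([holo_wfun]). So [F] is recovered from [h] and from the
    value of [F] at one half, and the norm behaves like that of a Bergman space.

    The key is Bergman's inequality ([bergman], [energy_bound]): locally
    uniformly, [|m h|] is bounded by the square root of the energy, that is of the
    integral of [|h|^2]. Integrating along the segment from one half, about which
    the slit disc is star-shaped, also bounds [E F] pointwise by the norm
    ([wfun_bound]). A function of norm zero therefore vanishes on the slice of [i];
    since all the slices share the segment (0, 1), the identity principle makes it
    vanish everywhere ([slice_regular_eq0]). The triangle inequality comes from the
    pointwise inequality [|u + v|^2 <= (1 + l) |u|^2 + (1 + 1/l) |v|^2].

    For a Cauchy sequence the same bounds show that [E F_n] converges pointwise and
    [m h_n] locally uniformly, so that the limit is holomorphic ([holo_limit]) and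
    provides a function on the slice. The representation formula
    [f (x + I y) = (1 - I i)/2 F (x + i y) + (1 + I i)/2 F (x - i y)] extends
    it to a slice regular function ([slice_regular_extension]), and Fatou's
    lemma gives convergence in norm ([energy_limit]).

    The quaternion-valued complex analysis in one plane is developed from
    pointwise differentiability: Goursat's theorem on parametrized rectangles
    ([goursat]), applied to cones over the edges of a rectangle, shows that
    [(z - z0)^-1 (w z - w z0)] has zero boundary integral ([cauchy_bd]); a
    lower bound for the winding integral then replaces its exact value and
    yields Cauchy's estimate ([cauchy_estimate]). Applied to difference
    quotients it reaches the derivative, and Tonelli's theorem selects good
    rectangles for Bergman's inequality. Applied to the products of a function
    with exponential weights it gives the identity principle ([rect_zero]). *)

Set Implicit Arguments.
Unset Strict Implicit.
Unset Printing Implicit Defensive.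
Import Order.TTheory GRing.Theory Num.Theory.
Import numFieldNormedType.Exports.
Local Open Scope classical_set_scope.
Local Open Scope ring_scope.

(** * Quaternions and the complex planes [slice i] *)

Section QuatAlgebra.
Variable R : realType.
Local Notation H := (quat R).
Implicit Types (p q u z : H) (x y : R).

Lemma sqr_normq q : `|q| ^+ 2 = qre q ^+ 2 + qi q ^+ 2 + qj q ^+ 2 + qk q ^+ 2.
Proof. by rewrite Defs.normqE sqr_sqrtr// (sqnormq_ge0 q). Qed.

Lemma normq_comps q :
  [/\ `|qre q| <= `|q|, `|qi q| <= `|q|, `|qj q| <= `|q| & `|qk q| <= `|q|].
Proof.
by split; rewrite -ler_sqr ?nnegrE ?normr_ge0// real_normK ?num_real//
  sqr_normq; have := sqr_ge0 (qre q); have := sqr_ge0 (qi q);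
  have := sqr_ge0 (qj q); have := sqr_ge0 (qk q); lra.
Qed.

Lemma ler_normq_comps q : `|q| <= `|qre q| + `|qi q| + `|qj q| + `|qk q|.
Proof.
rewrite -ler_sqr ?nnegrE ?addr_ge0 ?normr_ge0// sqr_normq.
rewrite -(real_normK (num_real (qre q))) -(real_normK (num_real (qi q))).
rewrite -(real_normK (num_real (qj q))) -(real_normK (num_real (qk q))).
have := normr_ge0 (qre q); have := normr_ge0 (qi q).
have := normr_ge0 (qj q); have := normr_ge0 (qk q).
move: `|qre q| `|qi q| `|qj q| `|qk q| => a b c d d0 c0 b0 a0.
by have := mulr_ge0 a0 b0; have := mulr_ge0 a0 c0; have := mulr_ge0 a0 d0;
   have := mulr_ge0 b0 c0; have := mulr_ge0 b0 d0; have := mulr_ge0 c0 d0; lra.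
Qed.

Lemma normq1 : `|1 : H| = 1.
Proof. by rewrite Defs.normqE /= expr1n expr0n !addr0 sqrtr1. Qed.

Lemma normqA x : `|x%:A : H| = `|x|.
Proof. by rewrite normrZ normq1 mulr1. Qed.

Lemma unitqE q : (q \is a GRing.unit) = (q != 0).
Proof. by []. Qed.

Lemma normqV q : `|q^-1| = `|q|^-1.
Proof.
have [->|q0] := eqVneq q 0; first by rewrite invr0 !normr0 invr0.
have n0 : `|q| != 0 by rewrite normr_eq0.
have e : `|q^-1| * `|q| = 1 by rewrite -Defs.normqM mulVr ?unitqE// normq1.
by rewrite -[LHS]mulr1 -(mulfV n0) mulrA e mul1r.
Qed.

Lemma normqX q n : `|q ^+ n| = `|q| ^+ n.
Proof. by elim: n => [|n IH]; rewrite ?expr0 ?normq1// !exprS Defs.normqM IH. Qed.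

Lemma mulq_eq0 p q : (p * q == 0) = (p == 0) || (q == 0).
Proof.
have H1 := normr_eq0 (p * q); rewrite Defs.normqM in H1.
by rewrite -H1 mulf_eq0 !normr_eq0.
Qed.

Lemma scaleqE x q : x *: q = x%:A * q.
Proof. by rewrite -scalerAl mul1r. Qed.

Lemma conjqM_re p q : qre (conjq p * q * p) = `|p| ^+ 2 * qre q.
Proof. by rewrite sqr_normq /=; ring. Qed.

Lemma norm_conjq p : `|conjq p| = `|p|.
Proof. by rewrite !Defs.normqE /= !sqrrN. Qed.

Lemma sphere_sqr (i : H) : imag_sphere i -> i * i = -1.
Proof.
move=> [i0 i1]; have := sqr_normq i; rewrite i1 i0 expr0n expr1n add0r => e.
by apply: quatP => /=; rewrite ?i0; lra.
Qed.

Lemma sphereN (i : H) : imag_sphere i -> imag_sphere (- i).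
Proof. by move=> [i0 i1]; split; rewrite ?normrN//= i0 oppr0. Qed.

Section Slice.
Variables (i : H) (hi : imag_sphere i).
Let ii := sphere_sqr hi.

(** The coordinate of a point of [slice i] along [i]. *)
Definition imc q : R := - qre (i * q).

Lemma imc_slice_pt x y : imc (slice_pt i x y) = y.
Proof.
rewrite /imc /slice_pt mulrDr -!scalerAr ii mulr1 /=.
by case: hi => /= -> _; ring.
Qed.

Lemma qre_slice_pt x y : qre (slice_pt i x y) = x.
Proof. by case: hi => /= -> _; rewrite mulr0 addr0 mulr1. Qed.

Lemma slice_slice_pt x y : slice i (slice_pt i x y).
Proof. by exists x, y. Qed.

Lemma slice_ptE q : slice i q -> q = slice_pt i (qre q) (imc q).
Proof. by move=> [x [y ->]]; rewrite imc_slice_pt qre_slice_pt. Qed.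

Lemma sqr_norm_slice_pt x y : `|slice_pt i x y| ^+ 2 = x ^+ 2 + y ^+ 2.
Proof.
case: hi => i0 i1; have := sqr_normq i; rewrite i1 i0 => e.
rewrite sqr_normq /= i0.
transitivity (x ^+ 2 + y ^+ 2 * (0 ^+ 2 + qi i ^+ 2 + qj i ^+ 2 + qk i ^+ 2)).
  by ring.
by rewrite -e expr1n mulr1.
Qed.

Lemma slice_ptB x y x' y' :
  slice_pt i x y - slice_pt i x' y' = slice_pt i (x - x') (y - y').
Proof. by rewrite /slice_pt !scalerBl opprD addrACA. Qed.

Lemma slice_ptD x y x' y' :
  slice_pt i x y + slice_pt i x' y' = slice_pt i (x + x') (y + y').
Proof. by rewrite /slice_pt !scalerDl addrACA. Qed.

Lemma slice_ptM x y x' y' :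
  slice_pt i x y * slice_pt i x' y' =
  slice_pt i (x * x' - y * y') (x * y' + y * x').
Proof.
rewrite /slice_pt mulrDl !mulrDr -!scalerAl -!scalerAr !mul1r mulr1 ii.
rewrite !scalerA scalerBl scalerDl scalerN.
by rewrite addrA -[in RHS]addrA [in RHS](addrC (- _)) addrA addrA.
Qed.

Lemma slice_ptZ a x y : a *: slice_pt i x y = slice_pt i (a * x) (a * y).
Proof. by rewrite /slice_pt scalerDr !scalerA. Qed.

Lemma sliceA x : slice i x%:A.
Proof. by exists x, 0; rewrite /slice_pt scale0r addr0. Qed.

Lemma slice0 : slice i 0. Proof. by rewrite -(scale0r 1); exact: sliceA. Qed.
Lemma slice1 : slice i 1. Proof. by rewrite -(scale1r 1); exact: sliceA. Qed.
Lemma slicei : slice i i.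
Proof. by exists 0, 1; rewrite /slice_pt scale0r scale1r add0r. Qed.

Lemma sliceD p q : slice i p -> slice i q -> slice i (p + q).
Proof.
by move=> [x [y ->]] [x' [y' ->]]; rewrite slice_ptD; exact: slice_slice_pt.
Qed.
Lemma sliceZ a q : slice i q -> slice i (a *: q).
Proof. by move=> [x [y ->]]; rewrite slice_ptZ; exact: slice_slice_pt. Qed.
Lemma sliceN q : slice i q -> slice i (- q).
Proof. by rewrite -scaleN1r; exact: sliceZ. Qed.
Lemma sliceB p q : slice i p -> slice i q -> slice i (p - q).
Proof. by move=> hp hq; apply: sliceD => //; exact: sliceN. Qed.
Lemma sliceM p q : slice i p -> slice i q -> slice i (p * q).
Proof.
by move=> [x [y ->]] [x' [y' ->]]; rewrite slice_ptM; exact: slice_slice_pt.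
Qed.

Lemma slice_comm p q : slice i p -> slice i q -> p * q = q * p.
Proof.
by move=> [x [y ->]] [x' [y' ->]]; rewrite !slice_ptM; congr slice_pt; ring.
Qed.

Lemma sliceV q : slice i q -> slice i q^-1.
Proof.
move=> [x [y ->]]; change (slice i ((sqnormq (slice_pt i x y))^-1 *:
  conjq (slice_pt i x y))).
apply: sliceZ; exists x, (- y); case: hi => i0 _.
by apply: quatP => /=; rewrite ?i0; ring.
Qed.

Lemma sliceX q n : slice i q -> slice i (q ^+ n).
Proof.
move=> hq; elim: n => [|n IH]; first by rewrite expr0; exact: slice1.
by rewrite exprS; exact: sliceM.
Qed.

Lemma slice_pt0 x : slice_pt i x 0 = x%:A.
Proof. by rewrite /slice_pt scale0r addr0. Qed.

Lemma slice_ptN x y : slice_pt (- i) x y = slice_pt i x (- y).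
Proof. by rewrite /slice_pt scalerN scaleNr. Qed.

End Slice.
End QuatAlgebra.

(** * Differential calculus with values in the quaternions *)

Section Calculus.
Variable R : realType.
Local Notation H := (quat R).

(** Differentiability along [S], with a rate but no neighbourhood filter: one
    calculus serves the planes [slice i], where increments stay in the plane,
    and the whole of H. *)
Definition diff_within (V : normedModType R) (S : set V) (f : V -> H) (v : V)
    (L : V -> H) :=
  forall e, 0 < e -> exists2 d, 0 < d & forall w, S w -> `|w - v| < d ->
    `|f w - f v - L (w - v)| <= e * `|w - v|.

Definition bdd_map (V : normedModType R) (L : V -> H) :=
  exists2 C, 0 < C & forall h, `|L h| <= C * `|h|.

Section Gen.
Variables (V : normedModType R) (S : set V).
Implicit Types (f g : V -> H) (v w h : V) (L M : V -> H).

Lemma diff_within_lip f v L : bdd_map L -> diff_within S f v L ->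
  exists2 C, 0 < C & exists2 d, 0 < d & forall w, S w -> `|w - v| < d ->
    `|f w - f v| <= C * `|w - v|.
Proof.
move=> [C C0 hL] /(_ 1 ltr01) [d d0 hd]; exists (C + 1); first lra.
exists d => // w Sw wd; have := hd w Sw wd.
have := hL (w - v); rewrite mul1r => h1 h2.
rewrite -(subrK (L (w - v)) (f w - f v)) (le_trans (ler_normD _ _))// mulrDl mul1r.
by rewrite addrC lerD.
Qed.

Lemma diff_within_cont f v L : bdd_map L -> diff_within S f v L ->
  forall e, 0 < e -> exists2 d, 0 < d & forall w, S w -> `|w - v| < d ->
    `|f w - f v| < e.
Proof.
move=> bL /(diff_within_lip bL) [C C0 [d d0 hd]] e e0.
exists (Num.min d (e / C)); first by rewrite lt_min d0 divr_gt0.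
move=> w Sw; rewrite lt_min ltr_pdivlMr// => /andP[wd we].
by rewrite (le_lt_trans (hd w Sw wd))// mulrC.
Qed.

Lemma diff_within_cst (c : H) v : diff_within S (fun=> c) v (fun=> 0).
Proof.
move=> e e0; exists 1 => // w _ _; rewrite !subrr normr0.
by rewrite mulr_ge0// ltW.
Qed.

Lemma diff_within_eq f L v M : L =1 M -> diff_within S f v L ->
  diff_within S f v M.
Proof.
by move=> LM hf e e0; have [d d0 hd] := hf e e0; exists d => // w; rewrite -LM; exact: hd.
Qed.

Lemma diff_within_near f g v L (r : R) : 0 < r -> f v = g v ->
  (forall w, S w -> `|w - v| < r -> f w = g w) ->
  diff_within S f v L -> diff_within S g v L.
Proof.
move=> r0 fgv fg hf e e0; have [d d0 hd] := hf e e0.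
exists (Num.min d r); first by rewrite lt_min d0.
by move=> w Sw; rewrite lt_min => /andP[wd wr]; rewrite -fg// -fgv; exact: hd.
Qed.

Lemma diff_within_add f g v L M : diff_within S f v L -> diff_within S g v M ->
  diff_within S (fun w => f w + g w) v (fun h => L h + M h).
Proof.
move=> hf hg e e0; have e2 : 0 < e / 2 by lra.
have [d d0 hd] := hf _ e2; have [d' d0' hd'] := hg _ e2.
exists (Num.min d d'); first by rewrite lt_min d0.
move=> w Sw; rewrite lt_min => /andP[wd wd'].
have -> : f w + g w - (f v + g v) - (L (w - v) + M (w - v)) =
  (f w - f v - L (w - v)) + (g w - g v - M (w - v)).
  by apply: quatP => /=; ring.
rewrite (le_trans (ler_normD _ _))//.
by have := hd w Sw wd; have := hd' w Sw wd'; lra.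
Qed.

Lemma diff_within_mul f g v L M : bdd_map L -> bdd_map M ->
  diff_within S f v L -> diff_within S g v M ->
  diff_within S (fun w => f w * g w) v (fun h => L h * g v + f v * M h).
Proof.
move=> bL bM hf hg e e0.
have [C C0 [r r0 hr]] := diff_within_lip bL hf.
have [C' C0' [r' r0' hr']] := diff_within_lip bM hg.
have ga : 0 < `|g v| + 1 by rewrite ltr_wpDl.
have fa : 0 < `|f v| + 1 by rewrite ltr_wpDl.
have e1 : 0 < e / 3 / (`|g v| + 1) by rewrite !divr_gt0.
have e2 : 0 < e / 3 / (`|f v| + 1) by rewrite !divr_gt0.
have [d d0 hd] := hf _ e1; have [d' d0' hd'] := hg _ e2.
exists (Num.min (Num.min d d') (Num.min (Num.min r r') (e / 3 / (C * C')))).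
  by rewrite !lt_min d0 d0' r0 r0' !divr_gt0// mulr_gt0.
move=> w Sw; rewrite !lt_min => /andP[/andP[wd wd'] /andP[/andP[wr wr'] we]].
have -> : f w * g w - f v * g v - (L (w - v) * g v + f v * M (w - v)) =
   (f w - f v - L (w - v)) * g v + f v * (g w - g v - M (w - v))
   + (f w - f v) * (g w - g v).
  by apply: quatP => /=; ring.
have h1 := hd w Sw wd; have h2 := hd' w Sw wd'.
have h3 := hr w Sw wr; have h4 := hr' w Sw wr'.
have n0 := normr_ge0 (w - v).
rewrite (le_trans (ler_normD _ _))// (le_trans (lerD (ler_normD _ _) (lexx _)))//.
rewrite !Defs.normqM.
have k1 : `|f w - f v - L (w - v)| * `|g v| <= e / 3 * `|w - v|.
  rewrite (le_trans (ler_pM _ _ h1 (_ : _ <= `|g v| + 1)))//; first by rewrite lerDl.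
  by rewrite mulrAC divfK ?gt_eqF.
have k2 : `|f v| * `|g w - g v - M (w - v)| <= e / 3 * `|w - v|.
  rewrite mulrC (le_trans (ler_pM _ _ h2 (_ : _ <= `|f v| + 1)))//; first by rewrite lerDl.
  by rewrite mulrAC divfK ?gt_eqF.
have k3 : `|f w - f v| * `|g w - g v| <= e / 3 * `|w - v|.
  rewrite (le_trans (ler_pM _ _ h3 h4))// mulrACA mulrA ler_wpM2r//.
  by rewrite mulrC -ler_pdivlMr ?mulr_gt0// ltW.
lra.
Qed.

Lemma bdd_map0 : bdd_map (fun _ : V => 0 : H).
Proof. by exists 1 => // h; rewrite normr0 mul1r. Qed.

Lemma bdd_map_add L M : bdd_map L -> bdd_map M -> bdd_map (fun h => L h + M h).
Proof.
move=> [C C0 hC] [D D0 hD]; exists (C + D); first by rewrite addr_gt0.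
by move=> h; rewrite (le_trans (ler_normD _ _))// mulrDl lerD.
Qed.

Lemma bdd_map_mulr L (c : H) : bdd_map L -> bdd_map (fun h => L h * c).
Proof.
move=> [C C0 hC]; exists (C * (`|c| + 1)); first by rewrite mulr_gt0// ltr_wpDl.
move=> h; rewrite Defs.normqM mulrAC ler_pM//.
by rewrite lerDl.
Qed.

Lemma bdd_map_mull L (c : H) : bdd_map L -> bdd_map (fun h => c * L h).
Proof.
move=> [C C0 hC]; exists ((`|c| + 1) * C); first by rewrite mulr_gt0// ltr_wpDl.
move=> h; rewrite Defs.normqM -mulrA ler_pM//.
by rewrite lerDl.
Qed.

End Gen.

Section Holo.
Variables (i : H) (hi : imag_sphere i).

(** Complex differentiability in the plane [slice i]. The values form a left
    module over that plane, so that the derivative acts as a right factor. *)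
Definition holo (f : H -> H) (z p : H) :=
  diff_within (slice i) f z (fun h => h * p).

Lemma bdd_holo (p : H) : bdd_map (fun h : H => h * p).
Proof.
apply: (@bdd_map_mulr _ id); by exists 1 => // h; rewrite mul1r.
Qed.

Lemma diff_within_comp (V : normedModType R) (S : set V) (f : V -> H) (v : V) L
   (G : H -> H) (p : H) :
  (forall w, S w -> slice i (f w)) -> bdd_map L ->
  diff_within S f v L -> holo G (f v) p ->
  diff_within S (fun w => G (f w)) v (fun h => L h * p).
Proof.
move=> Sf bL hf hG e e0.
have [C C0 [r r0 hr]] := diff_within_lip bL hf.
have pa : 0 < `|p| + 1 by rewrite ltr_wpDl.
have e1 : 0 < e / 2 / (`|p| + 1) by rewrite !divr_gt0.
have e2 : 0 < e / 2 / C by rewrite !divr_gt0.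
have [d d0 hd] := hf _ e1; have [d' d0' hd'] := hG _ e2.
exists (Num.min (Num.min d r) (d' / C)).
  by rewrite !lt_min d0 r0 divr_gt0.
move=> w Sw; rewrite !lt_min => /andP[/andP[wd wr]]; rewrite ltr_pdivlMr// => wd'.
have h1 := hd w Sw wd; have h2 := hr w Sw wr.
have h3 : `|f w - f v| < d' by rewrite (le_lt_trans h2)// mulrC.
have h4 := hd' _ (Sf _ Sw) h3.
rewrite -(subrK ((f w - f v) * p) (G (f w) - G (f v))) -addrA -mulrBl.
rewrite (le_trans (ler_normD _ _))// Defs.normqM.
have k1 : `|f w - f v - L (w - v)| * `|p| <= e / 2 * `|w - v|.
  rewrite (le_trans (ler_pM _ _ h1 (_ : _ <= `|p| + 1)))//; first by rewrite lerDl.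
  by rewrite mulrAC divfK ?gt_eqF.
have k2 : e / 2 / C * `|f w - f v| <= e / 2 * `|w - v|.
  by rewrite -mulrA ler_pM2l ?divr_gt0// mulrC ler_pdivrMr// mulrC.
lra.
Qed.

Lemma holo_comp (f G : H -> H) (z q p : H) :
  (forall w, slice i w -> slice i (f w)) ->
  holo f z q -> holo G (f z) p -> holo (fun w => G (f w)) z (q * p).
Proof.
move=> Sf hf hG; have := diff_within_comp Sf (bdd_holo q) hf hG.
by apply: diff_within_eq => h; rewrite mulrA.
Qed.

Lemma holo_cst (c z : H) : holo (fun=> c) z 0.
Proof. by apply: diff_within_eq (diff_within_cst _ c z) => h; rewrite mulr0. Qed.

Lemma holo_id (z : H) : holo id z 1.
Proof.
move=> e e0; exists 1 => // w _ _; rewrite mulr1 subrr normr0.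
by rewrite mulr_ge0// ltW.
Qed.

Lemma holo_add (f g : H -> H) (z p q : H) :
  holo f z p -> holo g z q -> holo (fun w => f w + g w) z (p + q).
Proof.
move=> hf hg; have := diff_within_add hf hg.
by apply: diff_within_eq => h; rewrite mulrDr.
Qed.

Lemma holo_mul (f g : H -> H) (z p q : H) : slice i z -> slice i (f z) ->
  holo f z p -> holo g z q -> holo (fun w => f w * g w) z (p * g z + f z * q).
Proof.
move=> Sz Sf hf hg.
have h0 := diff_within_mul (bdd_holo p) (bdd_holo q) hf hg.
move=> e e0; have [d d0 hd] := h0 e e0; exists d => // w Sw wd.
have := hd w Sw wd.
by rewrite mulrDr !mulrA (slice_comm hi Sf (sliceB Sw Sz)).
Qed.

Lemma holo_mulr (f : H -> H) (z p c : H) :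
  holo f z p -> holo (fun w => f w * c) z (p * c).
Proof.
move=> hf; have := diff_within_mul (bdd_holo p) (bdd_map0 _) hf (diff_within_cst _ c z).
by apply: diff_within_eq => h /=; rewrite mulr0 addr0 mulrA.
Qed.

Lemma holo_sub (f g : H -> H) (z p q : H) :
  holo f z p -> holo g z q -> holo (fun w => f w - g w) z (p - q).
Proof.
move=> hf hg; have := holo_add hf (holo_mulr (-1) hg); rewrite mulrN1.
by rewrite (_ : (fun w => f w - g w) = (fun w => f w + g w * -1))//;
  apply/funext => w; rewrite mulrN1.
Qed.

Lemma holo_mull (f : H -> H) (z p c : H) : slice i z -> slice i c ->
  holo f z p -> holo (fun w => c * f w) z (c * p).
Proof.
move=> Sz Sc hf; have := holo_mul Sz Sc (holo_cst c z) hf.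
by rewrite mul0r add0r.
Qed.

(** From [w^-1 - z^-1 = - w^-1 (w - z) z^-1] and the commutation of [w] and [z]. *)
Lemma holo_inv (z : H) : z != 0 -> slice i z -> holo (fun w => w^-1) z (- z ^- 2).
Proof.
move=> z0 Sz e e0.
have nz : 0 < `|z| by rewrite normr_gt0.
exists (Num.min (`|z| / 2) (e * `|z| ^+ 3 / 2)).
  by rewrite lt_min !divr_gt0// mulr_gt0// exprn_gt0.
move=> w Sw; rewrite lt_min => /andP[w1 w2].
have nw : `|z| / 2 < `|w|.
  by have := ler_normB w (w - z); rewrite subKr => h; lra.
have w0 : w != 0 by rewrite -normr_gt0; lra.
have -> : w^-1 - z^-1 - (w - z) * - z ^- 2 = w^-1 * (w - z) ^+ 2 * z ^- 2.
  have cwd : w * (w - z) = (w - z) * w by rewrite (slice_comm hi Sw (sliceB Sw Sz)).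
  have aw : w^-1 * w = 1 by rewrite mulVr.
  have zb : z * z^-1 = 1 by rewrite mulrV.
  have hab : w^-1 - z^-1 = - (w^-1 * (w - z) * z^-1).
    by rewrite -mulNr -mulrN opprB mulrBr mulrBl aw mul1r -mulrA zb mulr1.
  have hd : w - z = w^-1 * (w - z) * w by rewrite -mulrA -cwd mulrA aw mul1r.
  rewrite hab mulrN opprK -exprVn !expr2.
  have -> : w^-1 * (w - z) * z^-1 = w^-1 * (w - z) * z * (z^-1 * z^-1).
    by rewrite -[_ * z * _]mulrA (mulrA z) zb mul1r.
  rewrite [in X in _ + X]hd addrC -mulrBl -mulrBr; congr (_ * _).
  by rewrite -mulrA.
rewrite !Defs.normqM !normqV !normqX.
move: (normr_ge0 (w - z)) w2 nw nz.
move: `|w - z| `|w| `|z| => t a b t0 tb ab b0.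
have a0 : 0 < a by lra.
have a2 : a^-1 <= (b / 2)^-1 by rewrite lef_pV2 ?posrE ?ltW// divr_gt0.
have -> : e * t = (b / 2)^-1 * ((e * b ^+ 3 / 2) * t) * b ^- 2.
  by field; rewrite gt_eqF.
rewrite ler_pM2r ?invr_gt0 ?exprn_gt0//.

by apply: ler_pM => //; rewrite ?invr_ge0 ?mulr_ge0 ?ler_wpM2r// ltW.
Qed.

End Holo.
End Calculus.

(** * Integrals on intervals, bisection and Goursat's theorem *)

Section Interval.
Variable R : realType.
Implicit Types (f g : R -> R) (a b c : R).
Local Notation mu := (@lebesgue_measure R).

(** Continuity on a closed interval in the form that moduli of continuity give
    it and that is stable under restriction to smaller intervals. *)
Definition cont_on (U : normedModType R) (a b : R) (f : R -> U) :=
  forall x, a <= x <= b -> forall e, 0 < e -> exists2 d, 0 < d &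
    forall y, a <= y <= b -> `|y - x| < d -> `|f y - f x| < e.

Definition itg f a b : R := \int[mu]_(x in `[a, b]) f x.

Lemma cont_on_integrable a b f : cont_on a b f ->
  mu.-integrable `[a, b] (EFin \o f).
Proof.
move=> cf; apply: continuous_compact_integrable; first exact: segment_compact.
apply/subspace_continuousP => x /=; rewrite in_itv/= => xab.
apply/cvgrPdist_lt => e e0; have [d d0 hd] := cf x xab e e0.
rewrite near_withinE; apply/nbhs_ballP; exists d => //= y.
rewrite /ball/= => xy; rewrite in_itv/= => yab.
by rewrite distrC; apply: hd; rewrite // distrC.
Qed.

Lemma cont_onS (U : normedModType R) a b c d (f : R -> U) : a <= c -> d <= b ->
  cont_on a b f -> cont_on c d f.
Proof.
move=> ac db cf x /andP[cx xd] e e0.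
have [|r r0 hr] := cf x _ e e0; first by apply/andP; split; lra.
by exists r => // y /andP[cy yd]; apply: hr; apply/andP; split; lra.
Qed.

Lemma itg_split f a c b : a <= c <= b -> cont_on a b f ->
  itg f a b = itg f a c + itg f c b.
Proof.
move=> /andP[ac cb] cf; have If := cont_on_integrable cf.
have := @Rintegral_itvB R f (BLeft a) (BRight b) c If.
rewrite !bnd_simp => /(_ ac cb); rewrite Rintegral_itv_obnd_cbnd => [|].
  by rewrite /itg => <-; rewrite addrC subrK.
by apply: integrableS If => //; apply: subset_itvr; rewrite bnd_simp.
Qed.

Lemma itgB f g a b : cont_on a b f -> cont_on a b g ->
  itg (fun x => f x - g x) a b = itg f a b - itg g a b.
Proof. by move=> cf cg; rewrite /itg RintegralB//; exact: cont_on_integrable. Qed.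

Lemma itgD f g a b : cont_on a b f -> cont_on a b g ->
  itg (fun x => f x + g x) a b = itg f a b + itg g a b.
Proof. by move=> cf cg; rewrite /itg RintegralD//; exact: cont_on_integrable. Qed.

Lemma itgZ k f a b : cont_on a b f -> itg (fun x => k * f x) a b = k * itg f a b.
Proof. by move=> cf; rewrite /itg RintegralZl//; exact: cont_on_integrable. Qed.

Lemma itg_cst k a b : a <= b -> itg (fun=> k) a b = k * (b - a).
Proof.
move=> ab; rewrite /itg Rintegral_cst//= lebesgue_measure_itv/= lte_fin.
by case: ltP => // ba; rewrite (le_anti (_ : a <= b <= a)) ?ab// subrr.
Qed.

Lemma eq_itg f g a b : (forall x, a <= x <= b -> f x = g x) -> itg f a b = itg g a b.
Proof.
by move=> fg; apply: eq_Rintegral => x; rewrite inE/= in_itv/= => /fg.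
Qed.

Lemma le_itg f g a b : cont_on a b f -> cont_on a b g ->
  (forall x, a <= x <= b -> f x <= g x) -> itg f a b <= itg g a b.
Proof.
move=> cf cg fg; by apply: le_Rintegral => //; exact: cont_on_integrable.
Qed.

Lemma cont_on_cst (U : normedModType R) (k : U) a b : cont_on a b (fun=> k).
Proof. by move=> x _ e e0; exists 1 => // y _ _; rewrite subrr normr0. Qed.

Lemma norm_itg_le f a b C : a <= b -> cont_on a b f ->
  (forall x, a <= x <= b -> `|f x| <= C) -> `|itg f a b| <= C * (b - a).
Proof.
move=> ab cf fC; rewrite ler_norml -mulNr -!itg_cst//.
apply/andP; split; apply: le_itg => //; try exact: cont_on_cst;
  by move=> x /fC; rewrite ler_norml => /andP[].
Qed.

Lemma midpoint_in a b : a <= b -> a <= (a + b) / 2 /\ (a + b) / 2 <= b.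
Proof. by move=> ab; split; lra. Qed.

Lemma midpoint_sub a b : (a + b) / 2 - a = (b - a) / 2 /\ b - (a + b) / 2 = (b - a) / 2.
Proof. by split; field. Qed.

(** Halving a counterexample over and over yields nested rectangles that shrink
    to a point, where the local hypothesis refutes them (Cousin's principle).
    It replaces both Goursat's subdivision and compactness arguments. *)
Lemma rect_bisection (P : R -> R -> R -> R -> Prop) (s1 s2 t1 t2 : R) :
  s1 <= s2 -> t1 <= t2 ->
  (forall a b c d, s1 <= a -> a <= b -> b <= s2 -> t1 <= c -> c <= d -> d <= t2 ->
    let m := (a + b) / 2 in let n := (c + d) / 2 in
    P a m c n -> P m b c n -> P a m n d -> P m b n d -> P a b c d) ->
  (forall s t, s1 <= s <= s2 -> t1 <= t <= t2 -> exists2 r, 0 < r &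
    forall a b c d, s1 <= a -> a <= s <= b -> b <= s2 ->
      t1 <= c -> c <= t <= d -> d <= t2 -> b - a < r -> d - c < r -> P a b c d) ->
  P s1 s2 t1 t2.
Proof.
move=> s12 t12.
have [l0 [ls lt]] : 0 < s2 - s1 + (t2 - t1) + 1 /\
    (s2 - s1 <= s2 - s1 + (t2 - t1) + 1 /\ t2 - t1 <= s2 - s1 + (t2 - t1) + 1) by lra.
move=> hsplit hloc; apply: contrapT => nP.
pose dom (x : R * R * (R * R)) := [/\ s1 <= x.1.1, x.1.1 <= x.1.2, x.1.2 <= s2 &
   [/\ t1 <= x.2.1, x.2.1 <= x.2.2 & x.2.2 <= t2]] /\ ~ P x.1.1 x.1.2 x.2.1 x.2.2.
pose child (x y : R * R * (R * R)) :=
  [/\ x.1.1 <= y.1.1, y.1.2 <= x.1.2, x.2.1 <= y.2.1 & y.2.2 <= x.2.2] /\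
  (y.1.2 - y.1.1 = (x.1.2 - x.1.1) / 2 /\ y.2.2 - y.2.1 = (x.2.2 - x.2.1) / 2).
have step x : exists y, dom x -> dom y /\ child x y.
  have [dx|ndx] := pselect (dom x); last by exists x.
  case: x dx => -[a b] [c d] [/= [sa ab bs [tc cd dt]] nPx].
  have := hsplit _ _ _ _ sa ab bs tc cd dt.
  set m := (a + b) / 2; set n := (c + d) / 2 => /= hP.
  have [am mb] := midpoint_in ab; have [cn nd] := midpoint_in cd.
  have [ma bm] := midpoint_sub a b; have [nc dn] := midpoint_sub c d.
  rewrite -/m -/n in am mb cn nd ma bm nc dn.
  have sm := le_trans sa am; have ms := le_trans mb bs.
  have tn := le_trans tc cn; have nt := le_trans nd dt.
  have [p1|p1] := pselect (P a m c n); last first.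
    by exists (a, m, (c, n)) => _; do ![split => //=].
  have [p2|p2] := pselect (P m b c n); last first.
    by exists (m, b, (c, n)) => _; do ![split => //=].
  have [p3|p3] := pselect (P a m n d); last first.
    by exists (a, m, (n, d)) => _; do ![split => //=].
  have [p4|p4] := pselect (P m b n d); last first.
    by exists (m, b, (n, d)) => _; do ![split => //=].
  by exfalso; apply: nPx; exact: hP.
have [nxt hnxt] := choice step.
pose x n := iter n nxt (s1, s2, (t1, t2)).
have domx n : dom (x n).
  elim: n => [|n /hnxt[]//]; by do ![split => //=].
have chx n : child (x n) (x n.+1) by have [] := hnxt _ (domx n).
have size n : (x n).1.2 - (x n).1.1 = (s2 - s1) / 2 ^+ n /\
    (x n).2.2 - (x n).2.1 = (t2 - t1) / 2 ^+ n.
  elim: n => [|n [i1 i2]]; first by rewrite !divr1.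
  have [_ [-> ->]] := chx n; rewrite i1 i2 exprS.
  by split; field; rewrite expf_neq0.
have mono m n : (m <= n)%N -> [/\ (x m).1.1 <= (x n).1.1, (x n).1.2 <= (x m).1.2,
    (x m).2.1 <= (x n).2.1 & (x n).2.2 <= (x m).2.2].
  move=> /subnK <-; elim: (n - m)%N => [|k [i1 i2 i3 i4]]; first by split.
  have [[j1 j2 j3 j4] _] := chx (k + m)%N; rewrite addSn; split.
  - exact: le_trans i1 j1.
  - exact: le_trans j2 i2.
  - exact: le_trans i3 j3.
  - exact: le_trans j4 i4.
have nest (u v : nat -> R) : (forall m n, u m <= v n) ->
    exists s, forall n, u n <= s <= v n.
  move=> uv; have hs : has_sup (range u).
    by split; [exists (u 0%N), 0%N | exists (v 0%N) => _ [n _ <-]].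
  exists (sup (range u)) => n; apply/andP; split.
    by apply: sup_upper_bound => //; exists n.
  by apply: ge_sup; [case: hs | move=> _ [m _ <-]].
have [s hs] : exists s, forall n, (x n).1.1 <= s <= (x n).1.2.
  apply: nest => m n; have [h1 _ _ _] := mono _ _ (leq_maxl m n).
  have [_ h2 _ _] := mono _ _ (leq_maxr m n).
  by have [[_ h3 _ _] _] := domx (maxn m n); exact: le_trans h1 (le_trans h3 h2).
have [t ht] : exists t, forall n, (x n).2.1 <= t <= (x n).2.2.
  apply: nest => m n; have [_ _ h1 _] := mono _ _ (leq_maxl m n).
  have [_ _ _ h2] := mono _ _ (leq_maxr m n).
  by have [[_ _ _ [_ h3 _]] _] := domx (maxn m n); exact: le_trans h1 (le_trans h3 h2).
have [r r0 hr] := hloc s t (hs 0%N) (ht 0%N).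
have rl : 0 < r / (s2 - s1 + (t2 - t1) + 1) by rewrite divr_gt0.
have [n _ /(_ n (leqnn n)) hn] := near_infty_natSinv_expn_lt (PosNum rl).
have [[h1 h2 h3 [h4 h5 h6]] nPn] := domx n; apply: nPn; apply: hr => //;
  have [e1 e2] := size n; rewrite ?e1 ?e2 /=;
  rewrite /= div1r ltr_pdivlMr// mulrC in hn; apply: le_lt_trans hn;
  by rewrite ler_pM2r ?invr_gt0 ?exprn_gt0.
Qed.

(** A pointwise linear expansion; nothing is asked of the partial derivatives
    as functions, which is what makes Goursat's argument necessary. *)
Definition partial2 (A : R -> R -> R) (s t Ds Dt : R) (s1 s2 t1 t2 : R) :=
  forall e, 0 < e -> exists2 d, 0 < d & forall s' t', s1 <= s' <= s2 ->
    t1 <= t' <= t2 -> `|s' - s| < d -> `|t' - t| < d ->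
    `|A s' t' - A s t - (s' - s) * Ds - (t' - t) * Dt| <=
      e * (`|s' - s| + `|t' - t|).

Lemma partial2_cont (A : R -> R -> R) (s t Ds Dt : R) (s1 s2 t1 t2 : R) :
  partial2 A s t Ds Dt s1 s2 t1 t2 ->
  forall e, 0 < e -> exists2 d, 0 < d & forall s' t', s1 <= s' <= s2 ->
    t1 <= t' <= t2 -> `|s' - s| < d -> `|t' - t| < d -> `|A s' t' - A s t| < e.
Proof.
move=> /(_ 1 ltr01) [d d0 hd] e e0.
set C := `|Ds| + `|Dt| + 2.
have C0 : 0 < C by rewrite /C; have := normr_ge0 Ds; have := normr_ge0 Dt; lra.
exists (Num.min d (e / 2 / C)); first by rewrite lt_min d0 !divr_gt0.
move=> s' t' hs ht; rewrite !lt_min !ltr_pdivlMr// => /andP[sd se] /andP[td te].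
have h1 := hd _ _ hs ht sd td; rewrite mul1r in h1.
have h2 : `|(s' - s) * Ds| <= `|s' - s| * (C - 1).
  by rewrite normrM ler_wpM2l// /C; have := normr_ge0 Dt; lra.
have h3 : `|(t' - t) * Dt| <= `|t' - t| * (C - 1).
  by rewrite normrM ler_wpM2l// /C; have := normr_ge0 Ds; lra.
move: h1 h2 h3 se te.
move: ((s' - s) * Ds) ((t' - t) * Dt) (A s' t' - A s t) => u v w.
rewrite !mulrBr !mulr1 => h1 h2 h3 se te.
have := ler_normD (w - u - v) (u + v); have := ler_normD u v.
by rewrite (_ : w - u - v + (u + v) = w); [lra|ring].
Qed.

Lemma cont_onB_cst (u v : R) f g k : cont_on u v f -> cont_on u v g ->
  cont_on u v (fun x => f x - g x - k).
Proof.
move=> cf cg x hx e e0; have e2 : 0 < e / 2 by lra.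
have [d1 d10 h1] := cf x hx _ e2; have [d2 d20 h2] := cg x hx _ e2.
exists (Num.min d1 d2); first by rewrite lt_min d10.
move=> y hy; rewrite lt_min => /andP[y1 y2].
rewrite (_ : f y - g y - k - (f x - g x - k) = f y - f x - (g y - g x)); last by ring.
by rewrite (le_lt_trans (ler_normB _ _))// (splitr e) ltrD ?h1 ?h2.
Qed.

Lemma itgB_cst (u v : R) f g k : u <= v -> cont_on u v f -> cont_on u v g ->
  itg (fun x => f x - g x - k) u v = itg f u v - itg g u v - k * (v - u).
Proof.
move=> uv cf cg; have cfg : cont_on u v (fun x => f x - g x).
  by have := cont_onB_cst 0 cf cg; under eq_fun do rewrite subr0.
by rewrite (itgB cfg (@cont_on_cst _ k u v)) (itgB cf cg) (itg_cst _ uv).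
Qed.

(** Local step of Goursat's theorem: the contribution of two opposite sides is
    compared with that of the mixed derivative [D]. *)
Lemma increment_bound (A : R -> R -> R) (s t D a0 a b c d r e : R) : 0 < e ->
  a <= s <= b -> c <= t <= d -> b - a < r -> d - c < r ->
  (forall x y, a <= x <= b -> c <= y <= d -> `|x - s| < r -> `|y - t| < r ->
    `|A x y - A s t - (x - s) * D - (y - t) * a0| <= e / 4 * (`|x - s| + `|y - t|)) ->
  forall y, c <= y <= d -> `|A b y - A a y - (b - a) * D| <= e / 2 * (b - a + (d - c)).
Proof.
move=> e0 /andP[as_ sb] /andP[ct td] br dr h y /andP[cy yd].
have e4 : 0 < e / 4 by lra.
have ab := le_trans as_ sb; have hy : c <= y <= d by rewrite cy yd.
have yt : `|y - t| <= d - c by rewrite ler_norml; lra.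
have at_ x : a <= x <= b -> `|x - s| <= b - a ->
    `|A x y - A s t - (x - s) * D - (y - t) * a0| <= e / 4 * (b - a + (d - c)).
  move=> hx xs; apply: (le_trans (h _ _ hx hy (le_lt_trans xs br) (le_lt_trans yt dr))).
  by rewrite ler_pM2l// lerD.
have bs : `|b - s| <= b - a by rewrite ler_norml; lra.
have as' : `|a - s| <= b - a by rewrite ler_norml; lra.
have hb : a <= b <= b by rewrite ab lexx.
have ha : a <= a <= b by rewrite ab lexx.
rewrite (_ : _ - _ - _ = (A b y - A s t - (b - s) * D - (y - t) * a0) -
  (A a y - A s t - (a - s) * D - (y - t) * a0)); last by ring.
rewrite (le_trans (ler_normB _ _))// (le_trans (lerD (at_ b hb bs) (at_ a ha as')))//.
by rewrite -mulrDl le_eqVlt; apply/orP; left; apply/eqP; field.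
Qed.

Lemma goursat_sum (A1 A0 B1 B0 e u v D : R) :
  `|A1 - A0 - u * D * v| <= e / 2 * (u + v) * v ->
  `|B1 - B0 - v * D * u| <= e / 2 * (u + v) * u -> 0 < e ->
  `|A1 - A0 - (B1 - B0)| <= e * (u + v) ^+ 2.
Proof.
move=> n1 n2 e0.
rewrite (_ : _ - _ = (A1 - A0 - u * D * v) - (B1 - B0 - v * D * u)); last by ring.
rewrite (le_trans (ler_normB _ _))// (le_trans (lerD n1 n2))//.
rewrite (_ : _ + _ = e / 2 * (u + v) ^+ 2); last by field.
by rewrite ler_wpM2r ?sqr_ge0// ler_pdivrMr// ler_peMr ?(ltW e0)// ler1n.
Qed.

(** Green's theorem for the closed form [A dt + B ds], whose coefficients are only
    pointwise differentiable. On a small rectangle both coefficients are affine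
    up to an error that is small with respect to the side, and the affine parts
    cancel because the mixed derivatives agree; the error for the boundary
    integral is thus of the order of the squared size, a quantity that adds up
    correctly over four quarters. *)
Lemma goursat (A B : R -> R -> R) (s1 s2 t1 t2 : R) : s1 <= s2 -> t1 <= t2 ->
  (forall s t, s1 <= s <= s2 -> t1 <= t <= t2 -> exists D a b,
    partial2 A s t D a s1 s2 t1 t2 /\ partial2 B s t b D s1 s2 t1 t2) ->
  itg (A s2) t1 t2 - itg (A s1) t1 t2 = itg (B^~ t2) s1 s2 - itg (B^~ t1) s1 s2.
Proof.
move=> s12 t12 hAB.
have cA s : s1 <= s <= s2 -> cont_on t1 t2 (A s).
  move=> hs t ht e e0; have [D [a [b [/partial2_cont hA _]]]] := hAB s t hs ht.
  have [d d0 hd] := hA e e0; exists d => // t' ht' td.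
  by apply: hd; rewrite // subrr normr0.
have cB t : t1 <= t <= t2 -> cont_on s1 s2 (B^~ t).
  move=> ht s hs e e0; have [D [a [b [_ /partial2_cont hB]]]] := hAB s t hs ht.
  have [d d0 hd] := hB e e0; exists d => // s' hs' sd.
  by apply: hd; rewrite // subrr normr0.
pose mu4 a b c d := itg (A b) c d - itg (A a) c d - (itg (B^~ d) a b - itg (B^~ c) a b).
suff h e : 0 < e -> `|mu4 s1 s2 t1 t2| <= e * (s2 - s1 + (t2 - t1)) ^+ 2.
  apply/eqP; rewrite -subr_eq0 -normr_le0 -/(mu4 s1 s2 t1 t2).
  apply/ler_addgt0Pl => e e0; rewrite addr0.
  set l := (s2 - s1 + (t2 - t1)) ^+ 2.
  have l0 : 0 < l + 1 by rewrite ltr_wpDl// sqr_ge0.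
  have := h _ (divr_gt0 e0 l0); rewrite -/l => /le_trans; apply.
  by rewrite -mulrA ler_piMr ?(ltW e0)// mulrC ler_pdivrMr// mul1r; lra.
move=> e0.
apply: (@rect_bisection (fun a b c d =>
  `|mu4 a b c d| <= e * (b - a + (d - c)) ^+ 2)) => //.
- move=> a b c d sa ab bs tc cd dt m n.
  have [am mb] : a <= m /\ m <= b by exact: midpoint_in.
  have [cn nd] : c <= n /\ n <= d by exact: midpoint_in.
  have hb : s1 <= b <= s2 by rewrite bs (le_trans sa ab).
  have ha : s1 <= a <= s2 by rewrite sa (le_trans ab bs).
  have hd : t1 <= d <= t2 by rewrite dt (le_trans tc cd).
  have hc : t1 <= c <= t2 by rewrite tc (le_trans cd dt).
  have -> : mu4 a b c d = mu4 a m c n + mu4 m b c n + mu4 a m n d + mu4 m b n d.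
    rewrite /mu4 (@itg_split (A b) c n d) ?cn//; last first.
      by apply: (cont_onS tc dt); exact: cA.
    rewrite (@itg_split (A a) c n d) ?cn//; last first.
      by apply: (cont_onS tc dt); exact: cA.
    rewrite (@itg_split (B^~ d) a m b) ?am//; last first.
      by apply: (cont_onS sa bs); exact: cB.
    rewrite (@itg_split (B^~ c) a m b) ?am//; last first.
      by apply: (cont_onS sa bs); exact: cB.
    by ring.
  rewrite (_ : m - a = (b - a) / 2); last by rewrite /m; field.
  rewrite (_ : b - m = (b - a) / 2); last by rewrite /m; field.
  rewrite (_ : n - c = (d - c) / 2); last by rewrite /n; field.
  rewrite (_ : d - n = (d - c) / 2); last by rewrite /n; field.
  rewrite -mulrDl expr_div_n.
  move: (mu4 a m c n) (mu4 m b c n) (mu4 a m n d) (mu4 m b n d) => x y z w.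
  have := ler_normD (x + y + z) w; have := ler_normD (x + y) z.
  by have := ler_normD x y; rewrite (_ : 2 ^+ 2 = 4 :> R); [lra|ring].
- move=> s t hs ht; have [D [a0 [b0 [hA hB]]]] := hAB s t hs ht.
  have e4 : 0 < e / 4 by rewrite divr_gt0.
  have [r r0 hr] := hA _ e4; have [r' r0' hr'] := hB _ e4.
  exists (Num.min r r'); first by rewrite lt_min r0.
  move=> a b c d sa /andP[as_ sb] bs tc /andP[ct td] dt.
  rewrite !lt_min => /andP[bar bar'] /andP[dcr dcr'].
  have inS x : a <= x <= b -> s1 <= x <= s2.
    by move=> /andP[h1 h2]; rewrite (le_trans sa h1) (le_trans h2 bs).
  have inT y : c <= y <= d -> t1 <= y <= t2.
    by move=> /andP[h1 h2]; rewrite (le_trans tc h1) (le_trans h2 dt).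
  have hst : a <= s <= b by rewrite as_ sb.
  have hct : c <= t <= d by rewrite ct td.
  have [aab abb] : a <= a <= b /\ a <= b <= b by rewrite !lexx (le_trans as_ sb).
  have [ccd cdd] : c <= c <= d /\ c <= d <= d by rewrite !lexx (le_trans ct td).
  have bA : forall t', c <= t' <= d -> `|A b t' - A a t' - (b - a) * D| <= e / 2 * (b - a + (d - c)).
    apply: (@increment_bound A s t D a0 a b c d r e) => // x y hx hy xs yt.
    by apply: hr => //; [exact: inS|exact: inT].
  have bB : forall s', a <= s' <= b -> `|B s' d - B s' c - (d - c) * D| <= e / 2 * (b - a + (d - c)).
    move=> s' hs'; rewrite (addrC (b - a)); move: s' hs'.
    apply: (@increment_bound (fun y x => B x y) t s D b0 c d a b r' e) => // y x hy hx yt xs.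
    rewrite (_ : _ - _ - _ - _ = B x y - B s t - (x - s) * b0 - (y - t) * D); last by ring.
    by rewrite [X in _ <= _ * X]addrC; apply: hr' => //; [exact: inS|exact: inT].
  have cAx x : a <= x <= b -> cont_on c d (A x).
    by move=> hx; apply: (cont_onS tc dt); apply: cA; exact: inS.
  have cBy y : c <= y <= d -> cont_on a b (B^~ y).
    by move=> hy; apply: (cont_onS sa bs); apply: cB; exact: inT.
  have cd := le_trans ct td; have ab := le_trans as_ sb.
  have iA := itgB_cst ((b - a) * D) cd (cAx _ abb) (cAx _ aab).
  have iB := itgB_cst ((d - c) * D) ab (cBy _ cdd) (cBy _ ccd).
  have n1 := norm_itg_le cd (cont_onB_cst _ (cAx _ abb) (cAx _ aab)) bA.
  have n2 := norm_itg_le ab (cont_onB_cst _ (cBy _ cdd) (cBy _ ccd)) bB.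
  rewrite iA in n1; rewrite iB in n2; exact: goursat_sum n1 n2 e0.
Qed.

End Interval.

(** * Homotopy of Cauchy integrals along a cone *)

Section Cauchy.
Variable R : realType.
Local Notation H := (quat R).
Variables (i : H) (hi : imag_sphere i).

Definition holomorphic_at (f : H -> H) (z : H) := exists p, holo i f z p.

Lemma normq_pair_le (h : R * R) : `|h| <= `|h.1| + `|h.2|.
Proof. by rewrite prod_normE ge_max lerDl lerDr !normr_ge0. Qed.

Lemma normq_pair_ge (h : R * R) : `|h.1| <= `|h| /\ `|h.2| <= `|h|.
Proof. by rewrite prod_normE !le_max !lexx orbT. Qed.

Lemma diff_within_partial2 (f : R * R -> H) (s t : R) (a b u : H) (s1 s2 t1 t2 : R) :
  diff_within setT f (s, t) (fun h => h.1 *: a + h.2 *: b) ->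
  partial2 (fun s t => qre (u * f (s, t))) s t (qre (u * a)) (qre (u * b)) s1 s2 t1 t2.
Proof.
move=> hf e e0; have u0 : 0 < `|u| + 1 by rewrite ltr_wpDl.
have [d d0 hd] := hf _ (divr_gt0 e0 u0); exists d => // s' t' _ _ sd td.
have n0 : `|(s', t') - (s, t)| < d by rewrite prod_normE gt_max/= sd.
have := hd (s', t') I n0; set X := (X in `|X| <= _) => hX.
have -> : qre (u * f (s', t')) - qre (u * f (s, t)) - (s' - s) * qre (u * a) -
  (t' - t) * qre (u * b) = qre (u * X) by rewrite /X /=; ring.
case: (normq_comps (u * X)) => h _ _ _; rewrite (le_trans h)// Defs.normqM.
have h2 := normq_pair_le ((s', t') - (s, t)).
rewrite (@le_trans _ _ ((`|u| + 1) * `|X|))//; first by rewrite ler_wpM2r// lerDl.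
rewrite mulrC -ler_pdivlMr// (le_trans hX)// mulrAC ler_pM2r ?invr_gt0//.
by rewrite ler_pM2l.
Qed.

Lemma diff_within_fst (q : H) (s t : R) :
  diff_within setT (fun x : R * R => x.1 *: q) (s, t) (fun h => h.1 *: q).
Proof.
move=> e e0; exists 1 => // w _ _; rewrite /= scalerBl subrr normr0.
by rewrite mulr_ge0// ltW.
Qed.

Lemma diff_within_ray (z0 p q : H) (s t : R) :
  diff_within setT (fun x : R * R => z0 + x.1 *: (p + x.2 *: q)) (s, t)
    (fun h => h.1 *: (p + t *: q) + h.2 *: (s *: q)).
Proof.
move=> e e0; have q0 : 0 < `|q| + 1 by rewrite ltr_wpDl.
exists (e / (`|q| + 1)); first by rewrite divr_gt0.
move=> w _ /ltW wd.
have -> : z0 + w.1 *: (p + w.2 *: q) - (z0 + (s, t).1 *: (p + (s, t).2 *: q)) -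
    ((w - (s, t)).1 *: (p + t *: q) + (w - (s, t)).2 *: (s *: q)) =
    ((w - (s, t)).1 * (w - (s, t)).2) *: q.
  by case: w wd => w1 w2 _; apply: quatP => /=; ring.
have [h1 h2] := normq_pair_ge (w - (s, t)).
rewrite normrZ normrM mulrAC ler_pM ?mulr_ge0//.
rewrite (@le_trans _ _ (`|w - (s, t)| * (`|q| + 1)))//; last by rewrite -ler_pdivlMr.
by rewrite ler_pM// lerDl.
Qed.

Lemma diff_within_line (p q : H) (s t : R) :
  diff_within setT (fun x : R * R => p + x.2 *: q) (s, t) (fun h => h.2 *: q).
Proof.
move=> e e0; exists 1 => // w _ _.
rewrite [X in `|X|](_ : _ = 0) ?normr0 ?mulr_ge0 ?(ltW e0)//.
by apply: quatP => /=; ring.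
Qed.

Lemma bdd_fst (q : H) : bdd_map (fun h : R * R => h.1 *: q).
Proof.
exists (`|q| + 1) => [|h]; first by rewrite ltr_wpDl.
rewrite normrZ mulrC ler_pM// ?lerDl//.
by have [] := normq_pair_ge h.
Qed.

Lemma bdd_snd (q : H) : bdd_map (fun h : R * R => h.2 *: q).
Proof.
exists (`|q| + 1) => [|h]; first by rewrite ltr_wpDl.
rewrite normrZ mulrC ler_pM// ?lerDl//.
by have [] := normq_pair_ge h.
Qed.

(** Both mixed derivatives of the form [Psi dz], pulled back by the cone
    [(s, t) |-> z0 + s (p + t q)], are equal to [q Psi + s (p + t q) q Psi'];
    [u] and the real part select one real component. *)
Lemma cone_closed (Psi : H -> H) (z0 p q u psi : H) (s t s1 s2 t1 t2 : R) :
  slice i z0 -> slice i p -> slice i q ->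
  holo i Psi (z0 + s *: (p + t *: q)) psi ->
  exists D a b,
  partial2 (fun s t => qre (u * (s *: q * Psi (z0 + s *: (p + t *: q))))) s t D a
    s1 s2 t1 t2 /\
  partial2 (fun s t => qre (u * ((p + t *: q) * Psi (z0 + s *: (p + t *: q))))) s t b D
    s1 s2 t1 t2.
Proof.
move=> Sz Sp Sq hPsi.
have alg1 (h1 h2 : R) (g P0 : H) :
  h1 *: q * P0 + s *: q * ((h1 *: g + h2 *: (s *: q)) * psi) =
  h1 *: (q * P0 + s *: (q * g * psi)) + h2 *: (s *: q * (s *: q * psi)).
  by apply: quatP => /=; ring.
have alg2 (h1 h2 : R) (g P0 : H) :
  h2 *: q * P0 + g * ((h1 *: g + h2 *: (s *: q)) * psi) =
  h1 *: (g * (g * psi)) + h2 *: (q * P0 + s *: (g * q * psi)).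
  by apply: quatP => /=; ring.
set g := p + t *: q; set z := z0 + s *: g; set P0 := Psi z.
have Sg : slice i g by apply: sliceD => //; exact: sliceZ.
have bL : bdd_map (fun h : R * R => h.1 *: g + h.2 *: (s *: q)).
  exact: bdd_map_add (bdd_fst _) (bdd_snd _).
have hc : diff_within setT (fun x : R * R => Psi (z0 + x.1 *: (p + x.2 *: q))) (s, t)
    (fun h => (h.1 *: g + h.2 *: (s *: q)) * psi).
  apply: (@diff_within_comp _ i _ setT (fun x : R * R => z0 + x.1 *: (p + x.2 *: q))) => //.
    by move=> w _; apply: sliceD => //; apply/sliceZ/sliceD => //; exact: sliceZ.
  exact: diff_within_ray.
have bL' := bdd_map_mulr psi bL.
exists (qre (u * (q * P0 + s *: (q * g * psi)))),
  (qre (u * (s *: q * (s *: q * psi)))), (qre (u * (g * (g * psi)))); split.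
- apply: (@diff_within_partial2 (fun x => x.1 *: q * Psi (z0 + x.1 *: (p + x.2 *: q)))).
  have := diff_within_mul (bdd_fst q) bL' (diff_within_fst q s t) hc.
  apply: diff_within_eq => h; rewrite -/g -/z -/P0 /=.
  exact: alg1.
- apply: (@diff_within_partial2 (fun x => (p + x.2 *: q) * Psi (z0 + x.1 *: (p + x.2 *: q)))).
  have := diff_within_mul (bdd_snd q) bL' (diff_within_line p q s t) hc.
  apply: diff_within_eq => h; rewrite -/g -/z -/P0 /= -/g (slice_comm hi Sq Sg).
  exact: alg2.
Qed.

Lemma holo_shift_inv (z0 z : H) : slice i z0 -> slice i z -> z != z0 ->
  holo i (fun w => (w - z0)^-1) z (- (z - z0) ^- 2).
Proof.
move=> S0 Sz nz; rewrite -[X in holo _ _ _ X]mul1r.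
apply: (holo_comp (f := fun w => w - z0) (G := fun w => w^-1)).
- by move=> w Sw; exact: sliceB.
- by have := holo_add (holo_id i z) (holo_cst i (- z0) z); rewrite addr0.
- by apply: holo_inv => //; [rewrite subr_eq0 | exact: sliceB].
Qed.

Lemma holomorphic_quot (w : H -> H) (z0 z c : H) : slice i z0 -> slice i z -> z != z0 ->
  holomorphic_at w z -> holomorphic_at (fun x => (x - z0)^-1 * (w x - c)) z.
Proof.
move=> S0 Sz nz [p hp]; eexists.
apply: holo_mul => //; first exact/sliceV/sliceB.
  exact: holo_shift_inv.
exact: holo_add hp (holo_cst i (- c) z).
Qed.

(** One real component of the integral of [G dz] along a segment. Testing against
    every [u] loses nothing, and keeps all integrals real. *)
Definition edge (u : H) (G : H -> H) (p q : H) (t1 t2 : R) :=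
  itg (fun t => qre (u * (q * G (p + t *: q)))) t1 t2.

(** The same component of the integral of [Psi dz] on the ray from [z0 + s1 c]
    to [z0 + c]. *)
Definition radial (u z0 : H) (Psi : H -> H) (s1 : R) (c : H) :=
  itg (fun s => qre (u * (c * Psi (z0 + s *: c)))) s1 1.

(** Goursat's theorem on the cone with apex [z0] compares an edge with its image
    shrunk by the factor [s1]; the two rays contribute terms that depend on the
    end points only, and the shrunk edge tends to zero because
    [(z - z0) Psi z = w z - w z0] does. *)
Lemma edge_radial (w : H -> H) (u z0 p q : H) (t1 t2 r : R) :
  slice i z0 -> slice i p -> slice i q -> t1 <= t2 -> 0 < r ->
  (forall t, t1 <= t <= t2 -> r <= `|p + t *: q - z0|) ->
  (forall s t, 0 <= s <= 1 -> t1 <= t <= t2 ->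
     holomorphic_at w (z0 + s *: (p + t *: q - z0))) ->
  let Psi := fun z => (z - z0)^-1 * (w z - w z0) in
  forall e, 0 < e -> exists2 d, 0 < d & forall s1, 0 < s1 < d -> s1 < 1 ->
    `|edge u Psi p q t1 t2 - (radial u z0 Psi s1 (p + t2 *: q - z0)
        - radial u z0 Psi s1 (p + t1 *: q - z0))| <= e.
Proof.
move=> S0 Sp Sq t12 r0 hr hw Psi e e0.
set p' := p - z0; have Sp' : slice i p' by exact: sliceB.
have gE t : p + t *: q - z0 = p' + t *: q by rewrite addrAC.
have Sg t : slice i (p' + t *: q) by apply: sliceD => //; exact: sliceZ.
have w0 : holomorphic_at w z0.
  have := hw 0 t1; rewrite scale0r addr0; apply; lra.
pose M := r + `|p'| + (`|t1| + `|t2|) * `|q|.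
have M0 : 0 < M.
  by rewrite /M -addrA ltr_wpDr// addr_ge0// mulr_ge0// addr_ge0.
have gM t : t1 <= t <= t2 -> `|p' + t *: q| <= M.
  move=> ht; rewrite (le_trans (ler_normD _ _))// normrZ /M lerD//.
    by rewrite lerDr ltW.
  rewrite ler_wpM2r// ler_norml.
  have := ler_norm t1; have := ler_norm (- t1); have := ler_norm t2.
  by have := ler_norm (- t2); rewrite !normrN; move: `|t1| `|t2| => *; lra.
pose K := (`|u| + 1) * (`|q| + 1) / r * (t2 - t1 + 1).
have K0 : 0 < K.
  rewrite /K mulr_gt0//; last by lra.
  by rewrite divr_gt0// mulr_gt0// ltr_wpDl.
case: (w0) => pw hpw; have [d d0 hd] := diff_within_cont (bdd_holo pw) hpw (divr_gt0 e0 K0).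
exists (d / M); first by rewrite divr_gt0.
move=> s1 /andP[s10 s1d] s11.
pose A s t := qre (u * (s *: q * Psi (z0 + s *: (p' + t *: q)))).
pose B s t := qre (u * ((p' + t *: q) * Psi (z0 + s *: (p' + t *: q)))).
have hPsi s t : s1 <= s <= 1 -> t1 <= t <= t2 ->
    holomorphic_at Psi (z0 + s *: (p' + t *: q)).
  move=> hs ht; apply: holomorphic_quot => //; first 1 last.
  - rewrite -subr_eq0 addrAC subrr add0r scaler_eq0 negb_or gt_eqF/=; last by lra.
    by rewrite -normr_gt0 -gE; exact: lt_le_trans (hr _ ht).
  - by rewrite -gE; apply: hw => //; lra.
  - by apply: sliceD => //; exact: sliceZ.
have hAB s t : s1 <= s <= 1 -> t1 <= t <= t2 -> exists D a b,
    partial2 A s t D a s1 1 t1 t2 /\ partial2 B s t b D s1 1 t1 t2.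
  by move=> hs ht; have [psi hpsi] := hPsi s t hs ht; exact: cone_closed hpsi.
have := goursat (ltW s11) t12 hAB.
have -> : itg (A 1) t1 t2 = edge u Psi p q t1 t2.
  apply: eq_itg => t _; rewrite /A !scale1r; congr (qre (u * (q * Psi _))).
  by rewrite /p' addrC addrAC subrK.
have -> : itg (B^~ t2) s1 1 = radial u z0 Psi s1 (p + t2 *: q - z0) by rewrite gE.
have -> : itg (B^~ t1) s1 1 = radial u z0 Psi s1 (p + t1 *: q - z0) by rewrite gE.
move=> <-; rewrite opprB addrC subrK.
have cA : cont_on t1 t2 (A s1).
  move=> t ht e1 e10; have [|D [a [b [/partial2_cont hA _]]]] := hAB s1 t _ ht; first lra.
  have [d1 d10 hd1] := hA e1 e10; exists d1 => // t' ht' td.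
  by apply: hd1; rewrite // ?subrr ?normr0//; lra.
have bA t : t1 <= t <= t2 -> `|A s1 t| <= (`|u| + 1) * (`|q| + 1) / r * (e / K).
  move=> ht; rewrite /A /Psi.
  set g := p' + t *: q; have gr : r <= `|g| by rewrite /g -gE; exact: hr.
  have gn0 : g != 0 by rewrite -normr_gt0; exact: lt_le_trans gr.
  case: (normq_comps (u * (s1 *: q * ((z0 + s1 *: g - z0)^-1 * (w (z0 + s1 *: g) - w z0))))) => h _ _ _.
  apply: (le_trans h); rewrite !Defs.normqM normqV (addrC z0) addrK !normrZ gtr0_norm//.
  rewrite invfM.
  have -> : `|u| * (s1 * `|q| * (s1^-1 * `|g|^-1 * `|w (s1 *: g + z0) - w z0|)) =
     `|u| * `|q| * `|g|^-1 * `|w (s1 *: g + z0) - w z0|.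
    by field; rewrite !gt_eqF ?normr_gt0//.
  have wd : `|w (s1 *: g + z0) - w z0| <= e / K.
    apply/ltW/hd; first by apply: sliceD => //; apply: sliceZ; exact: Sg.
    rewrite addrK normrZ gtr0_norm//.
    rewrite (le_lt_trans (_ : _ <= s1 * M))//; first by rewrite ler_pM2l// gM.
    by rewrite -ltr_pdivlMr.
  rewrite ler_pM ?mulr_ge0 ?invr_ge0//.
  rewrite ler_pM ?mulr_ge0 ?invr_ge0//; last by rewrite lef_pV2 ?posrE ?(lt_le_trans r0).
  by rewrite ler_pM// lerDl.
have := norm_itg_le t12 cA bA => /le_trans; apply.
rewrite (@le_trans _ _ ((`|u| + 1) * (`|q| + 1) / r * (e / K) * (t2 - t1 + 1)))//.
  rewrite ler_wpM2l//; last lra.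
  by rewrite !mulr_ge0 ?invr_ge0 ?addr_ge0 ?(ltW K0) ?(ltW r0) ?(ltW e0).
by rewrite mulrAC -/K mulrCA divff ?mulr1// gt_eqF.
Qed.

End Cauchy.

(** * Cauchy's estimates on rectangles *)

Section CauchyRect.
Variable R : realType.
Local Notation H := (quat R).
Variables (i : H) (hi : imag_sphere i).
Local Notation pt := (slice_pt i).
Local Notation hol := (holomorphic_at i).

Lemma locally_bounded_rect (f : R -> R -> R) (s1 s2 t1 t2 : R) :
  s1 <= s2 -> t1 <= t2 ->
  (forall s t, s1 <= s <= s2 -> t1 <= t <= t2 -> exists2 r, 0 < r & exists B,
     forall s' t', s1 <= s' <= s2 -> t1 <= t' <= t2 ->
       `|s' - s| < r -> `|t' - t| < r -> f s' t' <= B) ->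
  exists B, forall s t, s1 <= s <= s2 -> t1 <= t <= t2 -> f s t <= B.
Proof.
move=> s12 t12 hloc.
apply: (@rect_bisection _ (fun a b c d => exists B, forall s t, a <= s <= b ->
  c <= t <= d -> f s t <= B)) => //.
- move=> a b c d _ ab _ _ cd _ m n [B1 h1] [B2 h2] [B3 h3] [B4 h4].
  exists (Num.max (Num.max B1 B2) (Num.max B3 B4)) => s t /andP[s3 s4] /andP[t3 t4].
  rewrite !le_max; case: (leP s m) => sm; case: (leP t n) => tn.
  + by rewrite h1 ?s3 ?t3.
  + by rewrite h3 ?s3 ?t4 ?(ltW tn) ?orbT.
  + by rewrite h2 ?s4 ?t3 ?(ltW sm) ?orbT.
  + by rewrite h4 ?s4 ?t4 ?(ltW tn) ?(ltW sm) ?orbT.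
- move=> s t hs ht; have [r r0 [B hB]] := hloc s t hs ht.
  exists r => // a b c d sa /andP[as_ sb] bs tc /andP[ct td] dt br dr.
  exists B => s' t' /andP[s3 s4] /andP[t3 t4].
  by apply: hB; rewrite ?ltr_norml; lra.
Qed.

Lemma norm_itg_le_itg (f g : R -> R) a b : cont_on a b f -> cont_on a b g ->
  (forall x, a <= x <= b -> `|f x| <= g x) -> `|itg f a b| <= itg g a b.
Proof.
move=> cf cg fg; rewrite ler_norml.
have h1 : itg f a b <= itg g a b.
  by apply: le_itg => // x /fg; rewrite ler_norml => /andP[].
have cNf : cont_on a b (fun x => -1 * f x).
  move=> x hx e e0; have [d d0 hd] := cf x hx e e0; exists d => // y hy yd.
  by rewrite -mulrBr normrM normrN1 mul1r; exact: hd.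
have : itg (fun x => -1 * f x) a b <= itg g a b.
  by apply: le_itg => // x /fg; rewrite ler_norml mulN1r; lra.
by rewrite itgZ// mulN1r h1 andbT; lra.
Qed.

Lemma norm_slice_pt_le x y : `|pt x y| <= `|x| + `|y|.
Proof.
rewrite (le_trans (ler_normD _ _))// normqA normrZ.
by case: hi => _ ->; rewrite mulr1.
Qed.

Lemma norm_slice_pt_ge x y : `|x| <= `|pt x y| /\ `|y| <= `|pt x y|.
Proof.
split; rewrite -ler_sqr ?nnegrE// (sqr_norm_slice_pt hi) real_normK ?num_real//.
  by rewrite lerDl sqr_ge0.
by rewrite lerDr sqr_ge0.
Qed.

Lemma slice_ptV (x y : R) : (x != 0) || (y != 0) ->
  (pt x y)^-1 = pt (x / (x ^+ 2 + y ^+ 2)) (- y / (x ^+ 2 + y ^+ 2)).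
Proof.
move=> xy; have n0 : x ^+ 2 + y ^+ 2 != 0.
  rewrite paddr_eq0 ?sqr_ge0// !sqrf_eq0.
  by move: xy; rewrite -negb_and.
have p0 : pt x y != 0.
  by rewrite -normr_eq0 -sqrf_eq0 (sqr_norm_slice_pt hi).
apply: (mulrI (x := pt x y)); first by rewrite unitqE.
rewrite mulrV ?unitqE// slice_ptM//.
rewrite [X in pt X](_ : _ = 1); last by field.
rewrite [X in pt _ X](_ : _ = 0); last by field.
by rewrite slice_pt0 scale1r.
Qed.

Lemma kernel_lower (m M x y : R) : 0 < m -> m <= x -> x <= M -> - M <= y <= M ->
  m / (2 * M ^+ 2) <= x / (x ^+ 2 + y ^+ 2).
Proof.
move=> m0 mx xM hy; have x0 : 0 < x := lt_le_trans m0 mx.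
have M0 : 0 < M := lt_le_trans x0 xM.
have x2 : 0 < x ^+ 2 by rewrite exprn_gt0.
apply: ler_pM => //; [exact: ltW|by rewrite invr_ge0 mulr_ge0// sqr_ge0|].
rewrite lef_pV2 ?posrE ?mulr_gt0 ?exprn_gt0// ?ltr_pwDl ?sqr_ge0//.
rewrite mulr_natl mulr2n lerD//; first by rewrite ler_sqr ?nnegrE ?(ltW M0) ?(ltW x0).
by rewrite -(real_normK (num_real y)) ler_sqr ?nnegrE ?(ltW M0)// ler_norml.
Qed.

Lemma vert_ptE x t : pt x 0 + t *: i = pt x t.
Proof. by rewrite slice_pt0. Qed.

Lemma horiz_ptE y t : pt 0 y + t *: 1 = pt t y.
Proof. by rewrite /slice_pt scale0r add0r addrC. Qed.

Lemma edge_cont (u : H) (G : H -> H) (p q : H) (t1 t2 : R) :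
  slice i p -> slice i q -> (forall t, t1 <= t <= t2 -> hol G (p + t *: q)) ->
  cont_on t1 t2 (fun t => G (p + t *: q)).
Proof.
move=> Sp Sq hG t ht e e0; have [D hD] := hG t ht.
have [d d0 hd] := diff_within_cont (bdd_holo D) hD e0.
have q0 : 0 < `|q| + 1 by rewrite ltr_wpDl.
exists (d / (`|q| + 1)); first by rewrite divr_gt0.
move=> t' ht'; rewrite ltr_pdivlMr// => td; apply: hd.
  by apply: sliceD => //; exact: sliceZ.
rewrite opprD addrACA subrr add0r -scalerBl normrZ (le_lt_trans _ td)//.
by rewrite ler_wpM2l// lerDl.
Qed.

Lemma cont_on_norm (G : R -> H) t1 t2 : cont_on t1 t2 G ->
  cont_on t1 t2 (fun t => `|G t|).
Proof.
move=> cG t ht e e0; have [d d0 hd] := cG t ht e e0; exists d => // t' ht' td.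
by rewrite (le_lt_trans (ler_dist_dist _ _))// hd.
Qed.

Lemma cont_on_qre (u q : H) (G : R -> H) t1 t2 : cont_on t1 t2 G ->
  cont_on t1 t2 (fun t => qre (u * (q * G t))).
Proof.
move=> cG t ht e e0.
have k0 : 0 < `|u * q| + 1 by rewrite ltr_wpDl.
have [d d0 hd] := cG t ht _ (divr_gt0 e0 k0); exists d => // t' ht' td.
rewrite (_ : _ - _ = qre (u * q * (G t' - G t))); last by rewrite /=; ring.
case: (normq_comps (u * q * (G t' - G t))) => h _ _ _; rewrite (le_lt_trans h)//.
rewrite Defs.normqM (@le_lt_trans _ _ ((`|u * q| + 1) * `|G t' - G t|))//.
  by rewrite ler_wpM2r// lerDl.
by rewrite mulrC -ltr_pdivlMr//; exact: hd.
Qed.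

Lemma edge_le (u : H) (G : H -> H) (p q : H) (t1 t2 : R) : slice i p -> slice i q ->
  (forall t, t1 <= t <= t2 -> hol G (p + t *: q)) ->
  `|edge u G p q t1 t2| <= `|u| * `|q| * itg (fun t => `|G (p + t *: q)|) t1 t2.
Proof.
move=> Sp Sq hG; have cG := edge_cont u Sp Sq hG.
rewrite -itgZ; last exact: cont_on_norm.
apply: norm_itg_le_itg; first exact: cont_on_qre.
  move=> t ht e e0; have k0 : 0 < `|u| * `|q| + 1 by rewrite ltr_wpDl// mulr_ge0.
  have [d d0 hd] := cont_on_norm cG ht (divr_gt0 e0 k0); exists d => // t' ht' td.
  rewrite -mulrBr normrM ger0_norm ?mulr_ge0//.
  rewrite (@le_lt_trans _ _ ((`|u| * `|q| + 1) *
      `| `|G (p + t' *: q)| - `|G (p + t *: q)| |))//; first by rewrite ler_wpM2r// lerDl.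
  by rewrite mulrC -ltr_pdivlMr//; exact: hd.
move=> t _; case: (normq_comps (u * (q * G (p + t *: q)))) => h _ _ _.
by rewrite (le_trans h)// !Defs.normqM mulrA.
Qed.

Lemma edgeB (u : H) (F G : H -> H) (p q : H) (t1 t2 : R) : slice i p -> slice i q ->
  (forall t, t1 <= t <= t2 -> hol F (p + t *: q)) ->
  (forall t, t1 <= t <= t2 -> hol G (p + t *: q)) ->
  edge u (fun z => F z - G z) p q t1 t2 = edge u F p q t1 t2 - edge u G p q t1 t2.
Proof.
move=> Sp Sq hF hG; rewrite /edge -itgB.
- by apply: eq_itg => t _; rewrite !mulrBr.
- exact/cont_on_qre/(edge_cont u).
- exact/cont_on_qre/(edge_cont u).
Qed.

Section Rect.
Variables (a b c d : R).

(** The boundary integral of [G dz] over a rectangle, counterclockwise. *)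
Definition bd (u : H) (G : H -> H) : R :=
  edge u G (pt b 0) i c d - edge u G (pt a 0) i c d -
  (edge u G (pt 0 d) 1 a b - edge u G (pt 0 c) 1 a b).

Definition on_rect (P : H -> Prop) :=
  forall x y : R, a <= x <= b -> c <= y <= d -> P (pt x y).

Definition on_bdry (P : H -> Prop) :=
  forall x y : R, a <= x <= b -> c <= y <= d ->
    [\/ x = a, x = b, y = c | y = d] -> P (pt x y).

Lemma on_rect_bdry P : on_rect P -> on_bdry P.
Proof. by move=> h x y hx hy _; exact: h. Qed.

Hypotheses (ab : a <= b) (cd : c <= d).

Lemma on_bdryE P : on_bdry P ->
  [/\ (forall t, c <= t <= d -> P (pt b 0 + t *: i)),
      (forall t, c <= t <= d -> P (pt a 0 + t *: i)),
      (forall t, a <= t <= b -> P (pt 0 d + t *: 1)) &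
      (forall t, a <= t <= b -> P (pt 0 c + t *: 1))].
Proof.
move=> h; split=> t ht; rewrite ?vert_ptE ?horiz_ptE; apply: h => //;
  rewrite ?lexx ?ab ?cd//.
- exact: Or42.
- exact: Or41.
- exact: Or44.
- exact: Or43.
Qed.

Lemma bdB u F G : on_bdry (hol F) -> on_bdry (hol G) ->
  bd u (fun z => F z - G z) = bd u F - bd u G.
Proof.
move=> /on_bdryE[F1 F2 F3 F4] /on_bdryE[G1 G2 G3 G4].
rewrite /bd !edgeB//; try exact: slice_slice_pt; try exact: slicei; try exact: slice1.
move: (edge u F _ _ _ _) (edge u F _ _ _ _) (edge u F _ _ _ _) (edge u F _ _ _ _).
move: (edge u G _ _ _ _) (edge u G _ _ _ _) (edge u G _ _ _ _) (edge u G _ _ _ _).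
by move=> *; ring.
Qed.

Definition bd_norm (G : H -> H) : R :=
  itg (fun t => `|G (pt b t)|) c d + itg (fun t => `|G (pt a t)|) c d +
  (itg (fun t => `|G (pt t d)|) a b + itg (fun t => `|G (pt t c)|) a b).

Lemma bd_le u G : on_bdry (hol G) -> `|bd u G| <= `|u| * bd_norm G.
Proof.
move=> /on_bdryE[G1 G2 G3 G4].
have S := slice_slice_pt i; have Si := slicei i; have S1 := slice1 i.
have := edge_le u (S b 0) Si G1; have := edge_le u (S a 0) Si G2.
have := edge_le u (S 0 d) S1 G3; have := edge_le u (S 0 c) S1 G4.
case: hi => _ ->; rewrite normq1 !mulr1.
under [X in _ <= _ * itg X _ _ -> _]eq_fun do rewrite horiz_ptE.
under [X in _ -> _ <= _ * itg X _ _ -> _]eq_fun do rewrite horiz_ptE.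
under [X in _ -> _ -> _ <= _ * itg X _ _ -> _]eq_fun do rewrite vert_ptE.
under [X in _ -> _ -> _ -> _ <= _ * itg X _ _ -> _]eq_fun do rewrite vert_ptE.
rewrite /bd /bd_norm !mulrDr.
move: (edge _ _ _ _ _ _) (edge _ _ _ _ _ _) (edge _ _ _ _ _ _) (edge _ _ _ _ _ _).
move=> x y z w h1 h2 h3 h4.
have := ler_normB (x - y) (z - w); have := ler_normB x y; have := ler_normB z w.
lra.
Qed.

Lemma bd_norm_le G B M : on_bdry (hol G) -> on_bdry (fun z => `|G z| <= B) -> 0 <= B ->
  b - a <= M -> d - c <= M -> bd_norm G <= 4 * B * M.
Proof.
move=> /on_bdryE[G1 G2 G3 G4] /on_bdryE[B1 B2 B3 B4] B0 Ma Mc.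
have S := slice_slice_pt i; have Si := slicei i; have S1 := slice1 i.
have aux p q t1 t2 : slice i p -> slice i q -> t1 <= t2 -> t2 - t1 <= M ->
   (forall t, t1 <= t <= t2 -> hol G (p + t *: q)) ->
   (forall t, t1 <= t <= t2 -> `|G (p + t *: q)| <= B) ->
   itg (fun t => `|G (p + t *: q)|) t1 t2 <= B * M.
  move=> Sp Sq t12 tM hG hB.
  apply: le_trans (_ : B * (t2 - t1) <= _); last by rewrite ler_wpM2l.
  rewrite -itg_cst//; apply: le_itg => //; last exact: cont_on_cst.
  exact/cont_on_norm/(edge_cont 0).
have := aux _ _ _ _ (S b 0) Si cd Mc G1 B1; have := aux _ _ _ _ (S a 0) Si cd Mc G2 B2.
have := aux _ _ _ _ (S 0 d) S1 ab Ma G3 B3; have := aux _ _ _ _ (S 0 c) S1 ab Ma G4 B4.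
under [X in itg X _ _ <= _ -> _]eq_fun do rewrite horiz_ptE.
under [X in _ -> itg X _ _ <= _ -> _]eq_fun do rewrite horiz_ptE.
under [X in _ -> _ -> itg X _ _ <= _ -> _]eq_fun do rewrite vert_ptE.
under [X in _ -> _ -> _ -> itg X _ _ <= _ -> _]eq_fun do rewrite vert_ptE.
rewrite /bd_norm; lra.
Qed.

Variables (m M : R).
Definition deep (x0 y0 : R) := [/\ m <= b - x0, m <= x0 - a, m <= d - y0 & m <= y0 - c].
Hypotheses (m0 : 0 < m) (aM : b - a <= M) (cM : d - c <= M).

Lemma deep_bdry x0 y0 : deep x0 y0 -> on_bdry (fun z => m <= `|z - pt x0 y0|).
Proof.
move: (m0) (ab) (cd) (aM) (cM) => m0' ab' cd' aM' cM'.
move=> [h1 h2 h3 h4] x y _ _ h; rewrite slice_ptB.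
have [g1 g2] := norm_slice_pt_ge (x - x0) (y - y0).
by case: h => e; rewrite e in g1 g2 *;
  [apply: le_trans g1|apply: le_trans g1|apply: le_trans g2|apply: le_trans g2];
  rewrite ler_normr; apply/orP; [right|left|right|left]; lra.
Qed.

Lemma bdry_neq x0 y0 : deep x0 y0 -> on_bdry (fun z => z != pt x0 y0).
Proof.
move: (m0) (ab) (cd) (aM) (cM) => m0' ab' cd' aM' cM'.
move=> h x y hx hy hb; have := deep_bdry h hx hy hb.
by rewrite -subr_eq0 -normr_gt0; exact: lt_le_trans.
Qed.

Lemma hol_quot_bdry w x0 y0 k : deep x0 y0 -> on_rect (hol w) ->
  on_bdry (hol (fun z => (z - pt x0 y0)^-1 * (w z - k))).
Proof.
move: (m0) (ab) (cd) (aM) (cM) => m0' ab' cd' aM' cM'.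
move=> h hw x y hx hy hb; apply: holomorphic_quot => //; try exact: slice_slice_pt.
  exact: bdry_neq h _ _ hx hy hb.
exact: hw.
Qed.

Lemma hol_quot_bdry0 (w : H -> H) x0 y0 : deep x0 y0 -> on_rect (hol w) ->
  on_bdry (hol (fun z => (z - pt x0 y0)^-1 * w z)).
Proof.
move=> h hw; have := hol_quot_bdry (0) h hw; congr (on_bdry (hol _)).
by apply/funext => z; rewrite subr0.
Qed.

Lemma hol_quot_cst x0 y0 (k : H) : deep x0 y0 ->
  on_bdry (hol (fun z => (z - pt x0 y0)^-1 * k)).
Proof.
move=> h; apply: (@hol_quot_bdry0 (fun=> k)) => // x y _ _.
by exists 0; exact: holo_cst.
Qed.

(** By [edge_radial] each edge is a difference of radial terms up to a small
    error, and over the closed boundary these terms cancel at the corners.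
    Subtracting [w z0] is what removes the residue. *)
Lemma cauchy_bd w u x0 y0 : deep x0 y0 -> on_rect (hol w) ->
  bd u (fun z => (z - pt x0 y0)^-1 * (w z - w (pt x0 y0))) = 0.
Proof.
move: (m0) (ab) (cd) (aM) (cM) => m0' ab' cd' aM' cM'.
move=> h hw; have [h1 h2 h3 h4] := h.
have S := slice_slice_pt i; have Si := slicei i; have S1 := slice1 i.
set Psi := fun z => _.
suff small (e : R) : 0 < e -> `|bd u Psi| <= e.
  by apply/eqP; rewrite -normr_le0; apply/ler_addgt0Pl => e e0; rewrite addr0 small.
move=> e0; have e4 : 0 < e / 4 by lra.
have [D1 D2 D3 D4] := on_bdryE (deep_bdry h).
have hs (x y s : R) : a <= x <= b -> c <= y <= d -> 0 <= s <= 1 ->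
    hol w (pt x0 y0 + s *: (pt x y - pt x0 y0)).
  move=> /andP[ax xb] /andP[cy yd] /andP[s0 s1].
  rewrite slice_ptB slice_ptZ slice_ptD; apply: hw.
    have : s * (x0 - a) <= x0 - a by rewrite ler_piMl//; lra.
    have : s * (b - x0) <= b - x0 by rewrite ler_piMl//; lra.
    have : 0 <= s * (x - a) by rewrite mulr_ge0//; lra.
    have : 0 <= s * (b - x) by rewrite mulr_ge0//; lra.
    lra.
  have : s * (y0 - c) <= y0 - c by rewrite ler_piMl//; lra.
  have : s * (d - y0) <= d - y0 by rewrite ler_piMl//; lra.
  have : 0 <= s * (y - c) by rewrite mulr_ge0//; lra.
  have : 0 <= s * (d - y) by rewrite mulr_ge0//; lra.
  lra.
have haa : a <= a <= b by rewrite lexx ab.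
have hbb : a <= b <= b by rewrite lexx ab.
have hcc : c <= c <= d by rewrite lexx cd.
have hdd : c <= d <= d by rewrite lexx cd.
have [|r1 r10 k1] := edge_radial (w := w) hi u (S x0 y0) (S b 0) Si cd m0 D1 _ e4.
  by move=> s t ? ?; rewrite vert_ptE; apply: hs.
have [|r2 r20 k2] := edge_radial (w := w) hi u (S x0 y0) (S a 0) Si cd m0 D2 _ e4.
  by move=> s t ? ?; rewrite vert_ptE; apply: hs.
have [|r3 r30 k3] := edge_radial (w := w) hi u (S x0 y0) (S 0 d) S1 ab m0 D3 _ e4.
  by move=> s t ? ?; rewrite horiz_ptE; apply: hs.
have [|r4 r40 k4] := edge_radial (w := w) hi u (S x0 y0) (S 0 c) S1 ab m0 D4 _ e4.
  by move=> s t ? ?; rewrite horiz_ptE; apply: hs.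
pose s := Num.min (Num.min r1 r2) (Num.min (Num.min r3 r4) 1) / 2.
have m_gt0 : 0 < Num.min (Num.min r1 r2) (Num.min (Num.min r3 r4) 1).
  by rewrite !lt_min r10 r20 r30 r40 ltr01.
have [s0 [s1 [s2 [s3 [s4 s5]]]]] : 0 < s /\ (s < r1 /\ (s < r2 /\ (s < r3 /\ (s < r4 /\ s < 1)))).
  have : s < Num.min (Num.min r1 r2) (Num.min (Num.min r3 r4) 1) by rewrite /s ltr_pdivrMr// ltr_pMr// ltr1n.
  rewrite !lt_min => /andP[/andP[? ?] /andP[/andP[? ?] ?]].
  by split; first by rewrite /s divr_gt0.
have := k1 s; have := k2 s; have := k3 s; have := k4 s.
rewrite !vert_ptE !horiz_ptE s0 s1 s2 s3 s4 => /(_ isT s5) + /(_ isT s5) + /(_ isT s5) + /(_ isT s5).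
rewrite /bd -/Psi.
move: (edge _ _ _ _ _ _) (edge _ _ _ _ _ _) (edge _ _ _ _ _ _) (edge _ _ _ _ _ _).
move=> E4 E3 E2 E1.
move: (radial _ _ _ _ _) (radial _ _ _ _ _) (radial _ _ _ _ _) (radial _ _ _ _ _).
move=> x y z t; rewrite !ler_norml.
lra.
Qed.

Lemma kernel_vert (x0 y0 : R) (k : H) (t x : R) : (x - x0 != 0) || (t - y0 != 0) ->
  qre (conjq k * - i * (i * ((pt x 0 + t *: i - pt x0 y0)^-1 * k))) =
  `|k| ^+ 2 * ((x - x0) / ((x - x0) ^+ 2 + (t - y0) ^+ 2)).
Proof.
move: (m0) (ab) (cd) (aM) (cM) => m0' ab' cd' aM' cM'.
move=> h; rewrite vert_ptE slice_ptB slice_ptV// !mulrA -(mulrA (conjq k)) mulNr.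
rewrite (sphere_sqr hi) opprK mulr1 conjqM_re.
by rewrite (qre_slice_pt hi) mulrA.
Qed.

Lemma kernel_horiz (x0 y0 : R) (k : H) (t y : R) : (t - x0 != 0) || (y - y0 != 0) ->
  qre (conjq k * - i * (1 * ((pt 0 y + t *: 1 - pt x0 y0)^-1 * k))) =
  - (`|k| ^+ 2 * ((y - y0) / ((t - x0) ^+ 2 + (y - y0) ^+ 2))).
Proof.
move: (m0) (ab) (cd) (aM) (cM) => m0' ab' cd' aM' cM'.
move=> h; rewrite horiz_ptE slice_ptB slice_ptV// mul1r !mulrA -(mulrA (conjq k)).
rewrite conjqM_re mulNr -[qre (- _)]/(- qre _) -/(imc i _).
by rewrite (imc_slice_pt hi) mulNr mulrN mulrA.
Qed.

(** With the multiplier [conjq k * - i] the integrand is a positive multiple of the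
    angular form around [z0], nonnegative on every edge; the right-hand edge
    alone gives the lower bound. This avoids the exact value of the winding
    integral. *)
Lemma winding_ge x0 y0 (k : H) : deep x0 y0 ->
  `|k| ^+ 2 * (m ^+ 2 / M ^+ 2) <=
  bd (conjq k * - i) (fun z => (z - pt x0 y0)^-1 * k).
Proof.
move: (m0) (ab) (cd) (aM) (cM) => m0' ab' cd' aM' cM'.
move=> h; have [h1 h2 h3 h4] := h.
set G := fun z : H => (z - pt x0 y0)^-1 * k.
have M0 : 0 < M by lra.
have [xa xb yc yd] : [/\ a < x0, x0 < b, c < y0 & y0 < d] by split; lra.
have hbM : b - x0 <= M by lra.
have hdc : m <= (d - c) / 2 by lra.
have htM t : c <= t <= d -> - M <= t - y0 <= M by move=> /andP[? ?]; lra.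
have hG : on_bdry (hol G) by exact: hol_quot_cst.
have k2 : 0 <= `|k| ^+ 2 by rewrite sqr_ge0.
have S := slice_slice_pt i; have Si := slicei i; have S1 := slice1 i.
have [G1 G2 G3 G4] := on_bdryE hG.
have C1 := cont_on_qre (conjq k * - i) i (edge_cont 0 (S b 0) Si G1).
have C2 := cont_on_qre (conjq k * - i) i (edge_cont 0 (S a 0) Si G2).
have C3 := cont_on_qre (conjq k * - i) 1 (edge_cont 0 (S 0 d) S1 G3).
have C4 := cont_on_qre (conjq k * - i) 1 (edge_cont 0 (S 0 c) S1 G4).
have E1 : `|k| ^+ 2 * (m ^+ 2 / M ^+ 2) <= edge (conjq k * - i) G (pt b 0) i c d.
  apply: (@le_trans _ _ (`|k| ^+ 2 * (m / (2 * M ^+ 2)) * (d - c))).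
    rewrite -mulrA ler_wpM2l//.
    rewrite (_ : m / (2 * M ^+ 2) * (d - c) = m * ((d - c) / 2) / M ^+ 2); last first.
      by field; rewrite gt_eqF.
    by rewrite expr2 ler_pM2r ?invr_gt0 ?exprn_gt0// ler_pM2l.
  rewrite -itg_cst//; apply: le_itg => //; first exact: cont_on_cst.
  move=> t ht; rewrite kernel_vert; last by rewrite subr_eq0 (gt_eqF xb).
  by rewrite ler_wpM2l// kernel_lower// htM.
have E2 : edge (conjq k * - i) G (pt a 0) i c d <= 0 * (d - c).
  rewrite -itg_cst//; apply: le_itg => //; first exact: cont_on_cst.
  move=> t ht; rewrite kernel_vert; last by rewrite subr_eq0 (lt_eqF xa).
  rewrite mulr_ge0_le0// mulr_le0_ge0//; first by rewrite subr_le0 ltW.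
  by rewrite invr_ge0 addr_ge0// sqr_ge0.
have E3 : edge (conjq k * - i) G (pt 0 d) 1 a b <= 0 * (b - a).
  rewrite -itg_cst//; apply: le_itg => //; first exact: cont_on_cst.
  move=> t ht; rewrite kernel_horiz; last by rewrite !subr_eq0 (gt_eqF yd) orbT.
  rewrite oppr_le0 mulr_ge0// divr_ge0//; first by rewrite subr_ge0 ltW.
  by rewrite addr_ge0// sqr_ge0.
have E4 : 0 * (b - a) <= edge (conjq k * - i) G (pt 0 c) 1 a b.
  rewrite -itg_cst//; apply: le_itg => //; first exact: cont_on_cst.
  move=> t ht; rewrite kernel_horiz; last by rewrite !subr_eq0 (lt_eqF yc) orbT.
  rewrite oppr_ge0 mulr_ge0_le0// mulr_le0_ge0//; first by rewrite subr_le0 ltW.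
  by rewrite invr_ge0 addr_ge0// sqr_ge0.
rewrite mul0r in E2 E3 E4; rewrite /bd -/G -[leLHS]subr0 lerB//; last by rewrite subr_le0 (le_trans E3).
by rewrite -[leLHS]subr0 lerB.
Qed.

(** [cauchy_bd] identifies the boundary integrals of [(z - z0)^-1 w] and of
    [(z - z0)^-1 w(z0)]; the first is bounded by the size of [w] on the boundary
    and the second is bounded below by [winding_ge]. *)
Lemma cauchy_estimate w x0 y0 : deep x0 y0 -> on_rect (hol w) ->
  m ^+ 3 * `|w (pt x0 y0)| <= M ^+ 2 * bd_norm w.
Proof.
move: (m0) (ab) (cd) (aM) (cM) => m0' ab' cd' aM' cM'.
move=> h hw; have [h1 h2 h3 h4] := h; set w0 := w _.
have S := slice_slice_pt i.
have M0 : 0 < M by lra.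
have hwb := on_rect_bdry hw.
have hq1 : on_bdry (hol (fun z => (z - pt x0 y0)^-1 * w z)) by exact: hol_quot_bdry0.
have hq2 : on_bdry (hol (fun z => (z - pt x0 y0)^-1 * w0)) by exact: hol_quot_cst.
have := cauchy_bd (conjq w0 * - i) h hw.
rewrite (_ : (fun z => _) = (fun z => (z - pt x0 y0)^-1 * w z - (z - pt x0 y0)^-1 * w0)); last first.
  by apply/funext => z; rewrite mulrBr.
rewrite bdB// => /eqP; rewrite subr_eq0 => /eqP e.
have := winding_ge w0 h; rewrite -e => k1.
have k2 := le_trans (ler_norm _) (bd_le (conjq w0 * - i) hq1).
have k3 : bd_norm (fun z => (z - pt x0 y0)^-1 * w z) <= m^-1 * bd_norm w.
  have [D1 D2 D3 D4] := on_bdryE (deep_bdry h).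
  have [G1 G2 G3 G4] := on_bdryE hq1.
  have [W1 W2 W3 W4] := on_bdryE hwb.
  have aux p q t1 t2 : slice i p -> slice i q -> t1 <= t2 ->
     (forall t, t1 <= t <= t2 -> hol (fun z => (z - pt x0 y0)^-1 * w z) (p + t *: q)) ->
     (forall t, t1 <= t <= t2 -> hol w (p + t *: q)) ->
     (forall t, t1 <= t <= t2 -> m <= `|p + t *: q - pt x0 y0|) ->
     itg (fun t => `|(p + t *: q - pt x0 y0)^-1 * w (p + t *: q)|) t1 t2 <=
     m^-1 * itg (fun t => `|w (p + t *: q)|) t1 t2.
    move=> Sp Sq t12 hG hW hm; have cw := cont_on_norm (edge_cont 0 Sp Sq hW).
    rewrite -itgZ//; apply: le_itg => //.
    - exact/cont_on_norm/(edge_cont 0 Sp Sq hG).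
    - move=> t ht e0 e00; have [r r0 hr] := cw t ht _ (mulr_gt0 m0 e00).
      exists r => // t' ht' tr; rewrite -mulrBr normrM gtr0_norm ?invr_gt0//.
      by rewrite mulrC ltr_pdivrMr// mulrC; exact: hr.
    - move=> t ht; rewrite Defs.normqM ler_wpM2r// normqV lef_pV2 ?posrE ?hm//.
      exact: lt_le_trans (hm t ht).
  have Si := slicei i; have S1 := slice1 i.
  have := aux _ _ _ _ (S b 0) Si cd G1 W1 D1; have := aux _ _ _ _ (S a 0) Si cd G2 W2 D2.
  have := aux _ _ _ _ (S 0 d) S1 ab G3 W3 D3; have := aux _ _ _ _ (S 0 c) S1 ab G4 W4 D4.
  under [X in itg X _ _ <= _ -> _]eq_fun do rewrite horiz_ptE.
  under [X in _ <= _ * itg X _ _ -> _]eq_fun do rewrite horiz_ptE.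
  under [X in _ -> itg X _ _ <= _ -> _]eq_fun do rewrite horiz_ptE.
  under [X in _ -> _ <= _ * itg X _ _ -> _]eq_fun do rewrite horiz_ptE.
  under [X in _ -> _ -> itg X _ _ <= _ -> _]eq_fun do rewrite vert_ptE.
  under [X in _ -> _ -> _ <= _ * itg X _ _ -> _]eq_fun do rewrite vert_ptE.
  under [X in _ -> _ -> _ -> itg X _ _ <= _ -> _]eq_fun do rewrite vert_ptE.
  under [X in _ -> _ -> _ -> _ <= _ * itg X _ _ -> _]eq_fun do rewrite vert_ptE.
  by move=> j4 j3 j2 j1; rewrite /bd_norm !mulrDr !lerD.
have nu : `|conjq w0 * - i| = `|w0|.
  by rewrite Defs.normqM norm_conjq normrN; case: hi => _ ->; rewrite mulr1.
rewrite nu in k2.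
have [->|w00] := eqVneq w0 0.
  rewrite normr0 mulr0 mulr_ge0 ?sqr_ge0//.
  rewrite /bd_norm !addr_ge0//; exact: Rintegral_ge0.
have nw : 0 < `|w0| by rewrite normr_gt0.
have : `|w0| ^+ 2 * (m ^+ 2 / M ^+ 2) <= `|w0| * (m^-1 * bd_norm w).
  by rewrite (le_trans k1)// (le_trans k2)// ler_wpM2l.
rewrite expr2 -mulrA ler_pM2l// => k4.
have mM : 0 < m * M ^+ 2 by rewrite mulr_gt0// exprn_gt0.
move: k4; rewrite -(ler_pM2l mM).
rewrite (_ : m * M ^+ 2 * (`|w0| * (m ^+ 2 / M ^+ 2)) = m ^+ 3 * `|w0|); last first.
  by field; rewrite gt_eqF.
by rewrite (_ : m * M ^+ 2 * (m^-1 * _) = M ^+ 2 * bd_norm w)//; field; rewrite gt_eqF.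
Qed.

(** Cauchy's formula at two points of the same rectangle, subtracted: the two
    kernels differ by a multiple of the distance of the points. *)
Lemma cauchy_lipschitz w x1 y1 x2 y2 B : deep x1 y1 -> deep x2 y2 ->
  on_rect (hol w) -> on_rect (fun z => `|w z| <= B) ->
  m ^+ 4 * `|w (pt x1 y1) - w (pt x2 y2)| <= 8 * M ^+ 3 * B * `|pt x1 y1 - pt x2 y2|.
Proof.
move: (m0) (ab) (cd) (aM) (cM) => m0' ab' cd' aM' cM'.
move=> h1 h2 hw hB; have [g1 g2 g3 g4] := h1; have [g5 g6 g7 g8] := h2.
set z1 := pt x1 y1; set z2 := pt x2 y2; set k := w z1 - w z2.
have M0 : 0 < M by lra.
have B0 : 0 <= B by apply: le_trans (hB x1 y1 _ _); rewrite ?normr_ge0//; lra.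
have [->|k0] := eqVneq k 0.
  by rewrite normr0 mulr0 !mulr_ge0 ?exprn_ge0 ?(ltW M0).
have nk : 0 < `|k| by rewrite normr_gt0.
set u := conjq k * - i.
have nu : `|u| = `|k|.
  by rewrite Defs.normqM norm_conjq normrN; case: hi => _ ->; rewrite mulr1.
have q1 := hol_quot_bdry (w z2) h1 hw.
have q2 := hol_quot_bdry (w z2) h2 hw.
have qk : on_bdry (hol (fun z => (z - z1)^-1 * k)) by exact: hol_quot_cst.
have e1 : bd u (fun z => (z - z1)^-1 * (w z - w z2)) = bd u (fun z => (z - z1)^-1 * k).
  have := cauchy_bd u h1 hw; rewrite -/z1.
  rewrite (_ : (fun z => (z - z1)^-1 * (w z - w z1)) =
     (fun z => (z - z1)^-1 * (w z - w z2) - (z - z1)^-1 * k)); last first.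
    by apply/funext => z; rewrite -mulrBr; congr (_ * _); rewrite /k opprB addrA subrK.
  by rewrite bdB// => /eqP; rewrite subr_eq0 => /eqP.
have e2 : bd u (fun z => (z - z2)^-1 * (w z - w z2)) = 0 by exact: cauchy_bd.
have qd : on_bdry (hol (fun z => (z - z1)^-1 * (w z - w z2) - (z - z2)^-1 * (w z - w z2))).
  move=> x y hx hy hb; have [p1 hp1] := q1 x y hx hy hb; have [p2 hp2] := q2 x y hx hy hb.
  by exists (p1 - p2); exact: holo_sub.
have e3 := winding_ge k h1; rewrite -/u -/z1 -e1 in e3.
rewrite -[X in _ <= X]subr0 -e2 -bdB// in e3.
have {e3} := le_trans e3 (le_trans (ler_norm _) (bd_le u qd)).
have bn : bd_norm (fun z => (z - z1)^-1 * (w z - w z2) - (z - z2)^-1 * (w z - w z2)) <=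
    4 * (m^-1 * m^-1 * `|z1 - z2| * (2 * B)) * M.
  apply: bd_norm_le => //; last by rewrite !mulr_ge0 ?invr_ge0// ltW.
  move=> x y hx hy hb.
  have d1 := deep_bdry h1 hx hy hb; have d2 := deep_bdry h2 hx hy hb.
  have n1 := bdry_neq h1 hx hy hb; have n2 := bdry_neq h2 hx hy hb.
  set z := pt x y in d1 d2 n1 n2 *.
  rewrite -mulrBl -/z1 -/z2 in d1 d2 n1 n2 *.
  have -> : (z - z1)^-1 - (z - z2)^-1 = (z - z1)^-1 * (z1 - z2) * (z - z2)^-1.
    rewrite -subr_eq0 in n1; rewrite -subr_eq0 in n2.
    rewrite (_ : z1 - z2 = (z - z2) - (z - z1)); last by rewrite opprB [RHS]addrC addrA subrK.
    rewrite mulrBr mulrBl mulVr ?unitqE// -mulrA mulrV ?unitqE// mulr1.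
    by rewrite mul1r.
  rewrite !Defs.normqM !normqV.
  have i1 : `|z - z1|^-1 <= m^-1 by rewrite lef_pV2 ?posrE// (lt_le_trans m0).
  have i2 : `|z - z2|^-1 <= m^-1 by rewrite lef_pV2 ?posrE// (lt_le_trans m0).
  have b1 : `|w z - w z2| <= 2 * B.
    have := ler_normB (w z) (w z2); have := hB x y hx hy.
    by have := hB x2 y2; rewrite -/z -/z2; lra.
  rewrite ler_pM ?mulr_ge0 ?invr_ge0//.
  rewrite (mulrAC m^-1) ler_pM ?mulr_ge0 ?invr_ge0//.
  by rewrite ler_wpM2r.
move=> /le_trans /(_ (ler_wpM2l (normr_ge0 u) bn)); rewrite nu expr2 -mulrA ler_pM2l//.
have mM : 0 < m ^+ 2 * M ^+ 2 by rewrite mulr_gt0// exprn_gt0.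
rewrite -(ler_pM2l mM).
rewrite (_ : m ^+ 2 * M ^+ 2 * (`|k| * (m ^+ 2 / M ^+ 2)) = m ^+ 4 * `|k|); last first.
  by field; rewrite gt_eqF.
move=> /le_trans; apply.
by rewrite le_eqVlt; apply/orP; left; apply/eqP; field; rewrite gt_eqF.
Qed.

End Rect.
End CauchyRect.

(** * Estimates for the derivative *)

Section Derivative.
Variable R : realType.
Local Notation H := (quat R).

Lemma is_derive_eps (U : normedModType R) (f : R -> U) (x : R) (D : U) :
  (forall e, 0 < e -> exists2 d, 0 < d & forall y : R, `|y - x| < d ->
    `|f y - f x - (y - x) *: D| <= e * `|y - x|) ->
  is_derive (x : R^o) (1 : R^o) (f : R^o -> U) D.
Proof.
move=> hf.
have cf : h^-1 *: (f (h *: (1 : R^o) + x) - f x) @[h --> 0^'] --> D.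
  apply/cvgrPdist_le => e e0; have [d d0 hd] := hf e e0.
  rewrite near_withinE; apply/nbhs_ballP; exists d => //= h.
  rewrite /ball/= sub0r normrN => hd' h0.
  have := hd (h *: (1 : R^o) + x); rewrite addrK [h *: _]mulr1 => /(_ hd') hh.
  have nh : 0 < `|h| by rewrite normr_gt0.
  rewrite distrC (_ : _ - D = h^-1 *: (f (h + x) - f x - h *: D)); last first.
    by rewrite [in RHS]scalerBr scalerA mulVf// scale1r.
  by rewrite normrZ normfV mulrC ler_pdivrMr.
by apply: DeriveDef; [apply/cvg_ex; exists D|exact: cvg_lim].
Qed.

Variables (i : H) (hi : imag_sphere i).
Local Notation pt := (slice_pt i).
Local Notation hol := (holomorphic_at i).

(** The scalar mean value theorem for the component of [w] in the direction of
    the increment itself. *)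
Lemma mvt_slice (w w1 : H -> H) (z1 z2 : H) (C : R) : slice i z1 -> slice i z2 ->
  (forall s : R, 0 <= s <= 1 -> holo i w (z1 + s *: (z2 - z1)) (w1 (z1 + s *: (z2 - z1)))) ->
  (forall s : R, 0 <= s <= 1 -> `|w1 (z1 + s *: (z2 - z1))| <= C) ->
  `|w z2 - w z1| <= C * `|z2 - z1|.
Proof.
move=> S1 S2 hw hC; set k := w z2 - w z1.
have [->|k0] := eqVneq k 0.
  by rewrite normr0 mulr_ge0// (le_trans _ (hC 0 _))// lexx ler01.
have nk : 0 < `|k| by rewrite normr_gt0.
pose phi (s : R) := qre (conjq k * w (z1 + s *: (z2 - z1))).
pose dphi (s : R) := qre (conjq k * ((z2 - z1) * w1 (z1 + s *: (z2 - z1)))).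
have dP (s : R) : 0 <= s <= 1 -> is_derive (s : R^o) (1 : R^o) (phi : R^o -> R^o) (dphi s).
  move=> hs; apply: is_derive_eps => e e0.
  have D0 : 0 < `|k| * (`|z2 - z1| + 1) by rewrite mulr_gt0// ltr_wpDl.
  have D1 : 0 < `|z2 - z1| + 1 by rewrite ltr_wpDl.
  have [d d0 hd] := hw s hs _ (divr_gt0 e0 D0).
  exists (d / (`|z2 - z1| + 1)); first by rewrite divr_gt0.
  move=> y; rewrite ltr_pdivlMr// => yd.
  have zz : z1 + y *: (z2 - z1) - (z1 + s *: (z2 - z1)) = (y - s) *: (z2 - z1).
    by rewrite opprD addrACA subrr add0r -scalerBl.
  have Sy : slice i (z1 + y *: (z2 - z1)) by apply: sliceD => //; apply/sliceZ/sliceB.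
  have yd' : `|y - s| * `|z2 - z1| < d.
    by apply: le_lt_trans yd; rewrite ler_wpM2l// lerDl.
  have := hd _ Sy; rewrite zz normrZ => /(_ yd').
  set X := (X in `|X| <= _) => hX.
  rewrite (_ : _ - _ = qre (conjq k * X)); last first.
    by rewrite /phi /dphi /X -scalerAl /GRing.scale /=; ring.
  case: (normq_comps (conjq k * X)) => h _ _ _; rewrite (le_trans h)//.
  rewrite Defs.normqM norm_conjq mulrC -ler_pdivlMr// (le_trans hX)//.
  rewrite (_ : _ * _ = e * `|y - s| / `|k| * (`|z2 - z1| / (`|z2 - z1| + 1))); last first.
    by field; rewrite !gt_eqF.
  rewrite ler_piMr ?mulr_ge0 ?invr_ge0 ?(ltW e0)//.
  by rewrite ler_pdivrMr// mul1r lerDl.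
have cphi : {within `[0, 1]%classic, continuous (phi : R^o -> R^o)}.
  apply: derivable_within_continuous => s; rewrite in_itv/= => hs.
  by have [] := dP s hs.
have [|c] := @MVT R phi dphi 0 1 ltr01 _ cphi.
  by move=> s; rewrite in_itv/= => /andP[s0 s1]; apply: dP; rewrite !ltW.
rewrite in_itv/= subr0 mulr1 => /andP[c0 c1].
rewrite /phi scale1r scale0r addr0 (addrC z1) subrK.
have -> : qre (conjq k * w z2) - qre (conjq k * w z1) = qre (conjq k * 1 * k).
  by rewrite mulr1 /k mulrBr.
rewrite conjqM_re mulr1 => hk.
have hc : `|w1 (z1 + c *: (z2 - z1))| <= C by apply: hC; rewrite !ltW.
have : `|k| ^+ 2 <= `|k| * (C * `|z2 - z1|).
  rewrite hk /dphi; case: (normq_comps (conjq k * ((z2 - z1) * w1 (z1 + c *: (z2 - z1))))) => h _ _ _.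
  rewrite (le_trans (ler_norm _))// (le_trans h)// !Defs.normqM norm_conjq.
  by rewrite ler_wpM2l// mulrC ler_wpM2r.
by rewrite expr2 ler_pM2l.
Qed.

Lemma hol_bounded_rect (w : H -> H) (a b c d : R) : a <= b -> c <= d ->
  on_rect i a b c d (hol w) -> exists B, on_rect i a b c d (fun z => `|w z| <= B).
Proof.
move=> ab cd hw.
apply: (@locally_bounded_rect _ (fun x y => `|w (pt x y)|)) => // s t hs ht.
have [p hp] := hw s t hs ht.
have [r r0 hr] := diff_within_cont (bdd_holo p) hp ltr01.
exists (r / 2); first by rewrite divr_gt0.
exists (`|w (pt s t)| + 1) => s' t' _ _ sr tr.
have := hr (pt s' t') (slice_slice_pt _ _ _); rewrite slice_ptB.
have := norm_slice_pt_le hi (s' - s) (t' - t) => h1 /(_ ltac:(lra)) h2.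
by rewrite -[X in `|X|](subrK (w (pt s t))) (le_trans (ler_normD _ _))// addrC lerD2l ltW.
Qed.

Definition dquot (h : R) (w : H -> H) (z : H) : H := h^-1 *: (w (z + h%:A) - w z).

Lemma hol_dquot (w : H -> H) h z : slice i z -> hol w z -> hol w (z + h%:A) ->
  hol (dquot h w) z.
Proof.
move=> Sz [p hp] [q hq]; exists ((h^-1)%:A * (1 * q - p)).
have -> : dquot h w = fun z => (h^-1)%:A * (w (z + h%:A) - w z).
  by apply/funext => x; rewrite /dquot scaleqE.
apply: holo_mull => //; first exact: sliceA.
apply: holo_sub; last exact: hp.
apply: (@holo_comp _ i (fun z => z + h%:A) w z 1 q) => //.
- by move=> x Sx; apply: sliceD => //; exact: sliceA.
- by have := holo_add (holo_id i z) (holo_cst i h%:A z); rewrite addr0.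
Qed.

Lemma dquot_lim (w : H -> H) z p : slice i z -> holo i w z p ->
  forall e, 0 < e -> exists2 r, 0 < r & forall h, 0 < h < r -> `|dquot h w z - p| <= e.
Proof.
move=> Sz hp e e0; have [r r0 hr] := hp e e0; exists r => // h /andP[h0 hr'].
have Szh : slice i (z + h%:A) by apply: sliceD => //; exact: sliceA.
have := hr _ Szh; rewrite [z + _ - z]addrC addKr normqA gtr0_norm// => /(_ hr') hh.
rewrite /dquot.
rewrite (_ : h^-1 *: _ - p = h^-1 *: (w (z + h%:A) - w z - h%:A * p)); last first.
  by rewrite -scaleqE [in RHS]scalerBr scalerA mulVf ?gt_eqF// scale1r.
by rewrite normrZ gtr0_norm ?invr_gt0// mulrC ler_pdivrMr.
Qed.

Lemma itv_sub (a b a' b' x : R) : a' <= a -> b <= b' -> a <= x <= b -> a' <= x <= b'.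
Proof. by move=> ha hb /andP[h1 h2]; rewrite (le_trans ha h1) (le_trans h2 hb). Qed.

Lemma itv_shift (a b a' b' x u r : R) : a' <= a -> b + r <= b' -> 0 <= u -> u <= r ->
  a <= x <= b -> a' <= x + u <= b'.
Proof. by move=> ha hb u0 ur /andP[h1 h2]; apply/andP; split; lra. Qed.

Lemma margins (a b rho : R) : 0 < rho ->
  [/\ a - rho <= a, b + rho <= b + 4 * rho, a - 4 * rho <= a - rho &
   [/\ b <= b + rho, a - 3 * rho <= a - 2 * rho & b + 2 * rho + rho <= b + 3 * rho]].
Proof. by move=> r0; do 2?[split]; lra. Qed.

Lemma cauchy_lipschitz_margin (v : H -> H) (a b c d a' b' c' d' r M B : R) :
  a <= b -> c <= d -> 0 < r ->
  [/\ a' = a - r, b' = b + r, c' = c - r & d' = d + r] ->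
  b' - a' <= M -> d' - c' <= M ->
  on_rect i a' b' c' d' (hol v) -> on_rect i a' b' c' d' (fun z => `|v z| <= B) ->
  forall x1 y1 x2 y2 : R, a <= x1 <= b -> c <= y1 <= d -> a <= x2 <= b -> c <= y2 <= d ->
    `|v (pt x1 y1) - v (pt x2 y2)| <= 8 * M ^+ 3 * B / r ^+ 4 * `|pt x1 y1 - pt x2 y2|.
Proof.
move=> ab cd r0 [-> -> -> ->] bM dM.
have dp (x y : R) : a <= x <= b -> c <= y <= d -> deep (a - r) (b + r) (c - r) (d + r) r x y.
  by move=> /andP[h1 h2] /andP[h3 h4]; split; lra.
have [ab' cd'] : a - r <= b + r /\ c - r <= d + r by split; lra.
move=> hv hB x1 y1 x2 y2 h1 h2 h3 h4; rewrite mulrAC ler_pdivlMr ?exprn_gt0// mulrC.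
exact: (cauchy_lipschitz hi ab' cd' r0 bM dM (dp _ _ h1 h2) (dp _ _ h3 h4) hv hB).
Qed.

Section Margin.
Variables (w w1 : H -> H) (a b c d rho : R).
Hypotheses (ab : a <= b) (cd : c <= d) (rho0 : 0 < rho).
Hypothesis hw : on_rect i (a - 4 * rho) (b + 4 * rho) (c - 4 * rho) (d + 4 * rho)
  (fun z => holo i w z (w1 z)).

(** The Lipschitz bound, applied to [w] and then to its difference quotients, makes
    the derivative Lipschitz and the uniform limit of the quotients. No second
    derivative is involved; each step costs a margin of width [rho]. *)
Lemma derivative_lipschitz : exists2 L, 0 <= L &
  (forall x1 y1 x2 y2 : R, a - rho <= x1 <= b + rho -> c - rho <= y1 <= d + rho ->
     a - rho <= x2 <= b + rho -> c - rho <= y2 <= d + rho ->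
     `|w1 (pt x1 y1) - w1 (pt x2 y2)| <= L * `|pt x1 y1 - pt x2 y2|) /\
  (forall x y h : R, a <= x <= b -> c <= y <= d -> 0 < h < rho ->
     `|dquot h w (pt x y) - w1 (pt x y)| <= L * h).
Proof.
move: (ab) (cd) (rho0) => ab' cd' rho0'.
have hol4 : on_rect i (a - 4 * rho) (b + 4 * rho) (c - 4 * rho) (d + 4 * rho) (hol w).
  by move=> x y hx hy; exists (w1 (pt x y)); exact: hw.
have [||B hB] := hol_bounded_rect _ _ hol4; try lra.
have [ma1 mb4 ma4 [mb1 ma3 mb3]] := margins a b rho0'.
have [mc1 md4 mc4 [md1 mc3 md3]] := margins c d rho0'.
pose M := b - a + (d - c) + 8 * rho.
have M0 : 0 < M by rewrite /M; lra.
have M3 : 0 < M ^+ 3 by rewrite exprn_gt0.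
have r4 : 0 < rho ^+ 4 by rewrite exprn_gt0.
have B0 : 0 <= B.
  apply: le_trans (hB a c _ _); rewrite ?normr_ge0//; lra.
pose L := 8 * M ^+ 3 * B / rho ^+ 4.
have L0 : 0 <= L by rewrite /L divr_ge0 ?(ltW r4)// !mulr_ge0// ltW.
have lip3 : forall x1 y1 x2 y2 : R, a - 3 * rho <= x1 <= b + 3 * rho ->
    c - 3 * rho <= y1 <= d + 3 * rho -> a - 3 * rho <= x2 <= b + 3 * rho ->
    c - 3 * rho <= y2 <= d + 3 * rho ->
    `|w (pt x1 y1) - w (pt x2 y2)| <= L * `|pt x1 y1 - pt x2 y2|.
  apply: cauchy_lipschitz_margin hol4 hB => //; [lra|lra|by split; ring| |];
    by rewrite /M; lra.
have hold h : 0 < h < rho ->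
    on_rect i (a - 2 * rho) (b + 2 * rho) (c - 2 * rho) (d + 2 * rho) (hol (dquot h w)).
  move=> /andP[h0 h1] x y hx hy; apply: hol_dquot; first exact: slice_slice_pt.
    by apply: hol4; lra.
  rewrite -(slice_pt0 i) slice_ptD; apply: hol4; lra.
have bd2 h : 0 < h < rho ->
    on_rect i (a - 2 * rho) (b + 2 * rho) (c - 2 * rho) (d + 2 * rho)
      (fun z => `|dquot h w z| <= L).
  move=> /andP[h0 h1] x y hx hy; rewrite /dquot normrZ gtr0_norm ?invr_gt0//.
  rewrite mulrC ler_pdivrMr// -(slice_pt0 i) slice_ptD addr0.
  have md32 := le_trans (_ : d + 2 * rho <= d + 2 * rho + rho) md3.
  rewrite (le_trans (lip3 _ _ _ _ (itv_shift ma3 mb3 (ltW h0) (ltW h1) hx)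
    (itv_sub mc3 (md32 _) hy) (itv_sub ma3 (le_trans _ mb3) hx)
    (itv_sub mc3 (md32 _) hy))) ?lerDl ?(ltW rho0')//.
  rewrite slice_ptB (addrC x) addrK subrr slice_pt0 normqA gtr0_norm//.
pose L2 := 8 * M ^+ 3 * L / rho ^+ 4.
have L20 : 0 <= L2 by rewrite /L2 divr_ge0 ?(ltW r4)// mulr_ge0// mulr_ge0// ltW.
have lipd h : 0 < h < rho -> forall x1 y1 x2 y2 : R, a - rho <= x1 <= b + rho ->
    c - rho <= y1 <= d + rho -> a - rho <= x2 <= b + rho -> c - rho <= y2 <= d + rho ->
    `|dquot h w (pt x1 y1) - dquot h w (pt x2 y2)| <= L2 * `|pt x1 y1 - pt x2 y2|.
  move=> hh; apply: cauchy_lipschitz_margin (hold h hh) (bd2 h hh) => //;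
    [lra|lra|by split; ring| |]; by rewrite /M; lra.
have lip1 (x1 y1 x2 y2 : R) : a - rho <= x1 <= b + rho ->
    c - rho <= y1 <= d + rho -> a - rho <= x2 <= b + rho ->
    c - rho <= y2 <= d + rho ->
    `|w1 (pt x1 y1) - w1 (pt x2 y2)| <= L2 * `|pt x1 y1 - pt x2 y2|.
  move=> h1 h2 h3 h4; apply/ler_addgt0Pr => e' e0'; move: e' e0' => e e0.
  have e2 : 0 < e / 2 by rewrite divr_gt0.
  have p1 : holo i w (pt x1 y1) (w1 (pt x1 y1)) by apply: hw; [exact: itv_sub h1|exact: itv_sub h2].
  have p2 : holo i w (pt x2 y2) (w1 (pt x2 y2)) by apply: hw; [exact: itv_sub h3|exact: itv_sub h4].
  have [r r0 hr] := dquot_lim (slice_slice_pt i _ _) p1 e2.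
  have [r' r0' hr'] := dquot_lim (slice_slice_pt i _ _) p2 e2.
  pose h := Num.min (Num.min r r') rho / 2.
  have mn0 : 0 < Num.min (Num.min r r') rho by rewrite !lt_min r0 r0'.
  have h0 : 0 < h by rewrite /h divr_gt0.
  have : h < Num.min (Num.min r r') rho by rewrite /h ltr_pdivrMr// ltr_pMr// ltr1n.
  rewrite !lt_min => /andP[/andP[hr1 hr2] hr3].
  have k1 : `|dquot h w (pt x1 y1) - w1 (pt x1 y1)| <= e / 2 by apply: hr; rewrite h0.
  have k2 : `|dquot h w (pt x2 y2) - w1 (pt x2 y2)| <= e / 2 by apply: hr'; rewrite h0.
  have hh : 0 < h < rho by rewrite h0.
  have k3 : `|dquot h w (pt x1 y1) - dquot h w (pt x2 y2)| <= L2 * `|pt x1 y1 - pt x2 y2|.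
    exact: (lipd h hh).
  have idt (p q u v : H) : p - q = u - v - (u - p) + (v - q).
    by apply: quatP => /=; ring.
  rewrite (idt _ _ (dquot h w (pt x1 y1)) (dquot h w (pt x2 y2))).
  rewrite (le_trans (ler_normD _ _))//.
  have := ler_normB (dquot h w (pt x1 y1) - dquot h w (pt x2 y2)) (dquot h w (pt x1 y1) - w1 (pt x1 y1)).
  move: k1 k2 k3; lra.
exists L2 => //; split=> // x y h hx hy /andP[h0 h1].
have hx1 := itv_sub ma1 mb1 hx; have hy1 := itv_sub mc1 md1 hy.
have hxy : holo i w (pt x y) (w1 (pt x y)).
  by apply: hw; [exact: itv_sub hx1|exact: itv_sub hy1].
pose v z := w z - z * w1 (pt x y); pose v1 z := w1 z - 1 * w1 (pt x y).
have dE : pt x y + h%:A - pt x y = h%:A by rewrite addrAC subrr add0r.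
have zE s : pt x y + s *: (pt x y + h%:A - pt x y) = pt (x + s * h) y.
  by rewrite dE -(slice_pt0 i) slice_ptZ slice_ptD mulr0 addr0.
have vE : v (pt x y + h%:A) - v (pt x y) = h *: (dquot h w (pt x y) - w1 (pt x y)).
  rewrite /v /dquot scalerBr scalerA divff ?gt_eqF// scale1r (scaleqE h (w1 _)) mulrDl.
  move: (w (pt x y + _)) (w (pt x y)) (pt x y * _) (_%:A * _) => p q r s.
  by apply: quatP => /=; ring.
have hsh (s : R) : 0 <= s <= 1 -> 0 <= s * h <= h.
  by move=> /andP[s0 s1]; rewrite mulr_ge0 ?(ltW h0)//= ler_piMl// ltW.
have := @mvt_slice v v1 (pt x y) (pt x y + h%:A) (L2 * h).
rewrite vE normrZ dE normqA gtr0_norm// [leRHS]mulrC ler_pM2l//; apply.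
- exact: slice_slice_pt.
- by rewrite -(slice_pt0 i) slice_ptD; exact: slice_slice_pt.
- move=> s /hsh/andP[s0 s1]; rewrite -dE zE; apply: holo_sub; last exact/holo_mulr/holo_id.
  apply: hw; last exact: itv_sub hy1.
  apply: itv_shift s0 (le_trans s1 (ltW h1)) hx; first exact: le_trans ma4 ma1.
  exact: mb4.
- move=> s /hsh/andP[s0 s1]; rewrite -dE zE /v1 mul1r.
  have hxs : a - rho <= x + s * h <= b + rho.
    exact: itv_shift ma1 (lexx _) s0 (le_trans s1 (ltW h1)) hx.
  rewrite (le_trans (lip1 _ _ _ _ hxs hy1 hx1 hy1))// ler_wpM2l//.
  by rewrite slice_ptB [x + _ - x]addrAC (subrr x) add0r subrr slice_pt0 normqA ger0_norm.
Qed.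

(** Difference quotients are holomorphic, so that Cauchy's estimate holds for them
    and passes to their uniform limit, the derivative. *)
Lemma cauchy_estimate_derivative m M (x0 y0 : R) : 0 < m -> b - a <= M -> d - c <= M ->
  deep a b c d m x0 y0 -> m ^+ 3 * `|w1 (pt x0 y0)| <= M ^+ 2 * bd_norm i a b c d w1.
Proof.
move: (ab) (cd) (rho0) => ab' cd' rho0' m0 aM cM dp.
have [d1 d2 d3 d4] := dp.
have M0 : 0 < M by lra.
have [L L0 [lip app]] := derivative_lipschitz.
have [ma1 _ _ [mb1 _ _]] := margins a b rho0'; have [mc1 _ _ [md1 _ _]] := margins c d rho0'.
have cw1v x : a <= x <= b -> cont_on c d (fun t => `|w1 (pt x t)|).
  move=> hx; apply: cont_on_norm => t ht e e0.
  have Lp : 0 < L + 1 by lra.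
  exists (e / (L + 1)); first by rewrite divr_gt0.
  move=> t' ht'; rewrite ltr_pdivlMr// => tt.
  have hx' := itv_sub ma1 mb1 hx.
  rewrite (le_lt_trans (lip _ _ _ _ hx' (itv_sub mc1 md1 ht') hx' (itv_sub mc1 md1 ht)))//.
  rewrite slice_ptB subrr (le_lt_trans _ tt)// mulrC ler_pM// ?lerDl//.
  by have := norm_slice_pt_le hi 0 (t' - t); rewrite normr0 add0r.
have cw1h y : c <= y <= d -> cont_on a b (fun t => `|w1 (pt t y)|).
  move=> hy; apply: cont_on_norm => t ht e e0.
  have Lp : 0 < L + 1 by lra.
  exists (e / (L + 1)); first by rewrite divr_gt0.
  move=> t' ht'; rewrite ltr_pdivlMr// => tt.
  have hy' := itv_sub mc1 md1 hy.
  rewrite (le_lt_trans (lip _ _ _ _ (itv_sub ma1 mb1 ht') hy' (itv_sub ma1 mb1 ht) hy'))//.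
  rewrite slice_ptB subrr (le_lt_trans _ tt)// mulrC ler_pM// ?lerDl//.
  by have := norm_slice_pt_le hi (t' - t) 0; rewrite normr0 addr0.
have m3 : 0 < m ^+ 3 by rewrite exprn_gt0.
have M2 : 0 < M ^+ 2 by rewrite exprn_gt0.
suff hh (h : R) : 0 < h < rho -> m ^+ 3 * `|w1 (pt x0 y0)| <=
    M ^+ 2 * bd_norm i a b c d w1 + (m ^+ 3 * L + M ^+ 2 * (4 * L * M)) * h.
  apply/ler_addgt0Pr => e e0.
  set K := m ^+ 3 * L + M ^+ 2 * (4 * L * M) in hh *.
  have K0 : 0 <= K.
    by apply: addr_ge0; apply: mulr_ge0 => //; rewrite ?(ltW m3) ?(ltW M2)//;
      apply: mulr_ge0; rewrite ?(ltW M0)// mulr_ge0.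
  have K1 : 0 < K + 1 by lra.
  pose h := Num.min (rho / 2) (e / (K + 1)).
  have h0 : 0 < h by rewrite /h lt_min !divr_gt0.
  have h1 : h < rho by rewrite /h gt_min ltr_pdivrMr// ltr_pMr// ltr1n.
  apply: (le_trans (hh h _)); first by rewrite h0.
  rewrite lerD2l (@le_trans _ _ ((K + 1) * h))//; first by rewrite ler_wpM2r// ?(ltW h0)// lerDl.
  by rewrite mulrC -ler_pdivlMr// /h ge_min lexx orbT.
move=> hrho; have /andP[h0 h1] := hrho.
have hol_d : on_rect i a b c d (hol (dquot h w)).
  move=> x y hx hy; apply: hol_dquot; first exact: slice_slice_pt.
    by exists (w1 (pt x y)); apply: hw; lra.
  by rewrite -(slice_pt0 i) slice_ptD; eexists; apply: hw; lra.
have k1 := cauchy_estimate hi ab cd m0 aM cM dp hol_d.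
have k2 : `|w1 (pt x0 y0)| <= `|dquot h w (pt x0 y0)| + L * h.
  have := app x0 y0 h ltac:(lra) ltac:(lra) hrho.
  have := ler_normB (dquot h w (pt x0 y0)) (dquot h w (pt x0 y0) - w1 (pt x0 y0)).
  by rewrite subKr; lra.
have k3 : bd_norm i a b c d (dquot h w) <= bd_norm i a b c d w1 + 4 * L * M * h.
  have [G1 G2 G3 G4] := on_bdryE ab cd (on_rect_bdry hol_d).
  have S := slice_slice_pt i; have Si := slicei i; have S1 := slice1 i.
  have aux (F : R -> H) (G : R -> H) t1 t2 : t1 <= t2 -> t2 - t1 <= M ->
     cont_on t1 t2 (fun t => `|F t|) -> cont_on t1 t2 (fun t => `|G t|) ->
     (forall t, t1 <= t <= t2 -> `|F t - G t| <= L * h) ->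
     itg (fun t => `|F t|) t1 t2 <= itg (fun t => `|G t|) t1 t2 + L * h * M.
    move=> t12 tM cF cG hFG.
    apply: (@le_trans _ _ (itg (fun t => `|G t|) t1 t2 + L * h * (t2 - t1))); last first.
      by rewrite lerD2l ler_wpM2l// mulr_ge0// ltW.
    rewrite -itg_cst// -itgD//; last exact: cont_on_cst.
    apply: le_itg => //.
      move=> t ht e e0; have [r r0 hr] := cG t ht e e0; exists r => // t' ht' tr.
      by rewrite opprD addrACA subrr addr0; exact: hr.
    move=> t ht; have := hFG t ht; have := ler_normD (F t - G t) (G t).
    by rewrite subrK; lra.
  have haa : a <= a <= b by rewrite lexx ab.
  have hbb : a <= b <= b by rewrite lexx ab.
  have hcc : c <= c <= d by rewrite lexx cd.
  have hdd : c <= d <= d by rewrite lexx cd.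
  have c1 : cont_on c d (fun t => `|dquot h w (pt b t)|).
    by apply: cont_on_norm; have := edge_cont 0 (S b 0) Si G1; under eq_fun do rewrite vert_ptE.
  have c2 : cont_on c d (fun t => `|dquot h w (pt a t)|).
    by apply: cont_on_norm; have := edge_cont 0 (S a 0) Si G2; under eq_fun do rewrite vert_ptE.
  have c3 : cont_on a b (fun t => `|dquot h w (pt t d)|).
    by apply: cont_on_norm; have := edge_cont 0 (S 0 d) S1 G3; under eq_fun do rewrite horiz_ptE.
  have c4 : cont_on a b (fun t => `|dquot h w (pt t c)|).
    by apply: cont_on_norm; have := edge_cont 0 (S 0 c) S1 G4; under eq_fun do rewrite horiz_ptE.
  have := aux _ _ _ _ cd cM c1 (cw1v b hbb) (fun t ht => app b t h hbb ht hrho).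
  have := aux _ _ _ _ cd cM c2 (cw1v a haa) (fun t ht => app a t h haa ht hrho).
  have := aux _ _ _ _ ab aM c3 (cw1h d hdd) (fun t ht => app t d h ht hdd hrho).
  have := aux _ _ _ _ ab aM c4 (cw1h c hcc) (fun t ht => app t c h ht hcc hrho).
  move=> j4 j3 j2 j1; rewrite (_ : bd_norm i a b c d w1 + 4 * L * M * h =
    itg (fun t => `|w1 (pt b t)|) c d + L * h * M + (itg (fun t => `|w1 (pt a t)|) c d + L * h * M) +
    (itg (fun t => `|w1 (pt t d)|) a b + L * h * M + (itg (fun t => `|w1 (pt t c)|) a b + L * h * M))).
    by rewrite /bd_norm !lerD.
  by rewrite /bd_norm; ring.
have k4 : m ^+ 3 * `|w1 (pt x0 y0)| <= m ^+ 3 * `|dquot h w (pt x0 y0)| + m ^+ 3 * (L * h).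
  by rewrite -mulrDr ler_pM2l.
have k5 : M ^+ 2 * bd_norm i a b c d (dquot h w) <= M ^+ 2 * bd_norm i a b c d w1 + M ^+ 2 * (4 * L * M * h).
  by rewrite -mulrDr ler_pM2l.
apply: (le_trans k4); apply: (@le_trans _ _ (M ^+ 2 * bd_norm i a b c d (dquot h w) + m ^+ 3 * (L * h))).
  by rewrite lerD2r.
apply: (@le_trans _ _ (M ^+ 2 * bd_norm i a b c d w1 + M ^+ 2 * (4 * L * M * h) + m ^+ 3 * (L * h))).
  by rewrite lerD2r.
by rewrite le_eqVlt; apply/orP; left; apply/eqP; ring.
Qed.

End Margin.
End Derivative.

(** * Bergman's inequality *)

Section PlaneMeasure.
Variable R : realType.
Local Notation mu := (@lebesgue_measure R).
Local Notation mu2 := (@lebesgue_measure R \x @lebesgue_measure R)%E.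

Definition cont_rel (D : set (R * R)) (f : R * R -> R) :=
  forall p, D p -> forall e, 0 < e -> exists2 d, 0 < d & forall q, D q ->
    `|q.1 - p.1| < d -> `|q.2 - p.2| < d -> `|f q - f p| < e.

(** The superlevel sets are traces on D of countable unions of boxes with
    rational centres. *)
Lemma cont_rel_measurable (D : set (R * R)) (f : R * R -> R) :
  measurable D -> cont_rel D f -> measurable_fun D f.
Proof.
move=> mD cf; apply: (measurability _ (measurable_realfun.RGenOInfty.measurableE R)).
move=> /= _ [_ [a ->]] <-.
pose box (q1 q2 : rat) (n : nat) : set (R * R) :=
  `]ratr q1 - n.+1%:R^-1, ratr q1 + n.+1%:R^-1[%classic `*`
  `]ratr q2 - n.+1%:R^-1, ratr q2 + n.+1%:R^-1[%classic.
pose F q1 q2 n := if `[< forall p, D p -> box q1 q2 n p -> a < f p >]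
  then box q1 q2 n else set0.
have -> : D `&` f @^-1` `]a, +oo[%classic =
    D `&` \bigcup_q1 \bigcup_q2 \bigcup_n F q1 q2 n.
  apply/seteqP; split=> p [Dp]; last first.
    move=> [q1 _ [q2 _ [n _]]]; rewrite /F; case: asboolP => // h bp.
    by split => //=; rewrite in_itv/= andbT; exact: h.
  rewrite /= in_itv/= andbT => afp; split=> //.
  have [d d0 hd] := cf p Dp (f p - a) ltac:(by rewrite subr_gt0).
  have d2 : 0 < d / 2 by rewrite divr_gt0.
  have [n _ /(_ n (leqnn n)) hn] := near_infty_natSinv_lt (PosNum d2).
  rewrite /= in hn; set k := n.+1%:R^-1 in hn.
  have k0 : 0 < k by rewrite /k invr_gt0.
  have [q1 q1P] := @rat_in_itvoo R (p.1 - k) (p.1 + k) ltac:(lra).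
  have [q2 q2P] := @rat_in_itvoo R (p.2 - k) (p.2 + k) ltac:(lra).
  rewrite in_itv/= in q1P; rewrite in_itv/= in q2P.
  exists q1 => //; exists q2 => //; exists n => //; rewrite /F asboolT.
    by rewrite /box -/k; split; rewrite /= in_itv/=; lra.
  move=> r Dr []; rewrite /box -/k /= !in_itv/= => r1 r2.
  have := hd r Dr; rewrite !ltr_norml => /(_ ltac:(lra) ltac:(lra)).
  by move=> /andP[h1 h2]; lra.
apply: measurableI => //; apply: bigcupT_measurable_rat => q1.
apply: bigcupT_measurable_rat => q2; apply: bigcupT_measurable => n.
rewrite /F; case: asboolP => _ //.
by apply: measurableX; exact: measurable_itv.
Qed.

Local Open Scope ereal_scope.

Lemma cont_rel_emeasurable (D : set (R * R)) (f : R * R -> R) : measurable D ->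
  cont_rel D f -> measurable_fun D (fun p => (f p)%:E).
Proof. by move=> mD cf; apply/measurable_EFinP; exact: cont_rel_measurable. Qed.

(** By Tonelli, some line of a rectangle carries at most twice the average mass. *)
Lemma good_line_vert (p q c d E : R) (f : R * R -> R) : (p < q)%R -> (0 < E)%R ->
  let D := `[p, q]%classic `*` `[c, d]%classic in
  cont_rel D f -> (forall z, D z -> 0 <= f z)%R ->
  \int[mu2]_(z in D) (f z)%:E <= E%:E ->
  exists2 x, (p <= x <= q)%R &
    \int[mu]_(y in `[c, d]) (f (x, y))%:E <= (2 * E / (q - p))%:E.
Proof.
move=> pq E0 D cf f0 fE; apply: contrapT => hn.
have mD : measurable D by apply: measurableX; exact: measurable_itv.
have mf := cont_rel_emeasurable mD cf.
set g : R * R -> \bar R := (fun z => (f z)%:E) \_ D.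
have mg : measurable_fun setT g by apply/(measurable_restrictT _ mD).
have g0 z : 0 <= g z.
  by rewrite /g patchE; case: ifPn => // /set_mem /f0; rewrite lee_fin.
have := @fubini_tonelli1 _ _ _ _ R mu mu g mg g0.
rewrite -integral_mkcond => e.
have qp : (0 < q - p)%R by rewrite subr_gt0.
have : (2 * E)%:E <= \int[mu]_x fubini_F mu g x.
  apply: (@le_trans _ _ (\int[mu]_(x in `[p, q]) fubini_F mu g x)); last first.
    apply: ge0_subset_integral => //; first exact: measurable_fun_fubini_tonelli_F.
    by move=> x _; apply: integral_ge0.
  apply: (@le_trans _ _ (\int[mu]_(x in `[p, q]) (2 * E / (q - p))%:E)).
    rewrite integral_cst; last exact: measurable_itv.
    rewrite /= lebesgue_measure_itv/= lte_fin pq -EFinB -EFinM lee_fin.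
    by rewrite divfK// gt_eqF.
  apply: ge0_le_integral => //.
  - by move=> x _; rewrite lee_fin divr_ge0 ?(ltW qp)// mulr_ge0// ltW.
  - by apply: measurable_funTS; exact: measurable_fun_fubini_tonelli_F.
  - move=> x /=; rewrite in_itv/= => px.
    have -> : fubini_F mu g x = \int[mu]_(y in `[c, d]) (f (x, y))%:E.
      rewrite /fubini_F [RHS]integral_mkcond; apply: eq_integral => y _.
      rewrite /g !patchE; congr (if _ then _ else _).
      by apply/idP/idP; rewrite !inE /D /= !in_itv/= px; [case|split].
    rewrite leNgt; apply/negP => /ltW hx; apply: hn; exists x => //.
rewrite -e => /le_trans /(_ fE); rewrite lee_fin; lra.
Qed.

Lemma good_line_horiz (p q c d E : R) (f : R * R -> R) : (c < d)%R -> (0 < E)%R ->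
  let D := `[p, q]%classic `*` `[c, d]%classic in
  cont_rel D f -> (forall z, D z -> 0 <= f z)%R ->
  \int[mu2]_(z in D) (f z)%:E <= E%:E ->
  exists2 y, (c <= y <= d)%R &
    \int[mu]_(x in `[p, q]) (f (x, y))%:E <= (2 * E / (d - c))%:E.
Proof.
move=> cd E0 D cf f0 fE; apply: contrapT => hn.
have mD : measurable D by apply: measurableX; exact: measurable_itv.
have mf := cont_rel_emeasurable mD cf.
set g : R * R -> \bar R := (fun z => (f z)%:E) \_ D.
have mg : measurable_fun setT g by apply/(measurable_restrictT _ mD).
have g0 z : 0 <= g z.
  by rewrite /g patchE; case: ifPn => // /set_mem /f0; rewrite lee_fin.
have := @fubini_tonelli2 _ _ _ _ R mu mu g mg g0.
rewrite -integral_mkcond => e.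
have qp : (0 < d - c)%R by rewrite subr_gt0.
have : (2 * E)%:E <= \int[mu]_x fubini_G mu g x.
  apply: (@le_trans _ _ (\int[mu]_(x in `[c, d]) fubini_G mu g x)); last first.
    apply: ge0_subset_integral => //; first exact: measurable_fun_fubini_tonelli_G.
    by move=> x _; apply: integral_ge0.
  apply: (@le_trans _ _ (\int[mu]_(x in `[c, d]) (2 * E / (d - c))%:E)).
    rewrite integral_cst; last exact: measurable_itv.
    rewrite /= lebesgue_measure_itv/= lte_fin cd -EFinB -EFinM lee_fin.
    by rewrite divfK// gt_eqF.
  apply: ge0_le_integral => //.
  - by move=> x _; rewrite lee_fin divr_ge0 ?(ltW qp)// mulr_ge0// ltW.
  - by apply: measurable_funTS; exact: measurable_fun_fubini_tonelli_G.
  - move=> y /=; rewrite in_itv/= => py.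
    have -> : fubini_G mu g y = \int[mu]_(x in `[p, q]) (f (x, y))%:E.
      rewrite /fubini_G [RHS]integral_mkcond; apply: eq_integral => x _.
      rewrite /g !patchE; congr (if _ then _ else _).
      by apply/idP/idP; rewrite !inE /D /= !in_itv/= py; [case|split].
    rewrite leNgt; apply/negP => /ltW hx; apply: hn; exists y => //.
rewrite -e => /le_trans /(_ fE); rewrite lee_fin; lra.
Qed.

Local Open Scope ring_scope.

(** From [2 |f| <= tau + f^2 / tau]; [tau] stays free so as to balance both terms. *)
Lemma itg_sqr_bound (f : R -> R) (a b a' b' tau C : R) : a' <= a -> a <= b -> b <= b' ->
  0 < tau -> cont_on a' b' f ->
  (\int[mu]_(y in `[a', b']) ((f y) ^+ 2)%:E <= C%:E)%E ->
  itg (fun y => `|f y|) a b <= (tau * (b - a) + C / tau) / 2.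
Proof.
move=> aa ab bb t0 cf hC.
have cf' : cont_on a b f by exact: cont_onS cf.
have cf2 u v : cont_on u v f -> cont_on u v (fun y => f y ^+ 2).
  move=> c x hx e e0; set M := `|f x|.
  have M0 : 0 <= M by exact: normr_ge0.
  have e1 : 0 < e / (2 * M + 1) by rewrite divr_gt0//; lra.
  have [d d0 hd] := c x hx (Num.min 1 (e / (2 * M + 1))) ltac:(by rewrite lt_min ltr01).
  exists d => // y hy yd; have := hd y hy yd; rewrite lt_min ltr_pdivlMr; last lra.
  move=> /andP[h1 h2]; rewrite subr_sqr normrM (le_lt_trans _ h2)// ler_wpM2l//.
  rewrite (_ : f y + f x = (f y - f x) + 2 * f x); last by ring.
  rewrite (le_trans (ler_normD _ _))// normrM ger0_norm// -/M addrC lerD2l ltW//.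
have k1 : itg (fun y => f y ^+ 2) a b <= C.
  rewrite -lee_fin /itg fineK; last first.
    by apply: integrable_fin_num => //; exact: (cont_on_integrable (cf2 _ _ cf')).
  apply: le_trans hC; apply: ge0_subset_integral => //.
  - by apply: (measurable_int mu); exact: cont_on_integrable (cf2 _ _ cf).
  - by move=> y _; rewrite lee_fin sqr_ge0.
  - by apply: subset_itv; rewrite bnd_simp.
have k2 : itg (fun y => `|f y|) a b <= itg (fun y => tau / 2 + (2 * tau)^-1 * f y ^+ 2) a b.
  apply: le_itg.
  - move=> x hx e e0; have [d d0 hd] := cf' x hx e e0; exists d => // y hy yd.
    by rewrite (le_lt_trans (ler_dist_dist _ _))// hd.
  - have t2 : 0 < 2 * tau by lra.
    move=> x hx e e0; have [d d0 hd] := cf2 _ _ cf' x hx _ (mulr_gt0 t2 e0); exists d => // y hy yd.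
    rewrite opprD addrACA subrr add0r -mulrBr normrM gtr0_norm ?invr_gt0//.
    by rewrite mulrC ltr_pdivrMr// mulrC; exact: hd.
  - move=> x _; rewrite -(real_normK (num_real (f x))).
    rewrite -subr_ge0 (_ : _ - _ = (2 * tau)^-1 * (tau - `|f x|) ^+ 2); last first.
      by field; rewrite gt_eqF.
    by rewrite mulr_ge0 ?sqr_ge0// invr_ge0; lra.
rewrite itgD ?itg_cst// ?itgZ in k2; first last.
- have t2 : 0 < 2 * tau by lra.
  move=> x hx e e0; have [d d0 hd] := cf2 _ _ cf' x hx _ (mulr_gt0 t2 e0); exists d => // y hy yd.
  rewrite -mulrBr normrM gtr0_norm ?invr_gt0//.
  by rewrite mulrC ltr_pdivrMr// mulrC; exact: hd.
- exact: cont_on_cst.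
- exact: cf2.
have k3 : (2 * tau)^-1 * itg (fun y => f y ^+ 2) a b <= (2 * tau)^-1 * C.
  by rewrite ler_wpM2l// invr_ge0; lra.
rewrite (_ : (tau * (b - a) + C / tau) / 2 = tau / 2 * (b - a) + (2 * tau)^-1 * C); last first.
  by field; rewrite gt_eqF.
lra.
Qed.

End PlaneMeasure.

Section Bergman.
Variable R : realType.
Local Notation H := (quat R).
Variables (i : H) (hi : imag_sphere i).
Local Notation pt := (slice_pt i).
Local Notation mu2 := (@lebesgue_measure R \x @lebesgue_measure R)%E.

Definition square (x y r : R) : set (R * R) :=
  `[x - r, x + r]%classic `*` `[y - r, y + r]%classic.

Lemma cont_relS (D D' : set (R * R)) (f : R * R -> R) :
  D' `<=` D -> cont_rel D f -> cont_rel D' f.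
Proof.
move=> DD cf p /DD Dp e e0; have [d d0 hd] := cf p Dp e e0.
by exists d => // q /DD Dq; exact: hd.
Qed.

Lemma rect_sub_square (x0 y0 q a b c d : R) : x0 - q <= a -> b <= x0 + q ->
  y0 - q <= c -> d <= y0 + q ->
  `[a, b]%classic `*` `[c, d]%classic `<=` square x0 y0 q.
Proof.
move=> ha hb hc hd z []; rewrite /square /= !in_itv/= => /andP[z1 z2] /andP[z3 z4].
by split; apply/andP; split; [exact: le_trans z1|exact: le_trans hb|
  exact: le_trans z3|exact: le_trans hd].
Qed.

Section Lipschitz.
Variables (p : R -> R -> H) (x0 y0 q L : R).
Hypothesis lip : forall x1 y1 x2 y2 : R, `|x1 - x0| <= q -> `|y1 - y0| <= q ->
   `|x2 - x0| <= q -> `|y2 - y0| <= q ->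
   `|p x1 y1 - p x2 y2| <= L * (`|x1 - x2| + `|y1 - y2|).
Hypothesis L0 : 0 <= L.

Lemma lip_sqr_cont_rel : cont_rel (square x0 y0 q) (fun z => `|p z.1 z.2| ^+ 2).
Proof.
have L0' : 0 <= L := L0.
move=> z [/= p1 p2] e e0; rewrite in_itv/= in p1; rewrite in_itv/= in p2.
set M := `|p z.1 z.2|; have M0 : 0 <= M by exact: normr_ge0.
have e1 : 0 < Num.min 1 (e / (2 * M + 1)) by rewrite lt_min ltr01 divr_gt0//; lra.
exists (Num.min 1 (e / (2 * M + 1)) / (2 * (L + 1))).
  by rewrite divr_gt0//; lra.
move=> w [/= q1 q2]; rewrite in_itv/= in q1; rewrite in_itv/= in q2.
rewrite !ltr_pdivlMr; [|lra|lra] => h1 h2.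
have h3 : `|p w.1 w.2 - p z.1 z.2| < Num.min 1 (e / (2 * M + 1)).
  apply: (le_lt_trans (lip _ _ _ _)); rewrite ?ler_norml; try lra.
  have := mulr_ge0 L0' (normr_ge0 (w.1 - z.1)).
  have := mulr_ge0 L0' (normr_ge0 (w.2 - z.2)).
  move: (normr_ge0 (w.1 - z.1)) (normr_ge0 (w.2 - z.2)) h1 h2 e1.
  move: (Num.min _ _) `|w.1 - z.1| `|w.2 - z.2|=> m u v; lra.
move: h3; rewrite lt_min ltr_pdivlMr; last lra.
move=> /andP[h3 h4]; rewrite subr_sqr normrM (le_lt_trans _ h4)//.
apply: ler_pM => //; first exact: ler_dist_dist.
have := ler_dist_dist (p w.1 w.2) (p z.1 z.2).
by rewrite -/M ger0_norm ?addr_ge0// ler_norml => /andP[_]; lra.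
Qed.

Lemma lip_cont_vert (x : R) : `|x - x0| <= q ->
  cont_on (y0 - q) (y0 + q) (fun t => `|p x t|).
Proof.
have L0' : 0 <= L := L0.
move=> hx; apply: cont_on_norm => t ht e e0; exists (e / (L + 1)).
  by rewrite divr_gt0//; lra.
move=> t' ht'; rewrite ltr_pdivlMr; last lra.
move=> h; apply: (le_lt_trans (lip hx _ hx _)); rewrite ?ler_norml; try lra.
rewrite subrr normr0 add0r; apply: le_lt_trans h.
by rewrite mulrC ler_wpM2l// lerDl.
Qed.

Lemma lip_cont_horiz (y : R) : `|y - y0| <= q ->
  cont_on (x0 - q) (x0 + q) (fun s => `|p s y|).
Proof.
have L0' : 0 <= L := L0.
move=> hy; apply: cont_on_norm => t ht e e0; exists (e / (L + 1)).
  by rewrite divr_gt0//; lra.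
move=> t' ht'; rewrite ltr_pdivlMr; last lra.
move=> h; apply: (le_lt_trans (lip _ hy _ hy)); rewrite ?ler_norml; try lra.
rewrite subrr normr0 addr0; apply: le_lt_trans h.
by rewrite mulrC ler_wpM2l// lerDl.
Qed.

End Lipschitz.

(** [itg_sqr_bound] for [tau = E / r], the value that balances its two terms. *)
Lemma line_bound (g : R -> H) (a b u v r E : R) : 0 < r -> 0 < E -> a <= u -> u <= v ->
  v <= b -> v - u <= 4 * r -> cont_on a b (fun t => `|g t|) ->
  (\int[lebesgue_measure]_(t in `[a, b]) (`|g t| ^+ 2)%:E <= (2 * E ^+ 2 / r)%:E)%E ->
  itg (fun t => `|g t|) u v <= 3 * E.
Proof.
move=> r0 E0 h1 h2 h3 h4 h5 h6; have Er : 0 < E / r by rewrite divr_gt0.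
have := itg_sqr_bound h1 h2 h3 Er h5 h6.
rewrite (_ : 2 * E ^+ 2 / r / (E / r) = 2 * E); last by field; rewrite !gt_eqF.
under [X in itg X _ _ <= _ -> _]eq_fun do rewrite normr_id.
have : E / r * (v - u) <= 4 * E.
  by rewrite mulrAC ler_pdivrMr// -mulrA (mulrC 4) -mulrA ler_pM2l// mulrC.
by move: (E / r * _) => Z; lra.
Qed.

(** Cauchy's estimate on a rectangle around the point whose four sides are chosen,
    by Tonelli, to carry little mass: each side is taken in a strip of width
    [r]. *)
Lemma bergman (w w1 : H -> H) (x0 y0 r E : R) : 0 < r -> 0 < E ->
  (forall x y, `|x - x0| <= 6 * r -> `|y - y0| <= 6 * r -> holo i w (pt x y) (w1 (pt x y))) ->
  (\int[mu2]_(z in square x0 y0 (4 * r)) (`|w1 (pt z.1 z.2)| ^+ 2)%:E <= (E ^+ 2)%:E)%E ->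
  forall x y, `|x - x0| <= r -> `|y - y0| <= r -> `|w1 (pt x y)| <= 200 * E / r.
Proof.
move=> r0 E0 hw hE x y hx hy.
rewrite ler_norml in hx; rewrite ler_norml in hy.
have rho0 : 0 < r / 4 by rewrite divr_gt0.
have wide (u v : R) : `|u - v| <= 4 * r -> v - 4 * r - r / 4 <= u <= v + 4 * r + r / 4.
  by rewrite ler_norml => /andP[h1 h2]; apply/andP; split; lra.
have [L L0 [lip _]] := @derivative_lipschitz _ i hi w w1 (x0 - 4 * r) (x0 + 4 * r)
  (y0 - 4 * r) (y0 + 4 * r) (r / 4) ltac:(lra) ltac:(lra) rho0
  ltac:(by move=> s t hs ht; apply: hw; rewrite ler_norml; lra).
have lip' (x1 y1 x2 y2 : R) : `|x1 - x0| <= 4 * r -> `|y1 - y0| <= 4 * r ->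
   `|x2 - x0| <= 4 * r -> `|y2 - y0| <= 4 * r ->
   `|w1 (pt x1 y1) - w1 (pt x2 y2)| <= L * (`|x1 - x2| + `|y1 - y2|).
  move=> h1 h2 h3 h4; apply: (le_trans (lip _ _ _ _ (wide _ _ h1) (wide _ _ h2) (wide _ _ h3) (wide _ _ h4))).
  by rewrite ler_wpM2l// slice_ptB norm_slice_pt_le.
have est (a b c d : R) : x - 2 * r <= a <= x - r -> x + r <= b <= x + 2 * r ->
    y - 2 * r <= c <= y - r -> y + r <= d <= y + 2 * r ->
    r ^+ 3 * `|w1 (pt x y)| <= (4 * r) ^+ 2 * bd_norm i a b c d w1.
  move=> ha hb hc hd; clear lip lip' hE.
  have dp : deep a b c d r x y by split; lra.
  apply: (cauchy_estimate_derivative hi _ _ rho0 _ r0 _ _ dp); try lra.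
  by move=> s t hs ht; apply: hw; rewrite ler_norml; lra.
pose f (z : R * R) := `|w1 (pt z.1 z.2)| ^+ 2.
have crel : cont_rel (square x0 y0 (4 * r)) f := lip_sqr_cont_rel lip' L0.
have f0 z : 0 <= f z by rewrite /f sqr_ge0.
have mS (a b c d : R) : measurable (`[a, b]%classic `*` `[c, d]%classic : set (R * R)).
  by apply: measurableX; exact: measurable_itv.
have sub (a b c d : R) : `[a, b]%classic `*` `[c, d]%classic `<=` square x0 y0 (4 * r) ->
    (\int[mu2]_(z in `[a, b]%classic `*` `[c, d]%classic) (f z)%:E <= (E ^+ 2)%:E)%E.
  move=> hsub; apply: le_trans hE; apply: ge0_subset_integral => //.
  - exact: mS.
  - exact: mS.
  - by apply: cont_rel_emeasurable crel; exact: mS.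
  - by move=> z _; rewrite lee_fin.
have E2 : 0 < E ^+ 2 by rewrite exprn_gt0.
have cv (s : R) : `|s - x0| <= 4 * r -> cont_on (y0 - 4 * r) (y0 + 4 * r) (fun t => `|w1 (pt s t)|).
  exact: (lip_cont_vert lip').
have ch (t : R) : `|t - y0| <= 4 * r -> cont_on (x0 - 4 * r) (x0 + 4 * r) (fun s => `|w1 (pt s t)|).
  exact: (lip_cont_horiz lip').
clear hw hE lip lip' mS.
have [x4 x4'] : x0 - 4 * r <= x - 2 * r /\ x + 2 * r <= x0 + 4 * r by split; lra.
have [y4 y4'] : y0 - 4 * r <= y - 2 * r /\ y + 2 * r <= y0 + 4 * r by split; lra.
have gv (p q : R) : p < q -> q - p = r -> x - 2 * r <= p -> q <= x + 2 * r ->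
    exists2 s : R, p <= s <= q & forall u v, y - 2 * r <= u -> u <= v ->
      v <= y + 2 * r -> itg (fun t => `|w1 (pt s t)|) u v <= 3 * E.
  move=> pq e hp hq.
  have hsub : `[p, q]%classic `*` `[(y - 2 * r)%R, (y + 2 * r)%R]%classic `<=` square x0 y0 (4 * r).
    by apply: rect_sub_square => //; [exact: le_trans hp|exact: le_trans x4'].
  have [s hs Is] := good_line_vert pq E2 (cont_relS hsub crel) (fun z _ => f0 z) (sub _ _ _ _ hsub).
  exists s => // u v hu uv hv; rewrite e in Is.
  have s4 : `|s - x0| <= 4 * r by clear Is hsub crel cv ch sub est; rewrite ler_norml; lra.
  apply: (line_bound (g := fun t => w1 (pt s t)) r0 E0 hu uv hv _ (cont_onS y4 y4' (cv s s4)) Is).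
  by clear Is hsub crel cv ch sub est; lra.
have gh (p q : R) : p < q -> q - p = r -> y - 2 * r <= p -> q <= y + 2 * r ->
    exists2 t : R, p <= t <= q & forall u v, x - 2 * r <= u -> u <= v ->
      v <= x + 2 * r -> itg (fun s => `|w1 (pt s t)|) u v <= 3 * E.
  move=> pq e hp hq.
  have hsub : `[(x - 2 * r)%R, (x + 2 * r)%R]%classic `*` `[p, q]%classic `<=` square x0 y0 (4 * r).
    by apply: rect_sub_square => //; [exact: le_trans hp|exact: le_trans y4'].
  have [t ht It] := good_line_horiz pq E2 (cont_relS hsub crel) (fun z _ => f0 z) (sub _ _ _ _ hsub).
  exists t => // u v hu uv hv; rewrite e in It.
  have t4 : `|t - y0| <= 4 * r by clear It hsub crel cv ch sub est; rewrite ler_norml; lra.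
  apply: (line_bound (g := fun s => w1 (pt s t)) r0 E0 hu uv hv _ (cont_onS x4 x4' (ch t t4)) It).
  by clear It hsub crel cv ch sub est; lra.
clear crel cv ch sub f0 f x4 x4' y4 y4' hx hy rho0.
have [r1 [r2 r3]] : x + r < x + 2 * r /\ (x + 2 * r - (x + r) = r /\ x - 2 * r <= x + r) by lra.
have [r4 [r5 r6]] : x - 2 * r < x - r /\ (x - r - (x - 2 * r) = r /\ x - r <= x + 2 * r) by lra.
have [r7 [r8 r9]] : y + r < y + 2 * r /\ (y + 2 * r - (y + r) = r /\ y - 2 * r <= y + r) by lra.
have [r10 [r11 r12]] : y - 2 * r < y - r /\ (y - r - (y - 2 * r) = r /\ y - r <= y + 2 * r) by lra.
have [b hb Ib] := gv _ _ r1 r2 r3 (lexx _).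
have [a ha Ia] := gv _ _ r4 r5 (lexx _) r6.
have [d hd Id] := gh _ _ r7 r8 r9 (lexx _).
have [c hc Ic] := gh _ _ r10 r11 (lexx _) r12.
clear gv gh; have hh := est a b c d ha hb hc hd; clear est.
have [/andP[ha1 ha2] /andP[hb1 hb2]] := (ha, hb).
have [/andP[hc1 hc2] /andP[hd1 hd2]] := (hc, hd).
have rr : - r <= r by rewrite -subr_ge0 opprK addr_ge0 ?(ltW r0).
have [xx yy] : x - r <= x + r /\ y - r <= y + r by rewrite !lerD2l.
have ab : a <= b := le_trans ha2 (le_trans xx hb1).
have cd : c <= d := le_trans hc2 (le_trans yy hd1).
have hbd : bd_norm i a b c d w1 <= 12 * E.
  have j1 := Ib c d hc1 cd hd2; have j2 := Ia c d hc1 cd hd2.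
  have j3 := Id a b ha1 ab hb2; have j4 := Ic a b ha1 ab hb2.
  by rewrite /bd_norm (_ : 12 * E = 3 * E + 3 * E + (3 * E + 3 * E)) ?lerD//; ring.
rewrite ler_pdivlMr// -(ler_pM2l (_ : 0 < r ^+ 2)) ?exprn_gt0//.
rewrite (_ : r ^+ 2 * (`|w1 (pt x y)| * r) = r ^+ 3 * `|w1 (pt x y)|); last by ring.
apply: (le_trans hh).
apply: (@le_trans _ _ ((4 * r) ^+ 2 * (12 * E))).
  by rewrite ler_wpM2l// exprn_ge0// mulr_ge0// ltW.
rewrite (_ : (4 * r) ^+ 2 * (12 * E) = r ^+ 2 * (192 * E)); last by ring.
by rewrite ler_pM2l ?exprn_gt0// ler_pM2r// ler_nat.
Qed.

End Bergman.

(** * Exponential, logarithm and powers in a slice *)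

Section RealAux.
Variable R : realType.

Lemma is_derive_expand (f : R -> R) (x D : R) : is_derive (x : R^o) (1 : R^o) (f : R^o -> R^o) D ->
  forall e, 0 < e -> exists2 d, 0 < d & forall h : R, `|h| < d ->
    `|f (h + x) - f x - h * D| <= e * `|h|.
Proof.
move=> [df <-] e e0; move: df => /cvgrPdist_le /(_ e e0).
rewrite near_withinE => /nbhs_ballP[d /= d0 hd]; exists d => // h hh.
have [->|h0] := eqVneq h 0.
  by rewrite add0r mul0r subr0 subrr !normr0 mulr0 lexx.
have := hd h; rewrite /ball/= sub0r normrN => /(_ hh h0).
rewrite [h *: _]mulr1 -/(derive f x 1); set D' := derive f x 1 => hl.
have nh : 0 < `|h| by rewrite normr_gt0.
rewrite (_ : f (h + x) - f x - h * D' = - (h * (D' - h^-1 *: (f (h + x) - f x)))).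
  by rewrite normrN normrM mulrC ler_pM2r.
by rewrite /GRing.scale/=; field.
Qed.

(** Only the strict monotonicity of [cos] is involved. The end points are
    included because positive real points have argument zero. *)
Lemma acos_cont (c0 : R) : -1 <= c0 <= 1 -> forall e, 0 < e -> exists2 d, 0 < d &
  forall c, -1 <= c <= 1 -> `|c - c0| < d -> `|acos c - acos c0| < e.
Proof.
move=> hc0 e e0; set a := acos c0.
have a0 : 0 <= a by exact: acos_ge0.
have api : a <= pi by exact: acos_lepi.
have cosa : cos a = c0 by rewrite /a acosK// in_itv.
have [d1 d10 h1] : exists2 d, 0 < d & forall c, -1 <= c <= 1 -> `|c - c0| < d -> acos c < a + e.
  have [ae|ae] := leP (a + e) pi; last first.
    exists 1 => // c hc _; apply: le_lt_trans ae; exact: acos_lepi.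
  exists (c0 - cos (a + e)).
    by rewrite subr_gt0 -cosa ltr_cos ?in_itv/=; lra.
  move=> c hc; rewrite ltr_norml => /andP[hd _].
  rewrite -[_ < _]ltr_cos ?in_itv/= ?acos_ge0 ?acos_lepi ?acosK ?in_itv//=; lra.
have [d2 d20 h2] : exists2 d, 0 < d & forall c, -1 <= c <= 1 -> `|c - c0| < d -> a - e < acos c.
  have [ae|ae] := leP 0 (a - e); last first.
    by exists 1 => // c hc _; apply: lt_le_trans ae _; exact: acos_ge0.
  exists (cos (a - e) - c0).
    by rewrite subr_gt0 -cosa ltr_cos ?in_itv/=; lra.
  move=> c hc; rewrite ltr_norml => /andP[_ hd].
  rewrite -[_ < _]ltr_cos ?in_itv/= ?acos_ge0 ?acos_lepi ?acosK ?in_itv//=; lra.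
exists (Num.min d1 d2); first by rewrite lt_min d10.
move=> c hc; rewrite lt_min => /andP[c1 c2]; rewrite ltr_norml.
by have := h1 c hc c1; have := h2 c hc c2; lra.
Qed.
End RealAux.

Section ExpLog.
Variable R : realType.
Local Notation H := (quat R).
Variables (i : H) (hi : imag_sphere i).
Local Notation pt := (slice_pt i).

Definition cexp (z : H) : H :=
  pt (expR (qre z) * cos (imc i z)) (expR (qre z) * sin (imc i z)).

Lemma imcD z w : imc i (z + w) = imc i z + imc i w.
Proof. by rewrite /imc mulrDr -opprD. Qed.

Lemma imcZ a z : imc i (a *: z) = a * imc i z.
Proof. by rewrite /imc -scalerAr /= mulrN. Qed.

Lemma cexpD z w : cexp (z + w) = cexp z * cexp w.
Proof.
rewrite /cexp imcD slice_ptM// [qre (z + w)]/(qre z + qre w) expRD cosD sinD.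
by congr pt; ring.
Qed.

Lemma slice_cexp z : slice i (cexp z). Proof. exact: slice_slice_pt. Qed.

Lemma norm_cexp z : `|cexp z| = expR (qre z).
Proof.
apply/eqP; rewrite -(@eqrXn2 _ 2)// ?expR_ge0//.
by rewrite (sqr_norm_slice_pt hi) !exprMn -mulrDr cos2Dsin2 mulr1.
Qed.

Lemma cexp_neq0 z : cexp z != 0.
Proof. by rewrite -normr_gt0 norm_cexp expR_gt0. Qed.

Lemma cexp_small e : 0 < e -> exists2 d, 0 < d & forall h, slice i h -> `|h| < d ->
  `|cexp h - 1 - h| <= e * `|h|.
Proof.
move=> e0; have e8 : 0 < Num.min 1 (e / 8) by rewrite lt_min ltr01 divr_gt0.
have [d1 d10 h1] := is_derive_expand (is_derive_expR (0 : R)) e8.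
have [d2 d20 h2] := is_derive_expand (is_derive_cos (0 : R)) e8.
have [d3 d30 h3] := is_derive_expand (is_derive_sin (0 : R)) e8.
have [em1 em8] : Num.min 1 (e / 8) <= 1 /\ Num.min 1 (e / 8) <= e / 8.
  by rewrite !ge_min !lexx orbT.
exists (Num.min (Num.min d1 (Num.min d2 d3)) (Num.min (1 / 2) (e / 8))).
  by rewrite !lt_min d10 d20 d30 !divr_gt0.
move=> h Sh; rewrite !lt_min => /andP[/andP[hd1 /andP[hd2 hd3]] /andP[hd4 hd5]].
set x := qre h; set y := imc i h.
have [nx ny] : `|x| <= `|h| /\ `|y| <= `|h|.
  by rewrite [in leRHS](slice_ptE hi Sh) [in X in _ /\ X](slice_ptE hi Sh); exact: norm_slice_pt_ge.
have := h1 x (le_lt_trans nx hd1); have := h2 y (le_lt_trans ny hd2).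
have := h3 y (le_lt_trans ny hd3).
rewrite !addr0 expR0 cos0 sin0 !subr0 oppr0 mulr0 !mulr1 !subr0.
move: (Num.min 1 (e / 8)) em1 em8 e8 {h1 h2 h3} => m em1 em8 e8 k3 k2 k1.
have n0 := normr_ge0 h.
have mx : m * `|x| <= e / 8 * `|h| by rewrite ler_pM// ?normr_ge0//; lra.
have my : m * `|y| <= e / 8 * `|h| by rewrite ler_pM// ?normr_ge0//; lra.
have mx1 : m * `|x| <= `|x| by rewrite ler_piMl.
have E1 : `|expR x - 1| <= 2 * `|x|.
  by have := ler_normD (expR x - 1 - x) x; rewrite subrK; lra.
have E2 : `|expR x| <= 2.
  by have := ler_normD (expR x - 1) 1; rewrite subrK normr1; lra.
have exy : `|(expR x - 1) * y| <= e / 4 * `|h|.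
  rewrite normrM (le_trans (ler_pM _ _ E1 ny))//.
  by rewrite -mulrA mulrCA mulrA ler_wpM2r//; lra.
have e1 : `|expR x * (cos y - 1)| <= e / 4 * `|h|.
  rewrite normrM (le_trans (ler_pM _ _ E2 k2))//; lra.
have e2 : `|expR x * (sin y - y)| <= e / 4 * `|h|.
  rewrite normrM (le_trans (ler_pM _ _ E2 k3))//; lra.
have -> : cexp h - 1 - h = pt (expR x * cos y - 1 - x) (expR x * sin y - y).
  rewrite /cexp -/x -/y [in X in _ - X](slice_ptE hi Sh) -/x -/y.
  by rewrite -[1 in LHS](scale1r (1 : H)) -(slice_pt0 i) !slice_ptB subr0.
rewrite (le_trans (norm_slice_pt_le hi _ _))//.
rewrite (_ : _ - 1 - x = (expR x - 1 - x) + expR x * (cos y - 1)); last by ring.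
rewrite (_ : _ - y = expR x * (sin y - y) + (expR x - 1) * y); last by ring.
have := ler_normD (expR x - 1 - x) (expR x * (cos y - 1)).
have := ler_normD (expR x * (sin y - y)) ((expR x - 1) * y).
by have := mulr_ge0 (ltW e0) n0; lra.
Qed.

Lemma holo_cexp z : slice i z -> holo i cexp z (cexp z).
Proof.
move=> Sz e e0; have n0 : 0 < `|cexp z| by rewrite normr_gt0 cexp_neq0.
have [d d0 hd] := cexp_small (divr_gt0 e0 n0); exists d => // w Sw wd.
have Sh := sliceB Sw Sz.
have -> : cexp w - cexp z - (w - z) * cexp z = (cexp (w - z) - 1 - (w - z)) * cexp z.
  by rewrite -[in LHS](subrK z w) cexpD addrK !mulrBl mul1r.
rewrite Defs.normqM -ler_pdivlMr// mulrAC; exact: hd.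
Qed.

Definition off_cut (z : H) := slice i z /\ (imc i z != 0 \/ 0 < qre z).

Definition clog (z : H) : H := pt (ln `|z|) (principal_arg (qre z) (imc i z)).

Lemma norm_slice_sqrt x y : `|pt x y| = Num.sqrt (x ^+ 2 + y ^+ 2).
Proof. by rewrite -(sqr_norm_slice_pt hi) sqrtr_sqr ger0_norm. Qed.

Lemma off_cut_neq0 z : off_cut z -> z != 0.
Proof.
move=> [Sz h]; apply/eqP => z0; move: h; rewrite z0 /imc mulr0 /= oppr0 eqxx ltxx.
by case.
Qed.

Lemma qre_div_norm z : slice i z -> z != 0 -> -1 <= qre z / `|z| <= 1.
Proof.
move=> Sz z0; have nz : 0 < `|z| by rewrite normr_gt0.
have := norm_slice_pt_ge hi (qre z) (imc i z); rewrite -(slice_ptE hi Sz) => -[+ _].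
by rewrite ler_norml ler_pdivrMr// ler_pdivlMr// mulN1r mul1r.
Qed.

Lemma principal_argE z : slice i z -> principal_arg (qre z) (imc i z) =
  if 0 <= imc i z then acos (qre z / `|z|) else - acos (qre z / `|z|).
Proof.
by move=> Sz; rewrite /principal_arg -norm_slice_sqrt -(slice_ptE hi Sz).
Qed.

Lemma cexp_clog z : slice i z -> z != 0 -> cexp (clog z) = z.
Proof.
move=> Sz z0; have nz : 0 < `|z| by rewrite normr_gt0.
rewrite /cexp /clog (qre_slice_pt hi) (imc_slice_pt hi) lnK ?posrE//.
have hc := qre_div_norm Sz z0.
rewrite [RHS](slice_ptE hi Sz) principal_argE//.
have cE : `|z| * cos (acos (qre z / `|z|)) = qre z.
  by rewrite acosK ?in_itv// mulrC divfK// gt_eqF.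
have sE : `|z| * sin (acos (qre z / `|z|)) = `|imc i z|.
  rewrite sin_acos// -[X in X * _]ger0_norm// -sqrtr_sqr -sqrtrM ?sqr_ge0//.
  rewrite -[RHS]sqrtr_sqr; congr Num.sqrt; rewrite mulrBr mulr1 -exprMn.
  rewrite (mulrC `|z|) divfK ?gt_eqF// [in X in X - _](slice_ptE hi Sz).
  by rewrite (sqr_norm_slice_pt hi) addrC addKr.
case: leP => y0; first by rewrite cE sE ger0_norm.
by rewrite cosN sinN mulrN cE sE ltr0_norm// opprK.
Qed.

Lemma cont_imc z w : slice i z -> slice i w ->
  `|qre w - qre z| <= `|w - z| /\ `|imc i w - imc i z| <= `|w - z|.
Proof.
move=> Sz Sw; rewrite [in leRHS](slice_ptE hi Sz) [in leRHS](slice_ptE hi Sw).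
rewrite [in X in _ /\ X](slice_ptE hi Sz) [in X in _ /\ X](slice_ptE hi Sw) slice_ptB.
by rewrite !(imc_slice_pt hi); exact: norm_slice_pt_ge.
Qed.

Lemma qre_div_cont z : slice i z -> z != 0 -> forall e, 0 < e ->
  exists2 d, 0 < d & forall w, slice i w -> `|w - z| < d ->
    w != 0 /\ `|qre w / `|w| - qre z / `|z| | < e.
Proof.
move=> Sz z0 e e0; have nz : 0 < `|z| by rewrite normr_gt0.
exists (Num.min (`|z| / 2) (e * `|z| / 4)).
  by rewrite lt_min !divr_gt0// mulr_gt0.
move=> w Sw; rewrite lt_min => /andP[w1 w2].
have nw : `|z| / 2 < `|w|.
  by have := ler_normB w (w - z); rewrite subKr => h; lra.
have nw0 : 0 < `|w| by lra.
split; first by rewrite -normr_gt0.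
have [k1 _] := cont_imc Sz Sw.
have k2 : `| `|w| - `|z| | <= `|w - z| by exact: ler_dist_dist.
have k3 : `|qre z| <= `|z| by case: (normq_comps z).
rewrite (_ : _ - _ = ((qre w - qre z) - (qre z / `|z|) * (`|w| - `|z|)) / `|w|); last first.
  by field; rewrite !gt_eqF.
rewrite normrM normfV (gtr0_norm nw0) ltr_pdivrMr//.
have k4 : `|qre z / `|z| * (`|w| - `|z|)| <= `|w - z|.
  rewrite normrM -[leRHS]mul1r ler_pM// normrM normfV (gtr0_norm nz).
  by rewrite ler_pdivrMr// mul1r.
have k5 : e * `|z| / 2 < e * `|w| by rewrite -mulrA ltr_pM2l.
have := ler_normB (qre w - qre z) (qre z / `|z| * (`|w| - `|z|)).
lra.
Qed.

(** The sign in the definition of the argument changes only across the real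
    axis; off the cut it does so where [acos] vanishes. *)
Lemma clog_cont z : off_cut z -> forall e, 0 < e -> exists2 d, 0 < d &
  forall w, slice i w -> `|w - z| < d -> `|clog w - clog z| < e.
Proof.
move=> oz e e0; have z0 := off_cut_neq0 oz; have [Sz hz] := oz.
have nz : 0 < `|z| by rewrite normr_gt0.
have e2 : 0 < e / 2 by rewrite divr_gt0.
have [d1 d10 h1] : exists2 d, 0 < d & forall w, slice i w -> `|w - z| < d ->
    `|ln `|w| - ln `|z| | < e / 2.
  have := continuous_ln nz => /cvgrPdist_lt /(_ _ e2) /nbhs_ballP[d /= d0 hd].
  exists d => // w Sw wd; rewrite distrC; apply: hd; rewrite /ball/= distrC.
  exact: le_lt_trans (ler_dist_dist _ _) wd.
have hc := qre_div_norm Sz z0.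
have [d d0 hd] := acos_cont hc e2.
have [d2 d20 h2] := qre_div_cont Sz z0 d0.
have [d3 d30 h3] : exists2 d, 0 < d & forall w, slice i w -> `|w - z| < d ->
    `|principal_arg (qre w) (imc i w) - principal_arg (qre z) (imc i z)| < e / 2.
  have [y0|y0] := eqVneq (imc i z) 0.
    exists d2 => // w Sw wd; have [w0 hw] := h2 w Sw wd.
    have := hd _ (qre_div_norm Sw w0) hw.
    rewrite !principal_argE// y0 lexx.
    have x0 : 0 < qre z by case: hz => //; rewrite y0 eqxx.
    have -> : qre z / `|z| = 1.
      rewrite [in X in _ / X](slice_ptE hi Sz) y0 slice_pt0 normqA gtr0_norm//.
      by rewrite divff// gt_eqF.
    by rewrite acos1 !subr0; case: ifP => // _; rewrite normrN.
  exists (Num.min d2 `|imc i z|); first by rewrite lt_min d20 normr_gt0.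
  move=> w Sw; rewrite lt_min => /andP[wd wy]; have [w0 hw] := h2 w Sw wd.
  have [_ k] := cont_imc Sz Sw; have {k wy} := le_lt_trans k wy.
  have := hd _ (qre_div_norm Sw w0) hw.
  rewrite !principal_argE//; case: (leP 0 (imc i z)) => yz.
    rewrite (ger0_norm yz) => k; rewrite ltr_norml => /andP[k1 _].
    by rewrite (_ : 0 <= imc i w)//; lra.
  rewrite (ltr0_norm yz) => k; rewrite ltr_norml => /andP[_ k1].
  rewrite leNgt (_ : imc i w < 0) /=; last lra.
  by rewrite -opprD normrN.
exists (Num.min d1 d3); first by rewrite lt_min d10.
move=> w Sw; rewrite lt_min => /andP[wd1 wd3]; rewrite /clog slice_ptB.
rewrite (le_lt_trans (norm_slice_pt_le hi _ _))//.
have := h1 w Sw wd1; have := h3 w Sw wd3; lra.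
Qed.

(** The derivative of the logarithm comes from that of its inverse, the
    exponential, once continuity is known. *)
Lemma holo_clog z : off_cut z -> holo i clog z z^-1.
Proof.
move=> oz; have z0 := off_cut_neq0 oz; have [Sz hz] := oz.
have nz : 0 < `|z| by rewrite normr_gt0.
move=> e e0; set e' := Num.min (1 / 2) (e * `|z| / 2).
have e'0 : 0 < e' by rewrite lt_min !divr_gt0// mulr_gt0.
have [em1 em2] : e' <= 1 / 2 /\ e' <= e * `|z| / 2 by rewrite !ge_min !lexx orbT.
have [d d0 hd] := cexp_small e'0; have [r r0 hr] := clog_cont oz d0.
exists (Num.min r `|z|); first by rewrite lt_min r0.
move=> w Sw; rewrite lt_min => /andP[wr wz].
have w0 : w != 0 by apply: contraTneq wz => ->; rewrite sub0r normrN ltxx.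
set k := clog w - clog z.
have Sk : slice i k by apply: sliceB; exact: slice_slice_pt.
have hk := hd k Sk (hr w Sw wr).
have wE : w - z = (cexp k - 1) * z.
  by rewrite mulrBl mul1r -[in X in _ * X](cexp_clog Sz z0) -cexpD subrK !cexp_clog.
rewrite wE -mulrA mulrV ?unitqE// mulr1.
rewrite -/k -(opprB (cexp k - 1)) normrN (le_trans hk)//.
have k2 : `|k| <= 2 * `|cexp k - 1|.
  have := ler_normB (cexp k - 1) (cexp k - 1 - k); rewrite subKr.
  have : e' * `|k| <= 1 / 2 * `|k| by rewrite ler_wpM2r.
  lra.
rewrite Defs.normqM (@le_trans _ _ (e * `|z| / 2 * (2 * `|cexp k - 1|)))//.
  by rewrite ler_pM// ltW.
by rewrite le_eqVlt; apply/orP; left; apply/eqP; field.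
Qed.

Definition cpow (a : R) (z : H) := cexp (a%:A * clog z).

Lemma holo_cpow a z : off_cut z -> holo i (cpow a) z (a%:A * z^-1 * cpow a z).
Proof.
move=> oz; have [Sz _] := oz.
have Sl w : slice i (a%:A * clog w).
  by apply: sliceM => //; [exact: sliceA|exact: slice_slice_pt].
apply: (@holo_comp _ i (fun w => a%:A * clog w) cexp) => //.
  by apply: holo_mull => //; [exact: sliceA|exact: holo_clog].
exact: holo_cexp.
Qed.

Lemma qpowRE a z : off_cut z -> qpowR z a = cpow a z.
Proof.
move=> oz; have z0 := off_cut_neq0 oz; have [Sz hz] := oz.
have nz : 0 < `|z| by rewrite normr_gt0.
rewrite [in LHS](slice_ptE hi Sz) qpowR_slice//; last first.
  by move=> y0; case: hz => //; rewrite y0 eqxx.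
rewrite /slice_powR -norm_slice_sqrt -(slice_ptE hi Sz) /cpow /cexp -scaleqE imcZ.
rewrite [qre (a *: _)]/(a * qre _) (qre_slice_pt hi) (imc_slice_pt hi).
by rewrite /powR gt_eqF.
Qed.

Lemma slice_exp_trunc k z : slice i z -> slice i (exp_trunc k z).
Proof.
move=> Sz; rewrite /exp_trunc; elim/big_ind: _ => [|x y|n _].
- exact: slice0.
- exact: sliceD.
- by apply: sliceZ; exact: sliceX.
Qed.

Lemma holo_expn n z : slice i z -> holo i (fun w => w ^+ n.+1) z (n.+1%:R%:A * z ^+ n).
Proof.
move=> Sz; elim: n => [|n IH].
  by rewrite expr0 mulr1 scale1r; exact: holo_id.
have := holo_mul hi Sz Sz (holo_id i z) IH.
rewrite mul1r mulrA -(slice_comm hi (sliceA i _) Sz) -mulrA -exprS -[X in X + _]mul1r.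
rewrite -mulrDl -[X in X + _]scale1r -scalerDl addrC natr1.
by apply: (diff_within_near ltr01) => [|w _ _]; rewrite -exprS.
Qed.

Lemma holo_exp_trunc k z : slice i z -> holo i (exp_trunc k.+1) z (exp_trunc k z).
Proof.
move=> Sz; elim: k => [|k IH].
  have -> : exp_trunc 1 = fun w : H => 1 + w.
    apply/funext => w; rewrite /exp_trunc big_nat_recr//= big_nat1.
    by rewrite !fact0 invr1 !scale1r expr0 expr1.
  rewrite /exp_trunc big_nat1 expr0 fact0 invr1 scale1r -[X in holo _ _ _ X]add0r.
  exact: holo_add (holo_cst i 1 z) (holo_id i z).
have recE m : exp_trunc m.+1 = fun w : H => exp_trunc m w + (m.+1`!%:R^-1)%:A * w ^+ m.+1.
  by apply/funext => w; rewrite /exp_trunc big_nat_recr//= -scaleqE.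
have cE : (k.+2`!%:R^-1)%:A * (k.+2%:R)%:A = (k.+1`!%:R^-1)%:A :> H.
  rewrite -scaleqE scalerA factS natrM invfM.
  by rewrite mulrAC mulVf ?pnatr_eq0// mul1r.
have zE : exp_trunc k.+1 z = exp_trunc k z + (k.+1`!%:R^-1)%:A * z ^+ k.+1 by rewrite recE.
rewrite zE (recE k.+1); apply: holo_add => //.
have := holo_mull hi Sz (sliceA i (k.+2`!%:R^-1)) (holo_expn k.+1 Sz).
by rewrite mulrA cE.
Qed.

End ExpLog.

(** * The slit ball and the fractional derivative *)

Section SlitBall.
Variable R : realType.
Local Notation H := (quat R).

Lemma slit_ballE (q : H) : @slit_ball R q <-> `|q| < 1 /\ (0 < qre q \/ qim q != 0).
Proof.
split=> [[q1 nq]|[q1 hq]].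
  split=> //; have [q0|] := eqVneq (qim q) 0; last by right.
  left; rewrite ltNge; apply/negP => x0; apply: nq.
  have qE : q = (qre q)%:A.
    by case: q0 => a b c; apply: quatP => /=; rewrite ?a ?b ?c; ring.
  have q1' : `|(qre q)%:A : H| < 1 by rewrite -qE.
  exists (qre q) => //=; rewrite in_itv/= x0 andbT.
  by move: q1'; rewrite normqA ltr_norml => /andP[].
split=> // -[x /=]; rewrite in_itv/= => /andP[x1 x0] qE.
case: hq; rewrite -qE /=; first by rewrite mulr1 ltNge x0.
by rewrite /qim /= mulr0 eqxx.
Qed.

Lemma norm_qim_le (q : H) : `|qim q| <= `|q|.
Proof.
rewrite -ler_sqr ?nnegrE// !sqr_normq /= expr0n/= add0r.
by have := sqr_ge0 (qre q); lra.
Qed.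

Lemma qimB (p q : H) : qim (p - q) = qim p - qim q.
Proof. by apply: quatP => /=; rewrite ?subr0. Qed.

Lemma slit_ball_open (q : H) : slit_ball q -> exists2 r, 0 < r &
  forall p, `|p - q| < r -> slit_ball p.
Proof.
move=> /slit_ballE[q1 hq].
have [r r0 hr] : exists2 r, 0 < r & forall p, `|p - q| < r -> 0 < qre p \/ qim p != 0.
  case: hq => [x0|y0].
    exists (qre q) => // p hp; left; case: (normq_comps (p - q)) => h _ _ _.
    by have := le_lt_trans h hp; rewrite /= ltr_norml; lra.
  exists `|qim q|; first by rewrite normr_gt0.
  move=> p hp; right; apply/eqP => p0.
  have := le_lt_trans (norm_qim_le (p - q)) hp.
  by rewrite qimB p0 sub0r normrN ltxx.
exists (Num.min r (1 - `|q|)); first by rewrite lt_min r0 subr_gt0.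
move=> p; rewrite lt_min => /andP[h1 h2]; apply/slit_ballE; split; last exact: hr.
by have := ler_normD (p - q) q; rewrite subrK; lra.
Qed.

Lemma slit_extE (f : slit_fun R) (q : @slit_ball R) : slit_ext f (val q) = f q.
Proof. exact: (congr1 (fun g => g q) (valLK (0 : H) (f : @slit_ball R -> H))). Qed.

Lemma slit_ext_out (f : slit_fun R) (q : H) : ~ slit_ball q -> slit_ext f q = 0.
Proof.
move=> nq; rewrite /slit_ext /valL_ /= oinv_set_val insubN//.
by apply/negP; rewrite inE.
Qed.

Lemma slit_ext_at (f : slit_fun R) (q : H) (hq : q \in @slit_ball R) :
  slit_ext f q = f (SigSub hq).
Proof. exact: (slit_extE f (SigSub hq)). Qed.

Lemma slit_extD (f g : slit_fun R) q : slit_ext (f + g) q = slit_ext f q + slit_ext g q.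
Proof.
have [hq|nq] := pselect (slit_ball q); last by rewrite !slit_ext_out// addr0.
by move/mem_set: hq => hq; rewrite !slit_ext_at.
Qed.

Lemma slit_extZ (a : (quat R)^c) (f : slit_fun R) q :
  slit_ext (a *: f) q = slit_ext f q * (a : H).
Proof.
have [hq|nq] := pselect (slit_ball q); last by rewrite !slit_ext_out// mul0r.
by move/mem_set: hq => hq; rewrite !slit_ext_at.
Qed.

Lemma slit_ext0 q : slit_ext (0 : slit_fun R) q = 0.
Proof.
have [hq|nq] := pselect (slit_ball q); last by rewrite !slit_ext_out.
by move/mem_set: hq => hq; rewrite !slit_ext_at.
Qed.

Lemma slit_extB (f g : slit_fun R) q : slit_ext (f - g) q = slit_ext f q - slit_ext g q.
Proof.
have [hq|nq] := pselect (slit_ball q); last by rewrite !slit_ext_out// subr0.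
by move/mem_set: hq => hq; rewrite !slit_ext_at.
Qed.

Lemma slit_fun_eq0 (f : slit_fun R) : (forall q, slit_ball q -> slit_ext f q = 0) -> f = 0.
Proof.
move=> hf; apply/funext => q; rewrite -slit_extE; apply: hf.
exact: set_valP.
Qed.

Definition real_linear (L : H -> H) := forall (a : R) u v, L (a *: u + v) = a *: L u + L v.

Lemma differentiable_diff_within (f : H -> H) (q : H) (L : H -> H) :
  real_linear L -> bdd_map L -> diff_within setT f q L -> differentiable f q.
Proof.
move=> lL [C C0 bL] hf.
pose Lm : {linear H -> H} := HB.pack L (GRing.isLinear.Build R H H _ L lL).
have LB (u v : H) : L u - L v = L (u - v) by exact: (esym (raddfB Lm u v)).
have cL : continuous L.
  move=> x; apply/(@cvgrPdist_lt R H H (nbhs x) _ L (L x)) => e e0; apply/nbhs_ballP; exists (e / C).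
    by rewrite /= divr_gt0.
  move=> y; rewrite -ball_normE/= => hy; rewrite LB (le_lt_trans (bL _))//.
  by rewrite mulrC -ltr_pdivlMr.
have e : f \o shift q = cst (f q) + (Lm : H -> H) +o_ (0 : H) id.
  apply/eqaddoP => eps eps0; have [d d0 hd] := hf eps eps0.
  apply/nbhs_ballP; exists d => //= h; rewrite -ball_normE/= sub0r normrN => hh.
  have := hd (h + q) I; rewrite addrK => /(_ hh).
  by rewrite [X in `|X| <= _](_ : _ = f (h + q) - (f q + L h))// opprD addrA.
have dE := @diff_unique R H H f Lm q cL e.
by apply/diff_locallyP; rewrite dE.
Qed.

Lemma diff_within_differentiable (f : H -> H) (q : H) : differentiable f q ->
  diff_within setT f q ('d f q).
Proof.
move=> /diff_locally/eqaddoP hf e e0.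
have := hf e e0 => /nbhs_ballP[d /= d0 hd]; exists d => // w _ wd.
have := hd (w - q); rewrite -ball_normE/= sub0r normrN => /(_ wd).
rewrite [X in `|X| <= _ -> _](_ : _ = f (w - q + q) - (f q + 'd f q (w - q)))//.
by rewrite subrK opprD addrA.
Qed.

Lemma line_derivative (f : H -> H) (q u D : H) (g : R -> H) (t : R) :
  (forall s, g s = q + (s - t) *: u) ->
  (forall e, 0 < e -> exists2 d, 0 < d & forall s : R, `|(s - t) *: u| < d ->
     `|f (q + (s - t) *: u) - f q - (s - t) *: D| <= e * `|(s - t) *: u|) ->
  derive1 (fun s => f (g s)) t = D.
Proof.
move=> gE hf; rewrite derive1E; apply: (@derive_val _ _ _ _ _ _ D _).
apply: is_derive_eps => e e0.
have u0 : 0 < `|u| + 1 by rewrite ltr_wpDl.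
have [d d0 hd] := hf _ (divr_gt0 e0 u0).
exists (d / (`|u| + 1)); first by rewrite divr_gt0.
move=> s; rewrite ltr_pdivlMr// => hs.
have su : `|(s - t) *: u| <= `|s - t| * (`|u| + 1).
  by rewrite normrZ ler_wpM2l// lerDl.
rewrite !gE subrr scale0r addr0 (le_trans (hd s (le_lt_trans su hs)))//.
by rewrite mulrAC ler_pdivrMr// -mulrA ler_pM2l.
Qed.

(** The Cauchy-Riemann equation says that the real differential maps [i] to [i]
    times the image of 1, hence acts on the plane of [i] as a right factor. *)
Lemma slice_regular_holo (f : slit_fun R) (i : H) (hi : imag_sphere i) (z : H) :
  slice_regular f -> slit_slice i z -> holomorphic_at i (slit_ext f) z.
Proof.
move=> [df cr] [Bz Sz]; have hd := diff_within_differentiable (df z Bz).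
set F := slit_ext f in hd *; set L := 'd F z in hd.
have zE := slice_ptE hi Sz.
have dv u s : diff_within setT F z L -> forall e, 0 < e -> exists2 d, 0 < d &
    forall s' : R, `|(s' - s) *: u| < d ->
     `|F (z + (s' - s) *: u) - F z - (s' - s) *: L u| <= e * `|(s' - s) *: u|.
  move=> h e e0; have [d d0 hd'] := h e e0; exists d => // s' hs.
  by have := hd' (z + (s' - s) *: u) I; rewrite (addrC z) addrK linearZ; apply.
have := cr i hi (qre z) (imc i z); rewrite -zE => /(_ Bz).
rewrite (@line_derivative F z 1 (L 1) _ _ _ (dv _ _ hd)); last first.
  by move=> s; rewrite [X in _ = X + _]zE /slice_pt addrAC -scalerDl (addrC (qre z)) subrK.
rewrite (@line_derivative F z i (L i) _ _ _ (dv _ _ hd)); last first.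
  by move=> s; rewrite [X in _ = X + _]zE /slice_pt -addrA -scalerDl (addrC (imc i z)) subrK.
move=> e; exists (L 1).
have Li : L i = i * L 1.
  move: (congr1 (fun x => i * x) e); rewrite mulr0 mulrDr mulrA (sphere_sqr hi) mulN1r.
  by move=> /eqP; rewrite subr_eq0 => /eqP.
have hL h : slice i h -> L h = h * L 1.
  move=> Sh; rewrite [in LHS](slice_ptE hi Sh) [in RHS](slice_ptE hi Sh) /slice_pt.
  by rewrite linearD !linearZ /= Li mulrDl -!scalerAl mul1r.
move=> e' e0; have [d d0 hd'] := hd e' e0; exists d => // w Sw wd.
by rewrite -hL; [exact: hd'|exact: sliceB].
Qed.

End SlitBall.

Section FracDeriv.
Variable R : realType.
Local Notation H := (quat R).
Variables (i : H) (hi : imag_sphere i).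
Local Notation pt := (slice_pt i).
Local Notation hol := (holomorphic_at i).

Lemma qim_slice_pt (x y : R) : qim (pt x y) = y *: i.
Proof.
case: hi => i0 _; apply: quatP => /=; rewrite ?i0 ?mulr0 ?add0r//.
Qed.

Lemma slit_slice_ptE (x y : R) :
  slit_slice i (pt x y) <-> x ^+ 2 + y ^+ 2 < 1 /\ (0 < x \/ y != 0).
Proof.
have i0 : i != 0 by case: hi => _ e; rewrite -normr_eq0 e oner_eq0.
have e1 : (`|pt x y| < 1) = (x ^+ 2 + y ^+ 2 < 1).
  by rewrite -(sqr_norm_slice_pt hi) expr_lt1.
have e2 : (qim (pt x y) != 0) = (y != 0).
  by rewrite qim_slice_pt scaler_eq0 (negbTE i0) orbF.
split=> [[/slit_ballE]|h]; first by rewrite e1 e2 (qre_slice_pt hi).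
split; last exact: slice_slice_pt.
by apply/slit_ballE; rewrite e1 e2 (qre_slice_pt hi).
Qed.

Lemma slit_slice_off_cut z : slit_slice i z -> off_cut i z.
Proof.
move=> hz; have [Bz Sz] := hz; split=> //; move: hz.
by rewrite {1}(slice_ptE hi Sz) => /slit_slice_ptE[_ []]; [right|left].
Qed.

Lemma slit_slice_open z : slit_slice i z -> exists2 r, 0 < r &
  forall w, slice i w -> `|w - z| < r -> slit_slice i w.
Proof.
by move=> [/slit_ball_open[r r0 hr] Sz]; exists r => // w Sw wr; split=> //; exact: hr.
Qed.

Variables (alpha sigma : R) (k : nat).
Hypotheses (halpha : 0 < alpha) (hsigma : 0 < sigma < 1) (hk : (1 <= k)%N).
Hypothesis hek : forall q : H, slit_ball q -> exp_trunc k.-1 (qpowR q alpha) != 0.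

(** The function [e_k(z^alpha)] with respect to which one differentiates, and
    its derivative. *)
Definition gE (z : H) := exp_trunc k (qpowR z alpha).
Definition dgE (z : H) :=
  alpha%:A * z^-1 * cpow i alpha z * exp_trunc k.-1 (cpow i alpha z).

(** On the slit slice [gE] is given by the complex power, which, unlike [gE],
    has its values in the slice everywhere. *)
Definition gpow (z : H) := exp_trunc k (cpow i alpha z).

Lemma slice_gpow z : slice i (gpow z).
Proof. by apply: (slice_exp_trunc hi); exact: slice_cexp. Qed.

Lemma gE_gpow z : slit_slice i z -> gE z = gpow z.
Proof. by move=> /slit_slice_off_cut oz; rewrite /gE /gpow (qpowRE hi). Qed.

Lemma holo_gpow z : off_cut i z -> holo i gpow z (dgE z).
Proof.
move=> oz; have hc := holo_cpow hi alpha oz.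
have Sc w : slice i (cpow i alpha w) by exact: slice_cexp.
rewrite /dgE /gpow; case: k hk => // k' _.
exact: (@holo_comp _ i (cpow i alpha) (exp_trunc k'.+1) _ _ _ (fun w _ => Sc w) hc
  (holo_exp_trunc hi k' (Sc z))).
Qed.

Lemma holo_gE z : slit_slice i z -> holo i gE z (dgE z).
Proof.
move=> hz; have [r r0 hr] := slit_slice_open hz.
apply: (diff_within_near (f := gpow) r0); first by rewrite gE_gpow.
  by move=> w Sw wr; rewrite gE_gpow//; exact: hr.
exact/holo_gpow/slit_slice_off_cut.
Qed.

Lemma slice_dgE z : slice i z -> slice i (dgE z).
Proof.
move=> Sz; have Sc : slice i (cpow i alpha z) by exact: slice_cexp.
apply: sliceM => //; last exact: slice_exp_trunc.
apply: sliceM => //; apply: sliceM => //; first exact: sliceA.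
exact: sliceV.
Qed.

(** On the slit slice only the factor [e_(k-1)] could vanish. *)
Lemma dgE_neq0 z : slit_slice i z -> dgE z != 0.
Proof.
move=> hz; have [Bz Sz] := hz; have oz := slit_slice_off_cut hz.
rewrite /dgE !mulq_eq0 !negb_or -!andbA; apply/and4P; split.
- by rewrite scaler_eq0 negb_or gt_eqF// oner_eq0.
- by rewrite -unitqE unitrV unitqE (off_cut_neq0 oz).
- exact: cexp_neq0.
- by rewrite -(qpowRE hi) //; exact: hek.
Qed.

Lemma hol_dgE z : slit_slice i z -> hol dgE z.
Proof.
move=> hz; have [Bz Sz] := hz; have oz := slit_slice_off_cut hz.
have Sc w : slice i (cpow i alpha w) by exact: slice_cexp.
have hc := holo_cpow hi alpha oz.
have hp : hol (exp_trunc k.-1) (cpow i alpha z).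
  case: k hk => // -[_|k' _] /=; last by eexists; exact: holo_exp_trunc.
  exists 0; have -> : exp_trunc 0 = fun _ : H => 1.
    by apply/funext => w; rewrite /exp_trunc big_nat1 expr0 fact0 invr1 scale1r.
  exact: holo_cst.
case: hp => p hp.
have hcp := @holo_comp _ i (cpow i alpha) (exp_trunc k.-1) _ _ _ (fun w _ => Sc w) hc hp.
have hi1 := holo_mull hi Sz (sliceA i alpha) (holo_inv hi (off_cut_neq0 oz) Sz).
have Sai : slice i (alpha%:A * z^-1) by apply: sliceM => //; [exact: sliceA|exact: sliceV].
have h2 := holo_mul hi Sz Sai hi1 hc.
have h3 := holo_mul hi Sz (sliceM hi Sai (Sc z)) h2 hcp.
by eexists; exact: h3.
Qed.

Lemma half_slit_slice : slit_slice i (2^-1)%:A.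
Proof.
rewrite -(slice_pt0 i); apply/slit_slice_ptE; split; last by left; lra.
by rewrite expr0n/= addr0; lra.
Qed.

(** The limit of the difference quotients with respect to [gE] is
    [dgE z ^-1 * p], by dividing numerator and denominator by [z - zeta]. *)
Lemma frac_derivE (f : slit_fun R) z p : slit_slice i z ->
  holo i (slit_ext f) z p ->
  frac_deriv sigma alpha k i f z =
  (1 - sigma) *: slit_ext f z + sigma *: ((dgE z)^-1 * p).
Proof.
move=> hz hp; rewrite /frac_deriv; congr (_ + _ *: _).
have [Bz Sz] := hz; have hg := holo_gE hz; set F := slit_ext f in hp *.
have n0 : 0 < `|dgE z| by rewrite normr_gt0 dgE_neq0.
have Sg w : slit_slice i w -> slice i (gE w).
  by move=> hw; rewrite gE_gpow//; exact: slice_gpow.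
have PF : ProperFilter (within (slit_slice i) (dnbhs z)).
  apply: Build_ProperFilter_ex => B; rewrite /within/= /dnbhs/= /within/=.
  move=> /nbhs_ballP[r /= r0 hr]; have [r1 r10 hr1] := slit_slice_open hz.
  pose t := Num.min r r1 / 2; have m0 : 0 < Num.min r r1 by rewrite lt_min r0.
  have t0 : 0 < t by rewrite divr_gt0.
  have : t < Num.min r r1 by rewrite ltr_pdivrMr// ltr_pMr// ltr1n.
  rewrite lt_min => /andP[tr tr1].
  have nt : `|z + t%:A - z| = t by rewrite (addrC z) addrK normqA gtr0_norm.
  exists (z + t%:A); apply: hr.
  - by rewrite -ball_normE/= distrC nt.
  - by apply/eqP => /(congr1 (fun x => `|x - z|)); rewrite nt subrr normr0; lra.
  - by apply: hr1; rewrite ?nt//; apply: sliceD => //; exact: sliceA.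
apply: (@cvg_lim H (@norm_hausdorff _ H) _ _ PF).
apply/(@cvgrPdist_le R H H _ (@filter_filter _ _ PF)) => e e0.
set a := `|dgE z|; pose C := (a / 2)^-1 * (1 + `|p| / a).
have C0 : 0 < C.
  by rewrite mulr_gt0 ?invr_gt0 ?divr_gt0// ltr_wpDr// divr_ge0// ltW.
pose e' := Num.min (a / 2) (e / C).
have e'0 : 0 < e' by rewrite lt_min !divr_gt0.
have [em1 em2] : e' <= a / 2 /\ e' <= e / C by rewrite !ge_min !lexx orbT.
have [d d0 hd] := hg _ e'0; have [d' d0' hd'] := hp _ e'0.
rewrite near_withinE near_withinE; apply/nbhs_ballP.
exists (Num.min d d'); first by rewrite /= lt_min d0.
move=> w; rewrite -ball_normE/= distrC lt_min => /andP[wd wd'] wz hw.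
have Sw : slice i w by case: hw.
have wz0 : w - z != 0 by rewrite subr_eq0.
have nwz : 0 < `|w - z| by rewrite normr_gt0.
pose A := (w - z)^-1 * (gE w - gE z); pose B := (w - z)^-1 * (F w - F z).
have SA : slice i A.
  by apply: sliceM => //; [apply/sliceV/sliceB|apply: sliceB; apply: Sg].
have quotE (h : H -> H) q : (w - z)^-1 * (h w - h z) - q =
    (w - z)^-1 * (h w - h z - (w - z) * q) by rewrite [RHS]mulrBr mulKr ?unitqE.
have nA : `|A - dgE z| <= e'.
  by rewrite /A quotE Defs.normqM normqV mulrC ler_pdivrMr//; exact: hd.
have nB : `|B - p| <= e'.
  by rewrite /B quotE Defs.normqM normqV mulrC ler_pdivrMr//; exact: hd'.
have gA : a / 2 <= `|A|.
  by have := ler_normB A (A - dgE z); rewrite subKr -/a; lra.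
have A0 : A != 0 by rewrite -normr_gt0; lra.
have gwz : gE z - gE w = - ((w - z) * A) by rewrite /A mulVKr ?unitqE// opprB.
have Fwz : F z - F w = - ((w - z) * B) by rewrite /B mulVKr ?unitqE// opprB.
have -> : (gE z - gE w)^-1 * (F z - F w) = A^-1 * B.
  rewrite gwz Fwz invrN mulrNN invrM ?unitqE//.
  by rewrite -mulrA mulKr ?unitqE.
have -> : (dgE z)^-1 * p - A^-1 * B = A^-1 * ((A - dgE z) * (dgE z)^-1 * p - (B - p)).
  have e1 : (A - dgE z) * (dgE z)^-1 * p = A * ((dgE z)^-1 * p) - p.
    by rewrite !mulrBl mulrV ?unitqE ?dgE_neq0// mul1r mulrA.
  by rewrite e1 opprB addrA subrK [RHS]mulrBr mulKr ?unitqE.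
rewrite Defs.normqM normqV (@le_trans _ _ ((a / 2)^-1 * (e' * (1 + `|p| / a))))//.
  have i1 : `|A|^-1 <= (a / 2)^-1.
    by rewrite lef_pV2 ?posrE ?normr_gt0// divr_gt0.
  apply: ler_pM => //.
  rewrite (le_trans (ler_normB _ _))// mulrDr mulr1 addrC lerD//.
  rewrite !Defs.normqM normqV -/a -mulrA [a^-1 * _]mulrC.
  by apply: ler_wpM2r => //; rewrite divr_ge0// ltW.
by rewrite mulrCA -/C -ler_pdivlMr//.
Qed.

End FracDeriv.

(** * Identity principle *)

Section Identity.
Variable R : realType.
Local Notation H := (quat R).

Section OneSlice.
Variables (i : H) (hi : imag_sphere i).
Local Notation pt := (slice_pt i).
Local Notation hol := (holomorphic_at i).

Lemma qreZ (a : R) (z : H) : qre (a *: z) = a * qre z. Proof. by []. Qed.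

Lemma lt1_of_sqrD (x y : R) : x ^+ 2 + y ^+ 2 < 1 -> x < 1.
Proof.
move=> h; rewrite ltNge; apply: contraPN h => x1.
have := ler_pM ler01 ler01 x1 x1; have := sqr_ge0 y; rewrite -expr2; lra.
Qed.

(** A weight whose modulus is [exp (n e^{- l y} cos (l x))]. *)
Definition weight (l n : R) (z : H) : H := cexp i (n%:A * cexp i (l *: i * z)).

Lemma slice_weight l n z : slice i (weight l n z). Proof. exact: slice_cexp. Qed.

Lemma hol_weight l n z : slice i z -> hol (weight l n) z.
Proof.
move=> Sz; have Sli : slice i (l *: i) by apply: sliceZ; exact: slicei.
have h1 := holo_mull hi Sz Sli (holo_id i z).
have h2 := @holo_comp _ i (fun z => l *: i * z) (cexp i) z _ _
  (fun w Sw => sliceM hi Sli Sw) h1 (holo_cexp hi (sliceM hi Sli Sz)).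
have h3 := holo_mull hi Sz (sliceA i n) h2.
have Sn w : slice i (n%:A * cexp i (l *: i * w)).
  by apply: sliceM => //; [exact: sliceA | exact: slice_cexp].
have h4 := @holo_comp _ i (fun z => n%:A * cexp i (l *: i * z)) (cexp i) z _ _
  (fun w _ => Sn w) h3 (holo_cexp hi (Sn z)).
by eexists; exact: h4.
Qed.

Lemma norm_weight l n x y :
  `|weight l n (pt x y)| = expR (n * (expR (- (l * y)) * cos (l * x))).
Proof.
rewrite /weight (norm_cexp hi) -scaleqE qreZ; congr (expR (n * _)).
have -> : l *: i * pt x y = pt (- (l * y)) (l * x).
  have -> : l *: i = pt 0 l by rewrite /slice_pt scale0r add0r.
  by rewrite slice_ptM//; congr pt; ring.
by rewrite /cexp (qre_slice_pt hi) (imc_slice_pt hi) (qre_slice_pt hi).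
Qed.

(** Two-constants argument: on the three sides other than the bottom the modulus of
    the weights stays exponentially below its value at the point of height [y],
    while [w] vanishes on the bottom; Cauchy's estimate then forces zero. The
    choice [l a = pi / 2] makes the cosine vanish on the vertical sides. *)
Lemma rect_zero (w : H -> H) (a B y : R) : 0 < a -> 0 < y < B ->
  on_rect i (- a) a 0 B (hol w) -> (forall x, `|x| <= a -> w (pt x 0) = 0) ->
  w (pt 0 y) = 0.
Proof.
move=> a0 /andP[y0 yB] hw w0.
have aa : - a <= a by lra.
have B0 : 0 <= B by lra.
have [C0 hC0] := hol_bounded_rect hi aa B0 hw.
pose C := Num.max C0 0.
have C_ge0 : 0 <= C by rewrite le_max lexx orbT.
have hC : on_rect i (- a) a 0 B (fun z => `|w z| <= C).
  by move=> s t hs ht; rewrite le_max hC0.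
pose l := pi / (2 * a).
have l0 : 0 < l by rewrite divr_gt0 ?pi_gt0//; lra.
pose q1 := expR (- (l * y)); pose q2 := expR (- (l * B)).
have q12 : q2 < q1 by rewrite ltr_expR ltrN2 ltr_pM2l.
have q20 : 0 < q2 by exact: expR_gt0.
pose m := Num.min a (Num.min y (B - y)).
have m0 : 0 < m by rewrite !lt_min a0 y0 subr_gt0.
have [ma [my mB]] : m <= a /\ (m <= y /\ m <= B - y).
  by rewrite /m !ge_min !lexx !orbT.
pose M := 2 * a + B; have M0 : 0 < M by rewrite /M; lra.
have dp : deep (- a) a 0 B m 0 y by split; lra.
have m3 : 0 < m ^+ 3 by rewrite exprn_gt0.
have est (n : nat) : m ^+ 3 * (`|w (pt 0 y)| * expR (n%:R * q1)) <=
    M ^+ 2 * (4 * (C * expR (n%:R * q2)) * M).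
  pose W z := weight l n%:R z * w z.
  have hW : on_rect i (- a) a 0 B (hol W).
    move=> s t hs ht; have S := slice_slice_pt i s t.
    have [p hp] := hol_weight l n%:R S; have [q hq] := hw s t hs ht.
    by eexists; exact: (holo_mul hi S (slice_weight l n%:R _) hp hq).
  have aM : a - - a <= M by rewrite /M; lra.
  have BM : B - 0 <= M by rewrite /M; lra.
  have := cauchy_estimate hi aa B0 m0 aM BM dp hW.
  rewrite {1}/W Defs.normqM norm_weight mulr0 cos0 mulr1 -/q1 (mulrC (expR _)).
  move=> /le_trans; apply; rewrite ler_wpM2l ?exprn_ge0 ?(ltW M0)//.
  apply: bd_norm_le => //; [exact: on_rect_bdry| |by rewrite mulr_ge0// expR_ge0].
  move=> s t hs ht hb; rewrite /W Defs.normqM norm_weight.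
  have [t00|tn0] := eqVneq t 0.
    by rewrite t00 w0 ?ler_norml// normr0 mulr0 mulr_ge0// expR_ge0.
  rewrite mulrC ler_pM ?expR_ge0//; first exact: hC.
  rewrite ler_expR ler_wpM2l//.
  have side : (s == - a) || (s == a) -> expR (- (l * t)) * cos (l * s) <= q2.
    move=> hs'; have -> : cos (l * s) = 0.
      have e : l * a = pi / 2 by rewrite /l; field; rewrite gt_eqF.
      by case/orP: hs' => /eqP ->; rewrite ?mulrN ?cosN e cos_pihalf.
    by rewrite mulr0 ltW.
  case: hb => e; try (by apply: side; rewrite e eqxx ?orbT).
    by rewrite e eqxx in tn0.
  rewrite e -/q2 -[leRHS]mulr1 ler_wpM2l ?(ltW q20)// cos_le1//.
apply/eqP; rewrite -normr_le0 leNgt; apply/negP => wy.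
set K := M ^+ 2 * (4 * C * M) / (m ^+ 3 * `|w (pt 0 y)|).
have mw : 0 < m ^+ 3 * `|w (pt 0 y)| by rewrite mulr_gt0.
have dq : 0 < q1 - q2 by rewrite subr_gt0.
have hK (n : nat) : n%:R * (q1 - q2) <= K.
  have := est n; rewrite -[expR (n%:R * q1)](_ : expR (n%:R * (q1 - q2)) * expR (n%:R * q2) = _); last first.
    by rewrite -expRD; congr expR; ring.
  rewrite (_ : M ^+ 2 * _ = M ^+ 2 * (4 * C * M) * expR (n%:R * q2)); last by ring.
  rewrite (mulrA `|_|) mulrA ler_pM2r ?expR_gt0// mulrA mulrC -ler_pdivlMr// => h.
  apply: le_trans h.
  by rewrite (le_trans _ (expR_ge1Dx _))// lerDr.
have := archi_boundP (_ : 0 <= K / (q1 - q2)).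
have K0 : 0 <= K.
  by rewrite /K divr_ge0 ?(ltW mw)// !mulr_ge0 ?exprn_ge0 ?(ltW M0).
move=> /(_ (divr_ge0 K0 (ltW dq))); rewrite ltr_pdivrMr// => h.
by have := hK (Num.bound (K / (q1 - q2))); lra.
Qed.

Lemma hol_affine (w : H -> H) (z0 u z : H) : slice i z0 -> slice i u -> slice i z ->
  hol w (z0 + u * z) -> hol (fun z => w (z0 + u * z)) z.
Proof.
move=> S0 Su Sz [p hp].
have hq := holo_add (holo_cst i z0 z) (holo_mull hi Sz Su (holo_id i z)).
have Sf x : slice i x -> slice i (z0 + u * x).
  by move=> Sx; apply: sliceD => //; exact: sliceM.
by eexists; exact: (@holo_comp _ i (fun z => z0 + u * z) w z _ p Sf hq hp).
Qed.

(** Two applications of [rect_zero]: upwards from the real segment, which covers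
    the part over (0, 1), then sideways from a vertical segment of that part. *)
Lemma identity_upper (w : H -> H) :
  (forall z, slit_slice i z -> hol w z) ->
  (forall x : R, 0 < x < 1 -> w x%:A = 0) ->
  forall x y, 0 < y -> slit_slice i (pt x y) -> w (pt x y) = 0.
Proof.
move=> hw w0.
have right x y : 0 < x -> 0 < y -> x ^+ 2 + y ^+ 2 < 1 -> w (pt x y) = 0.
  move=> x0 y0 r1.
  have x1 : x < 1 by exact: lt1_of_sqrD r1.
  have y1 : y < 1 by apply: (@lt1_of_sqrD y x); rewrite addrC.
  pose e := Num.min (x / 2) ((1 - (x ^+ 2 + y ^+ 2)) / 8).
  have e0 : 0 < e by rewrite lt_min !divr_gt0// subr_gt0.
  have [ex er] : e <= x / 2 /\ e <= (1 - (x ^+ 2 + y ^+ 2)) / 8.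
    by rewrite !ge_min !lexx orbT.
  have shift s t : x%:A + 1 * pt s t = pt (x + s) t.
    by rewrite mul1r -(slice_pt0 i) slice_ptD add0r.
  have small : (x + e) ^+ 2 + (y + e) ^+ 2 < 1.
    have : e * e <= e * 1 by rewrite ler_wpM2l ?(ltW e0)//; have := sqr_ge0 y; have := sqr_ge0 x; lra.
    have : e * x <= e * 1 by rewrite ler_wpM2l ?(ltW e0)// ltW.
    have : e * y <= e * 1 by rewrite ler_wpM2l ?(ltW e0)// ltW.
    by rewrite !sqrrD !expr2; rewrite !expr2 in er; lra.
  have := @rect_zero (fun z => w (x%:A + 1 * z)) e (y + e) y e0.
  rewrite shift addr0; apply; first lra.
  - move=> s t hs ht; apply: hol_affine; try exact: slice_slice_pt.
    + exact: sliceA.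
    + exact: slice1.
    + rewrite shift; apply: hw; apply/(slit_slice_ptE hi); split; last by left; lra.
      apply: le_lt_trans small; apply: lerD; rewrite ler_sqr ?nnegrE; lra.
  - move=> s; rewrite ler_norml => hs; rewrite shift slice_pt0; apply: w0.
    apply/andP; split; first lra.
    rewrite ltNge; apply/negP => h1; have := ler_pM ler01 ler01 h1 h1.
    have : (x + s) * (x + s) <= (x + e) ^+ 2 by rewrite -expr2 ler_sqr ?nnegrE; lra.
    by have := sqr_ge0 (y + e); lra.
move=> x y y0 hxy; have := hxy => /(slit_slice_ptE hi)[r1 _].
have [x0|x0] := ltP 0 x; first exact: right.
have y1 : y < 1 by apply: (@lt1_of_sqrD y x); rewrite addrC.
have x1 : - x < 1 by apply: (@lt1_of_sqrD (- x) y); rewrite sqrrN.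
pose e := Num.min (y / 2) ((1 - (x ^+ 2 + y ^+ 2)) / 8).
have e0 : 0 < e by rewrite lt_min !divr_gt0// subr_gt0.
have [ey er] : e <= y / 2 /\ e <= (1 - (x ^+ 2 + y ^+ 2)) / 8.
  by rewrite !ge_min !lexx orbT.
have shift s t : pt e y + i * pt s t = pt (e - t) (y + s).
  have -> : i * pt s t = pt (- t) s.
    have {1}-> : i = pt 0 1 by rewrite /slice_pt scale0r scale1r add0r.
    by rewrite slice_ptM//; congr pt; ring.
  by rewrite slice_ptD.
have small : (x - e) ^+ 2 + (y + e) ^+ 2 < 1.
  have : e * e <= e * 1 by rewrite ler_wpM2l ?(ltW e0)//; have := sqr_ge0 y; have := sqr_ge0 x; lra.
  have : e * - x <= e * 1 by rewrite ler_wpM2l ?(ltW e0)// ltW.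
  have : e * y <= e * 1 by rewrite ler_wpM2l ?(ltW e0)// ltW.
  by rewrite !sqrrD !expr2; rewrite !expr2 in er; lra.
have sq (u v : R) : x - e <= u <= e -> y - e <= v <= y + e -> u ^+ 2 + v ^+ 2 < 1.
  move=> hu hv; apply: le_lt_trans small; apply: lerD; last by rewrite ler_sqr ?nnegrE; lra.
  rewrite -subr_ge0 subr_sqr mulr_le0//; lra.
have := @rect_zero (fun z => w (pt e y + i * z)) e (e - x + e) (e - x) e0.
rewrite shift addr0 subKr; apply; first lra.
- move=> s t hs ht; apply: hol_affine; try exact: slice_slice_pt.
  + exact: slicei.
  + rewrite shift; apply: hw; apply/(slit_slice_ptE hi); split.
      by apply: sq; lra.
    by right; rewrite gt_eqF//; lra.
- move=> s; rewrite ler_norml => hs; rewrite shift subr0; apply: right => //; first lra.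
  by apply: sq; lra.
Qed.

End OneSlice.

Lemma sliceN_iff (i z : H) : slice (- i) z <-> slice i z.
Proof.
split=> -[x [y ->]]; exists x, (- y); rewrite slice_ptN ?opprK//.
Qed.

(** The lower half of the plane of [i] is the upper half of the plane of [- i]. *)
Lemma identity_slice (i : H) (hi : imag_sphere i) (w : H -> H) :
  (forall z, slit_slice i z -> holomorphic_at i w z) ->
  (forall x : R, 0 < x < 1 -> w x%:A = 0) ->
  forall z, slit_slice i z -> w z = 0.
Proof.
move=> hw w0 z hz; have [Bz [x [y zE]]] := hz; rewrite zE in hz *.
have [y0|y0|y0] := ltgtP y 0.
- have -> : slice_pt i x y = slice_pt (- i) x (- y) by rewrite slice_ptN opprK.
  apply: (identity_upper (sphereN hi)) => //; last 2 first.
  + lra.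
  + by rewrite slice_ptN opprK; case: hz => ? ?; split=> //; exact/sliceN_iff.
  + move=> z' [Bz' /sliceN_iff Sz']; have [p hp] := hw z' (conj Bz' Sz').
    exists p => e e0; have [d d0 hd] := hp e e0; exists d => // v /sliceN_iff; exact: hd.
- exact: (identity_upper hi).
- have := hz; rewrite y0 => /(slit_slice_ptE hi)[h1 [x0|]]; last by rewrite eqxx.
  rewrite slice_pt0; apply: w0; rewrite x0/=.
  by move: h1; rewrite expr0n addr0 expr_lt1// ltW.
Qed.

(** All slices share the segment (0, 1), from which the vanishing on one slice
    spreads to the others. *)
Lemma slice_regular_eq0 (i : H) (hi : imag_sphere i) (f : slit_fun R) :
  slice_regular f -> (forall z, slit_slice i z -> slit_ext f z = 0) -> f = 0.
Proof.
move=> rf f0; apply: slit_fun_eq0 => q hq.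
have hI := qaxis_sphere q.
apply: (identity_slice hI (w := slit_ext f)).
- by move=> z hz; exact: slice_regular_holo.
- move=> x /andP[x0 x1]; apply: f0; rewrite -(slice_pt0 i); apply/(slit_slice_ptE hi).
  by split; [rewrite expr0n addr0 expr_lt1// ltW|left].
- by split=> //; exists (qre q), `|qim q|; exact: qaxisE.
Qed.

End Identity.

(** * Energy and integrating factor *)

Lemma factor_close (R : realType) (m m' h h' : quat R) (e : R) : 0 < e -> 0 < `|m| ->
  `|m' - m| < `|m| / 2 -> `|m' - m| * (`|h| + 1) < e * `|m| / 4 ->
  `|m' * h' - m * h| < e * `|m| / 4 -> `|h' - h| < e.
Proof.
move=> e0 m0 mm mh hh; have nh := normr_ge0 h.
have hb : `|m' * (h' - h)| <= `|m' * h' - m * h| + `|m' - m| * `|h|.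
  rewrite -Defs.normqM (_ : m' * (h' - h) = (m' * h' - m * h) - (m' - m) * h) ?ler_normB//.
  by rewrite mulrBr mulrBl opprB addrA subrK.
have := ler_normB m' (m' - m); rewrite subKr => hm.
have hp : `|m' - m| * `|h| <= `|m' - m| * (`|h| + 1) by rewrite ler_wpM2l// lerDl.
rewrite Defs.normqM in hb; have m2 : 0 < `|m| / 2 by rewrite divr_gt0.
have : `|m| / 2 * `|h' - h| <= `|m'| * `|h' - h| by rewrite ler_wpM2r//; lra.
rewrite -(ltr_pM2l m2); move: (`|m' - m| * _) (`|m' - m| * _) (`|m'| * _) (`|m| / 2 * `|h' - h|) hb hp mh.
by move=> a b c d hb hp mh hd; lra.
Qed.

Section SliceRegularModule.
Variable R : realType.
Local Notation H := (quat R).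

Lemma holo_unique (i : H) (hi : imag_sphere i) (f : H -> H) z p q : slice i z ->
  holo i f z p -> holo i f z q -> p = q.
Proof.
move=> Sz hp hq; apply/eqP; rewrite -subr_eq0 -normr_le0.
suff h (e : R) : 0 < e -> `|p - q| <= e by apply/ler_addgt0Pr => e e0; rewrite add0r h.
move=> e0; have e2 : 0 < e / 2 by rewrite divr_gt0.
have [d d0 hd] := dquot_lim Sz hp e2; have [d' d0' hd'] := dquot_lim Sz hq e2.
have m0 : 0 < Num.min d d' by rewrite lt_min d0.
pose t := Num.min d d' / 2; have t0 : 0 < t by rewrite divr_gt0.
have : t < Num.min d d' by rewrite ltr_pdivrMr// ltr_pMr// ltr1n.
rewrite lt_min => /andP[t1 t2].
have := hd t; have := hd' t; rewrite t0 t1 t2 => /(_ isT) h1 /(_ isT) h2.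
have := ler_normB (dquot t f z - q) (dquot t f z - p).
rewrite (_ : _ - _ - _ = p - q); last by apply: quatP => /=; ring.
by lra.
Qed.

(** Converse of [slice_regular_holo]: on the lines of a slice the expansion of the
    complex derivative [p] gives the partial derivatives [p] and [i p]. *)
Lemma holo_slice_regular (f : slit_fun R) :
  (forall q, slit_ball q -> differentiable (slit_ext f) q) ->
  (forall i, imag_sphere i -> forall z, slit_slice i z ->
     holomorphic_at i (slit_ext f) z) -> slice_regular f.
Proof.
move=> df hf; split=> // i hi x y hB.
have S := slice_slice_pt i x y.
have [p hp] := hf i hi _ (conj hB S).
set F := slit_ext f in hp *.
have approx u : slice i u -> forall s e, 0 < e -> exists2 d, 0 < d &
    forall s' : R, `|(s' - s) *: u| < d ->
     `|F (slice_pt i x y + (s' - s) *: u) - F (slice_pt i x y) - (s' - s) *: (u * p)|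
       <= e * `|(s' - s) *: u|.
  move=> Su s e e0; have [d d0 hd] := hp e e0; exists d => // s' hs.
  have S' : slice i (slice_pt i x y + (s' - s) *: u) by apply: sliceD => //; exact: sliceZ.
  have := hd _ S'; rewrite (addrC (slice_pt i x y)) addrK => /(_ hs).
  by rewrite -scalerAl.
rewrite (@line_derivative _ F (slice_pt i x y) 1 (1 * p) _ _ _ (approx _ (slice1 i) x)); last first.
  by move=> s; rewrite /slice_pt addrAC -scalerDl (addrC x) subrK.
rewrite (@line_derivative _ F (slice_pt i x y) i (i * p) _ _ _ (approx _ (slicei i) y)); last first.
  by move=> s; rewrite /slice_pt -addrA -scalerDl (addrC y) subrK.
by rewrite mul1r mulrA (sphere_sqr hi) mulN1r subrr.
Qed.

Lemma slice_regular0 : slice_regular (0 : slit_fun R).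
Proof.
have e : slit_ext (0 : slit_fun R) = fun=> 0 by apply/funext => q; exact: slit_ext0.
apply: holo_slice_regular; rewrite e.
  by move=> q _; exact: differentiable_cst.
by move=> i hi z _; exists 0; exact: holo_cst.
Qed.

Lemma slice_regularD (f g : slit_fun R) :
  slice_regular f -> slice_regular g -> slice_regular (f + g).
Proof.
move=> rf rg.
have e : slit_ext (f + g) = (slit_ext f \+ slit_ext g).
  by apply/funext => q; exact: slit_extD.
apply: holo_slice_regular; rewrite e.
  by move=> q hq; apply: differentiableD; [case: rf => h _|case: rg => h _]; exact: h.
move=> i hi z hz; have [p hp] := slice_regular_holo hi rf hz.
have [q hq] := slice_regular_holo hi rg hz.
by exists (p + q); exact: holo_add.
Qed.

Lemma slice_regularZ (a : (quat R)^c) (f : slit_fun R) :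
  slice_regular f -> slice_regular (a *: f).
Proof.
move=> rf; pose g (x : H) := x * (a : H).
have e : slit_ext (a *: f) = g \o slit_ext f.
  by apply/funext => q; exact: slit_extZ.
apply: holo_slice_regular; rewrite e.
  move=> q hq; apply: differentiable_comp; first by case: rf => h _; exact: h.
  apply: (@differentiable_diff_within _ g _ g).
  - by move=> b u v; rewrite /g mulrDl -scalerAl.
  - exact: bdd_holo.
  - move=> e' e0; exists 1 => // w _ _; rewrite /g mulrBl subrr normr0.
    by rewrite mulr_ge0// ltW.
move=> i hi z hz; have [p hp] := slice_regular_holo hi rf hz.
by exists (p * (a : H)); exact: holo_mulr.
Qed.

Lemma slice_regularB (f g : slit_fun R) :
  slice_regular f -> slice_regular g -> slice_regular (f - g).
Proof.
move=> rf rg; rewrite -[- g]scaleN1r.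
by apply: slice_regularD => //; exact: slice_regularZ.
Qed.

End SliceRegularModule.

Section DirichletSpace.
Variable R : realType.
Local Notation H := (quat R).
Local Notation mu2 := (@lebesgue_measure R \x @lebesgue_measure R)%E.
Variables (alpha sigma : R) (k : nat) (i : H).
Hypotheses (halpha : 0 < alpha) (hsigma : 0 < sigma < 1) (hk : (1 <= k)%N)
  (hek : forall q : H, slit_ball q -> exp_trunc k.-1 (qpowR q alpha) != 0)
  (hi : imag_sphere i).
Local Notation pt := (slice_pt i).
Local Notation hol := (holomorphic_at i).
Local Notation fd := (frac_deriv sigma alpha k i).
Local Notation dg := (dgE i alpha k).
Implicit Types (f g : slit_fun R).

Lemma fd_holo f z : slice_regular f -> slit_slice i z -> exists2 p,
  holo i (slit_ext f) z p &
  fd f z = (1 - sigma) *: slit_ext f z + sigma *: ((dg z)^-1 * p).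
Proof.
move=> rf hz; have [p hp] := slice_regular_holo hi rf hz.
by exists p => //; exact: frac_derivE.
Qed.

Lemma fdD f g z : slice_regular f -> slice_regular g -> slit_slice i z ->
  fd (f + g) z = fd f z + fd g z.
Proof.
move=> rf rg hz; have [p hp ->] := fd_holo rf hz; have [q hq ->] := fd_holo rg hz.
have [s hs ->] := fd_holo (slice_regularD rf rg) hz.
have e : slit_ext (f + g) = fun q => slit_ext f q + slit_ext g q.
  by apply/funext => x; exact: slit_extD.
have -> : s = p + q.
  rewrite e in hs; apply: (holo_unique hi _ hs (holo_add hp hq)).
  by case: hz.
by rewrite slit_extD mulrDr !scalerDr addrACA.
Qed.

Lemma fdZ (a : (quat R)^c) f z : slice_regular f -> slit_slice i z ->
  fd (a *: f) z = fd f z * (a : H).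
Proof.
move=> rf hz; have [p hp ->] := fd_holo rf hz.
have [s hs ->] := fd_holo (slice_regularZ a rf) hz.
have e : slit_ext (a *: f) = fun q => slit_ext f q * (a : H).
  by apply/funext => x; exact: slit_extZ.
have -> : s = p * (a : H).
  rewrite e in hs; apply: (holo_unique hi _ hs (holo_mulr (a : H) hp)).
  by case: hz.
by rewrite slit_extZ mulrA mulrDl -!scalerAl.
Qed.

Lemma fdB f g z : slice_regular f -> slice_regular g -> slit_slice i z ->
  fd (f - g) z = fd f z - fd g z.
Proof.
move=> rf rg hz; rewrite -[- g]scaleN1r fdD//; last exact: slice_regularZ.
by rewrite fdZ// mulrN1.
Qed.

(** Solving the equation [(1 - sigma) F + sigma F' / g' = h] amounts to
    [(E F)' = mfac h] with the integrating factor [E = exp ((1 - sigma) / sigma g)]. *)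
Definition intfac (z : H) : H := cexp i (((1 - sigma) / sigma)%:A * gpow i alpha k z).
Definition mfac (z : H) : H := (sigma^-1)%:A * dg z * intfac z.

Lemma slice_intfac z : slice i (intfac z). Proof. exact: slice_cexp. Qed.

Lemma intfac_neq0 z : intfac z != 0. Proof. exact: cexp_neq0. Qed.

Lemma mfac_neq0 z : slit_slice i z -> mfac z != 0.
Proof.
move=> hz; have /andP[s0 s1] := hsigma.
rewrite /mfac mulq_eq0 negb_or intfac_neq0 andbT mulq_eq0 negb_or.
rewrite (dgE_neq0 hi halpha hek hz) andbT.
by rewrite scaler_eq0 negb_or oner_eq0 invr_eq0 gt_eqF.
Qed.

Lemma holo_intfac z : slit_slice i z ->
  holo i intfac z (((1 - sigma) / sigma)%:A * dg z * intfac z).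
Proof.
move=> hz; have [_ Sz] := hz; set c := (1 - sigma) / sigma.
have Sg w : slice i (c%:A * gpow i alpha k w).
  by apply: sliceM => //; [exact: sliceA|exact: slice_gpow].
have h1 := holo_mull hi Sz (sliceA i c) (holo_gpow hi alpha hk (slit_slice_off_cut hi hz)).
exact: (@holo_comp _ i (fun w => c%:A * gpow i alpha k w) (cexp i) z _ _
  (fun w _ => Sg w) h1 (holo_cexp hi (Sg z))).
Qed.

Lemma hol_mfac z : slit_slice i z -> hol mfac z.
Proof.
move=> hz; have [_ Sz] := hz.
have [p hp] := hol_dgE hi alpha hk hz.
have h1 := holo_mull hi Sz (sliceA i sigma^-1) hp.
have Ss : slice i ((sigma^-1)%:A * dg z).
  by apply: sliceM => //; [exact: sliceA|exact: slice_dgE].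
by eexists; exact: (holo_mul hi Sz Ss h1 (holo_intfac hz)).
Qed.

Definition wfun f (z : H) : H := intfac z * slit_ext f z.

Lemma holo_wfun f z : slice_regular f -> slit_slice i z ->
  holo i (wfun f) z (mfac z * fd f z).
Proof.
move=> rf hz; have [_ Sz] := hz; have [p hp ->] := fd_holo rf hz.
have /andP[s0 s1] := hsigma.
have := holo_mul hi Sz (slice_intfac z) (holo_intfac hz) hp.
set F := slit_ext f z; set E := intfac z.
have SE : slice i E := slice_intfac z.
have Sd : slice i (dg z) by exact: slice_dgE.
have d0 : dg z != 0 by exact: dgE_neq0.
rewrite /mfac -/E [_ * E * (_ + _)]mulrDr.
have -> : (sigma^-1)%:A * dg z * E * ((1 - sigma) *: F) =
    ((1 - sigma) / sigma)%:A * dg z * E * F.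
  by rewrite -scalerAr -!scaleqE -!scalerAl scalerA.
have -> : (sigma^-1)%:A * dg z * E * (sigma *: ((dg z)^-1 * p)) = E * p.
  have : dg z * ((dg z)^-1 * p) = p by rewrite mulVKr ?unitqE.
  move: ((dg z)^-1 * p) => q hq.
  rewrite -scalerAr -!scaleqE -!scalerAl scalerA divff ?gt_eqF// scale1r.
  by rewrite (slice_comm hi Sd SE) -mulrA hq.
by [].
Qed.

Definition plane : set (R * R) := [set p | slit_slice i (pt p.1 p.2)].

Definition energy f : \bar R := (\int[mu2]_(p in plane) (`|fd f (pt p.1 p.2)| ^+ 2)%:E)%E.

Lemma sqnormE f : dirichlet_sqnorm sigma alpha k i f =
  ((alpha * `|slit_ext f (2^-1)%:A| ^+ 2)%:E + energy f)%E.
Proof. by []. Qed.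

Lemma measurable_plane : measurable plane.
Proof.
have cr (f : R * R -> R) (C : R) : (forall p q, `|f q - f p| <= C * (`|q.1 - p.1| + `|q.2 - p.2|)) ->
    0 < C -> measurable_fun setT f.
  move=> hf C0; apply: cont_rel_measurable => // p _ e e0; exists (e / C / 2).
    by rewrite !divr_gt0.
  move=> q _ h1 h2; apply: (le_lt_trans (hf p q)).
  rewrite mulrC -ltr_pdivlMr//; lra.
have m1 : measurable_fun setT (fun p : R * R => p.1).
  by apply: (cr _ 1) => // p q; rewrite mul1r lerDl.
have m2 : measurable_fun setT (fun p : R * R => p.2).
  by apply: (cr _ 1) => // p q; rewrite mul1r lerDr.
have -> : plane = ((fun p => p.1 ^+ 2 + p.2 ^+ 2) @^-1` `]-oo, 1[%classic) `&`
    (((fun p => p.1) @^-1` `]0, +oo[%classic) `|` ((fun p => p.2) @^-1` (~` [set 0]))).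
  apply/seteqP; split=> -[x y] /=; rewrite !in_itv/= ?andbT.
    move=> /(slit_slice_ptE hi)[h1 [h2|/eqP h2]]; split=> //; [by left|by right].
  move=> [h1 h2]; apply/(slit_slice_ptE hi); split=> //.
  by case: h2 => h2; [left|right; apply/eqP].
apply: measurableI.
  rewrite -[X in measurable X]setTI.
  by apply: (measurable_funD (measurable_funX 2 m1) (measurable_funX 2 m2)) => //.
apply: measurableU.
  by rewrite -[X in measurable X]setTI; apply: m1.
by rewrite -[X in measurable X]setTI; apply: m2 => //; apply: measurableC.
Qed.

Lemma square_in z : slit_slice i z -> exists2 r, 0 < r & forall x y,
  `|x - qre z| <= r -> `|y - imc i z| <= r -> slit_slice i (pt x y).
Proof.
move=> hz; have [r r0 hr] := slit_slice_open hz; exists (r / 3); first by rewrite divr_gt0.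
move=> x y hx hy; apply: hr; first exact: slice_slice_pt.
have [_ Sz] := hz; rewrite [in X in _ - X](slice_ptE hi Sz) slice_ptB.
have := norm_slice_pt_le hi (x - qre z) (y - imc i z); lra.
Qed.

(** The product [mfac * fd f] is a derivative, hence continuous by
    [derivative_lipschitz], and [mfac] does not vanish. *)
Lemma fd_cont f : slice_regular f -> forall z, slit_slice i z -> forall e, 0 < e ->
  exists2 d, 0 < d & forall w, slice i w -> `|w - z| < d -> `|fd f w - fd f z| < e.
Proof.
move=> rf z hz e e0; have [_ Sz] := hz.
have [r r0 hr] := square_in hz.
have r8 : 0 < r / 8 by rewrite divr_gt0.
have [L L0 [lip _]] := @derivative_lipschitz _ i hi (wfun f) (fun z => mfac z * fd f z)
  (qre z) (qre z) (imc i z) (imc i z) (r / 8) (lexx _) (lexx _) r8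
  ltac:(move=> x y hx hy; apply: holo_wfun => //; apply: hr; rewrite ler_norml; lra).
have m0 := mfac_neq0 hz.
have nm : 0 < `|mfac z| by rewrite normr_gt0.
case: (hol_mfac hz) => p hp; set h := fd f z.
have n1 : 0 < `|h| + 1 by rewrite ltr_wpDl.
have e4 : 0 < e * `|mfac z| / 4 by rewrite divr_gt0// mulr_gt0.
have e5 : 0 < Num.min (`|mfac z| / 2) (e * `|mfac z| / 4 / (`|h| + 1)).
  by rewrite lt_min !divr_gt0 ?mulr_gt0.
have [d d0 hd] := diff_within_cont (bdd_holo p) hp e5.
exists (Num.min (Num.min d (r / 8)) (e * `|mfac z| / 4 / (L + 1))).
  by rewrite !lt_min d0 r8 divr_gt0// ltr_wpDl.
move=> w Sw; rewrite !lt_min => /andP[/andP[wd wr] we].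
have := hd w Sw wd; rewrite lt_min (ltr_pdivlMr _ _ n1) => /andP[g1 g2].
have [k1 k2] := cont_imc hi Sz Sw.
have l1 := ltW (le_lt_trans k1 wr); have l2 := ltW (le_lt_trans k2 wr).
have bx (x : R) : `|x - x| <= r / 8 by rewrite subrr normr0 ltW.
have := lip (qre w) (imc i w) (qre z) (imc i z).
rewrite -!ler_distl => /(_ l1 l2 (bx _) (bx _)).
rewrite -(slice_ptE hi Sw) -(slice_ptE hi Sz) => g3.
apply: (factor_close e0 nm g1 g2); apply: (le_lt_trans g3).
rewrite ltr_pdivlMr ?ltr_wpDl// in we; apply: le_lt_trans we.
by rewrite mulrC ler_wpM2l// lerDl.
Qed.

Definition cont_slice (g : H -> H) := forall z, slit_slice i z -> forall e, 0 < e ->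
  exists2 d, 0 < d & forall w, slice i w -> `|w - z| < d -> `|g w - g z| < e.

Lemma sqr_cont_rel (g : H -> H) : cont_slice g ->
  cont_rel plane (fun p => `|g (pt p.1 p.2)| ^+ 2).
Proof.
move=> cg p hp e e0; set M := `|g (pt p.1 p.2)|; have M0 : 0 <= M by exact: normr_ge0.
have e1 : 0 < Num.min 1 (e / (2 * M + 1)) by rewrite lt_min ltr01 divr_gt0//; lra.
have [d d0 hd] := cg _ hp _ e1; exists (d / 2); first by rewrite divr_gt0.
move=> q hq h1 h2.
have h3 : `|pt q.1 q.2 - pt p.1 p.2| < d.
  by rewrite slice_ptB (le_lt_trans (norm_slice_pt_le hi _ _))//; lra.
have := hd _ (slice_slice_pt i _ _) h3; rewrite lt_min ltr_pdivlMr; last lra.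
move=> /andP[h4 h5]; rewrite subr_sqr normrM (le_lt_trans _ h5)//.
have h6 := ler_dist_dist (g (pt q.1 q.2)) (g (pt p.1 p.2)).
apply: ler_pM => //; rewrite -/M in h6 *.
by rewrite ger0_norm ?addr_ge0//; move: h6; rewrite ler_norml; lra.
Qed.

Lemma cont_slice_mul (g h : H -> H) : cont_slice g -> cont_slice h ->
  cont_slice (fun z => g z * h z).
Proof.
move=> cg ch z hz e e0.
have a0 : 0 < `|g z| + 1 by rewrite ltr_wpDl.
have b0 : 0 < `|h z| + 1 by rewrite ltr_wpDl.
have e1 : 0 < Num.min 1 (e / 2 / (`|h z| + 1)) by rewrite lt_min ltr01 !divr_gt0.
have e2 : 0 < e / 2 / (`|g z| + 1) by rewrite !divr_gt0.
have [d d0 hd] := cg z hz _ e1; have [d' d0' hd'] := ch z hz _ e2.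
exists (Num.min d d'); first by rewrite lt_min d0.
move=> w Sw; rewrite lt_min => /andP[wd wd'].
have := hd w Sw wd; have := hd' w Sw wd'; rewrite lt_min.
rewrite (ltr_pdivlMr _ _ a0) (ltr_pdivlMr _ _ b0) => k1 /andP[k2 k3].
have -> : g w * h w - g z * h z = (g w - g z) * h z + g w * (h w - h z).
  by rewrite mulrBl mulrBr [RHS]addrC addrA subrK.
rewrite (le_lt_trans (ler_normD _ _))// !Defs.normqM.
have j1 : `|g w - g z| * `|h z| <= `|g w - g z| * (`|h z| + 1).
  by rewrite ler_wpM2l// lerDl.
have gw : `|g w| <= `|g z| + 1.
  by have := ler_normD (g w - g z) (g z); rewrite subrK; lra.
have j2 : `|g w| * `|h w - h z| <= (`|g z| + 1) * `|h w - h z| by rewrite ler_wpM2r.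
rewrite mulrC in k1; lra.
Qed.

Lemma cont_slice_mfac : cont_slice mfac.
Proof.
by move=> z /hol_mfac[p hp]; exact: diff_within_cont (bdd_holo p) hp.
Qed.

Lemma measurable_sqr_fd f : slice_regular f ->
  measurable_fun plane (fun p => (`|fd f (pt p.1 p.2)| ^+ 2)%:E).
Proof.
move=> rf; apply: cont_rel_emeasurable measurable_plane _.
exact: (sqr_cont_rel (fd_cont rf)).
Qed.

End DirichletSpace.

(** * Pointwise bounds by the energy *)

Section EnergyBound.
Variables (R : realType) (alpha sigma : R) (k : nat) (i : quat R).
Hypotheses (halpha : 0 < alpha) (hsigma : 0 < sigma < 1) (hk : (0 < k)%N)
  (hek : forall q : quat R, slit_ball q -> exp_trunc k.-1 (qpowR q alpha) != 0)
  (hi : imag_sphere i).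
Local Notation H := (quat R).
Local Notation pt := (slice_pt i).
Local Notation mu2 := (@lebesgue_measure R \x @lebesgue_measure R)%E.
Local Notation fd := (frac_deriv sigma alpha k i).
Local Notation mfac := (mfac alpha sigma k i).
Local Notation wfun := (wfun alpha sigma k i).
Local Notation energy := (energy alpha sigma k i).
Local Notation plane := (plane i).
Implicit Types (f g : slit_fun R).

(** Near [z0] the factor [mfac] is bounded, so that the energy controls the mean
    square of the derivative of [wfun f]; Bergman's inequality turns this into a
    pointwise bound. *)
Lemma energy_bound z0 : slit_slice i z0 -> exists2 r, 0 < r & exists2 C, 0 < C &
  forall w, slice i w -> `|w - z0| < r -> slit_slice i w /\
    forall f E, slice_regular f -> 0 < E -> (energy f <= (E ^+ 2)%:E)%E ->
      `|mfac w * fd f w| <= C * E.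
Proof.
move=> hz; have [_ Sz] := hz; have [r0 r00 hr0] := square_in hi hz.
set x0 := qre z0 in hr0 *; set y0 := imc i z0 in hr0 *.
have m0 : 0 < `|mfac z0| by rewrite normr_gt0 (mfac_neq0 halpha hsigma hek hi hz).
have [d d0 hd] := cont_slice_mfac alpha sigma hk hi hz m0.
(* the square of half-side [6 rho] lies in the slit slice, and on that of
   half-side [4 rho] the factor [mfac] is at most twice its value at [z0] *)
have [rho [rho0 rr rd]] : exists rho : R, [/\ 0 < rho, rho <= r0 / 6 & rho <= d / 16].
  exists (Num.min (r0 / 6) (d / 16)).
  by split; rewrite ?lt_min ?divr_gt0// !ge_min !lexx ?orbT.
have sq6 (x y : R) : `|x - x0| <= 6 * rho -> `|y - y0| <= 6 * rho -> slit_slice i (pt x y).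
  by move=> hx hy; apply: hr0; lra.
exists rho => //; exists (200 * (2 * `|mfac z0|) / rho).
  apply: divr_gt0 => //; apply: mulr_gt0; first by rewrite ltr0n.
  by apply: mulr_gt0.
move=> w Sw wr; have [k1 k2] := cont_imc hi Sz Sw.
have hw : slit_slice i w.
  by rewrite (slice_ptE hi Sw); apply: sq6; rewrite -/x0 -/y0 in k1 k2 *; lra.
split=> // f E rf E0 hE.
pose E' := 2 * `|mfac z0| * E; have E'0 : 0 < E' by rewrite !mulr_gt0.
have sqp : square x0 y0 (4 * rho) `<=` plane.
  move=> [x y] [/=]; rewrite !in_itv/= ; rewrite -!ler_distl => h1 h2.
  have r46 : 4 * rho <= 6 * rho by rewrite ler_pM2r// ler_nat.
  by apply: sq6; [apply: le_trans h1 r46 | apply: le_trans h2 r46].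
have mS : measurable (square x0 y0 (4 * rho) : set (R * R)).
  by apply: measurableX; exact: measurable_itv.
have msq (g : H -> H) : cont_slice i g ->
    measurable_fun (square x0 y0 (4 * rho)) (fun p => (`|g (pt p.1 p.2)| ^+ 2)%:E).
  by move=> cg; apply: cont_rel_emeasurable mS _; exact: cont_relS sqp (sqr_cont_rel hi cg).
have hint : (\int[mu2]_(p in square x0 y0 (4 * rho))
    (`|mfac (pt p.1 p.2) * fd f (pt p.1 p.2)| ^+ 2)%:E <= (E' ^+ 2)%:E)%E.
  apply: (@le_trans _ _ (\int[mu2]_(p in square x0 y0 (4 * rho))
    (((2 * `|mfac z0|) ^+ 2)%:E * (`|fd f (pt p.1 p.2)| ^+ 2)%:E))%E).
    apply: ge0_le_integral => //.
    - apply: (msq (fun z => mfac z * fd f z)).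
      exact: cont_slice_mul (cont_slice_mfac alpha sigma hk hi) (fd_cont halpha hsigma hk hek hi rf).
    - by apply: measurable_funeM; exact: msq (fd_cont halpha hsigma hk hek hi rf).
    - move=> [x y] /=; rewrite /square /= => -[/=]; rewrite !in_itv/= -!ler_distl => h1 h2.
      rewrite -EFinM lee_fin Defs.normqM exprMn ler_wpM2r ?sqr_ge0//.
      rewrite ler_sqr ?nnegrE ?mulr_ge0//.
      have hxy : `|pt x y - z0| < d.
        rewrite [in X in _ - X](slice_ptE hi Sz) -/x0 -/y0 slice_ptB.
        by have := norm_slice_pt_le hi (x - x0) (y - y0); lra.
      have h := hd _ (slice_slice_pt i x y) hxy.
      rewrite mulr_natl mulr2n (le_trans _ (lerD (ltW h) (lexx _)))//.
      by have := ler_normD (mfac (pt x y) - mfac z0) (mfac z0); rewrite subrK.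
  apply: (@le_trans _ _ (((2 * `|mfac z0|) ^+ 2)%:E *
    \int[mu2]_(p in square x0 y0 (4 * rho)) (`|fd f (pt p.1 p.2)| ^+ 2)%:E)%E).
    rewrite le_eqVlt; apply/orP; left; apply/eqP.
    apply: (ge0_integralZl mu2 mS (msq _ (fd_cont halpha hsigma hk hek hi rf))).
      by move=> p _; rewrite lee_fin sqr_ge0.
    by rewrite lee_fin sqr_ge0.
  have -> : E' ^+ 2 = (2 * `|mfac z0|) ^+ 2 * E ^+ 2 by exact: exprMn.
  rewrite (EFinM (_ ^+ 2)); apply: lee_wpmul2l; first by rewrite lee_fin sqr_ge0.
  apply: le_trans hE.
  apply: (ge0_subset_integral mu2 mS (measurable_plane hi)
    (measurable_sqr_fd halpha hsigma hk hek hi rf) _ sqp).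
  by move=> p _; rewrite lee_fin sqr_ge0.
have := @bergman R i hi (wfun f) (fun z => mfac z * fd f z) x0 y0 rho E' rho0 E'0
  (fun x y hx hy => holo_wfun halpha hsigma hk hek hi rf (sq6 x y hx hy)) hint (qre w) (imc i w).
rewrite -/x0 -/y0 in k1 k2.
move=> /(_ (le_trans k1 (ltW wr)) (le_trans k2 (ltW wr))).
rewrite -(slice_ptE hi Sw) => /le_trans; apply.
by rewrite /E' le_eqVlt; apply/orP; left; apply/eqP; field; rewrite gt_eqF.
Qed.

End EnergyBound.

(** * Algebraic properties of the norm *)

Section DirichletNorm.
Variables (R : realType) (alpha sigma : R) (k : nat) (i : quat R).
Hypotheses (halpha : 0 < alpha) (hsigma : 0 < sigma < 1) (hk : (0 < k)%N)
  (hek : forall q : quat R, slit_ball q -> exp_trunc k.-1 (qpowR q alpha) != 0)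
  (hi : imag_sphere i).
Local Notation H := (quat R).
Local Notation pt := (slice_pt i).
Local Notation mu2 := (@lebesgue_measure R \x @lebesgue_measure R)%E.
Local Notation fd := (frac_deriv sigma alpha k i).
Local Notation energy := (energy alpha sigma k i).
Local Notation plane := (plane i).
Implicit Types (f g : slit_fun R).

(** With a free parameter [l] the triangle inequality becomes additive in the
    squares and can be integrated; [le_add_of_sqr] recovers it for the norms
    without a Cauchy-Schwarz inequality for integrals. *)
Lemma sqr_normD_le (u v : H) (l : R) : 0 < l ->
  `|u + v| ^+ 2 <= (1 + l) * `|u| ^+ 2 + (1 + l^-1) * `|v| ^+ 2.
Proof.
move=> l0; have h : `|u + v| ^+ 2 <= (`|u| + `|v|) ^+ 2.
  by rewrite ler_sqr ?nnegrE ?addr_ge0// ler_normD.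
apply: (le_trans h); rewrite -subr_ge0.
rewrite (_ : _ - _ = (l * `|u| - `|v|) ^+ 2 / l); last by field; rewrite gt_eqF.
by rewrite divr_ge0 ?sqr_ge0 ?ltW.
Qed.

Lemma le_add_of_sqr (X a b : R) : 0 <= a -> 0 <= b ->
  (forall l, 0 < l -> X ^+ 2 <= (1 + l) * a ^+ 2 + (1 + l^-1) * b ^+ 2) -> X <= a + b.
Proof.
move=> a0 b0 h; apply/ler_addgt0Pr => e e0.
have a1 : 0 < a + e / 2 by rewrite ltr_wpDl// divr_gt0.
have b1 : 0 < b + e / 2 by rewrite ltr_wpDl// divr_gt0.
have ha : a ^+ 2 <= (a + e / 2) ^+ 2 by rewrite ler_sqr ?nnegrE ?(ltW a1)// lerDl ltW// divr_gt0.
have hb : b ^+ 2 <= (b + e / 2) ^+ 2 by rewrite ler_sqr ?nnegrE ?(ltW b1)// lerDl ltW// divr_gt0.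
have l0 : 0 < (b + e / 2) / (a + e / 2) by rewrite divr_gt0.
have ab : 0 < a + b + e by rewrite ltr_wpDl// addr_ge0.
have [X0|X0] := leP X 0; first exact: le_trans X0 (ltW ab).
rewrite -(@ler_pXn2r _ 2%N) ?nnegrE ?(ltW ab) ?(ltW X0)//.
apply: (le_trans (h _ l0)).
apply: (@le_trans _ _ ((1 + (b + e / 2) / (a + e / 2)) * (a + e / 2) ^+ 2 +
  (1 + ((b + e / 2) / (a + e / 2))^-1) * (b + e / 2) ^+ 2)).
  by apply: lerD; apply: ler_wpM2l => //; rewrite addr_ge0// ?invr_ge0 ltW.
rewrite le_eqVlt; apply/orP; left; apply/eqP; field.
by rewrite !gt_eqF//; lra.
Qed.

Lemma energy_ge0 f : (0 <= energy f)%E.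
Proof. by apply: integral_ge0 => p _; rewrite lee_fin sqr_ge0. Qed.

Lemma energyD f g (l : R) : slice_regular f -> slice_regular g -> 0 < l ->
  (energy (f + g)%R <= (1 + l)%:E * energy f + (1 + l^-1)%:E * energy g)%E.
Proof.
move=> rf rg l0; have mP := measurable_plane hi.
have mf := measurable_sqr_fd halpha hsigma hk hek hi rf.
have mg := measurable_sqr_fd halpha hsigma hk hek hi rg.
have mfg := measurable_sqr_fd halpha hsigma hk hek hi (slice_regularD rf rg).
have p1 : 0 <= 1 + l by rewrite addr_ge0// ltW.
have p2 : 0 <= 1 + l^-1 by rewrite addr_ge0// invr_ge0 ltW.
have nn u : forall p, plane p -> (0 <= (`|fd u (pt p.1 p.2)| ^+ 2)%:E)%E.
  by move=> p _; rewrite lee_fin sqr_ge0.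
have sc (c : R) u : 0 <= c -> forall p, plane p -> (0 <= c%:E * (`|fd u (pt p.1 p.2)| ^+ 2)%:E)%E.
  by move=> c0 p pp; rewrite mule_ge0 ?nn.
rewrite -(ge0_integralZl_EFin mu2 mP (nn f) mf p1).
rewrite -(ge0_integralZl_EFin mu2 mP (nn g) mg p2).
have mf' := measurable_funeM (1 + l)%:E mf; have mg' := measurable_funeM (1 + l^-1)%:E mg.
rewrite -(ge0_integralD mu2 mP (sc _ f p1) mf' (sc _ g p2) mg').
apply: (ge0_le_integral mu2 mP (nn _) mfg (emeasurable_funD mf' mg')) => p hp.
by rewrite -!EFinM -EFinD lee_fin (fdD sigma halpha hk hek hi rf rg hp) sqr_normD_le.
Qed.

Lemma energyZ (a : H^c) f : slice_regular f ->
  energy (a *: f) = ((`|a : H| ^+ 2)%:E * energy f)%E.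
Proof.
move=> rf; have mP := measurable_plane hi.
have mf := measurable_sqr_fd halpha hsigma hk hek hi rf.
rewrite -(ge0_integralZl_EFin mu2 mP _ mf (sqr_ge0 _)); last first.
  by move=> p _; rewrite lee_fin sqr_ge0.
apply: eq_integral => p /set_mem hp.
by rewrite -EFinM (fdZ sigma halpha hk hek hi a rf hp) Defs.normqM exprMn mulrC.
Qed.

Local Notation sqn := (dirichlet_sqnorm sigma alpha k i).
Local Notation D := (dirichlet_space sigma alpha k i).
Local Notation N := (dirichlet_norm sigma alpha k i).

Lemma sqn_ge0 f : (0 <= sqn f)%E.
Proof.
by rewrite sqnormE adde_ge0 ?energy_ge0// lee_fin mulr_ge0 ?sqr_ge0// ltW.
Qed.

Lemma sqn_fin f : (sqn f < +oo)%E -> sqn f = (N f ^+ 2)%:E.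
Proof.
move=> h; have fn : sqn f \is a fin_num by rewrite ge0_fin_numE ?sqn_ge0.
by rewrite /dirichlet_norm sqr_sqrtr ?fine_ge0 ?sqn_ge0// fineK.
Qed.

Lemma energy_le_sqn f : (energy f <= sqn f)%E.
Proof. by rewrite sqnormE leeDr// lee_fin mulr_ge0 ?sqr_ge0// ltW. Qed.

Lemma half_le_sqn f : ((alpha * `|slit_ext f (2^-1)%:A| ^+ 2)%:E <= sqn f)%E.
Proof. by rewrite sqnormE leeDl// energy_ge0. Qed.

Lemma sqnD f g (l : R) : slice_regular f -> slice_regular g -> 0 < l ->
  (sqn (f + g)%R <= (1 + l)%:E * sqn f + (1 + l^-1)%:E * sqn g)%E.
Proof.
move=> rf rg l0; rewrite !sqnormE.
have p1 : 0 <= 1 + l by rewrite addr_ge0// ltW.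
have p2 : 0 <= 1 + l^-1 by rewrite addr_ge0// invr_ge0 ltW.
have ef := energyD rf rg l0; have f0 := energy_ge0 f; have g0 := energy_ge0 g.
have sq (u : H) : (0 <= (alpha * `|u| ^+ 2)%:E)%E.
  by rewrite lee_fin mulr_ge0 ?sqr_ge0 ?(ltW halpha).
move: (energy f) (energy g) (energy _) f0 g0 ef => a b c a0 b0 cab.
rewrite (ge0_muleDr _ (sq _) a0) (ge0_muleDr _ (sq _) b0).
rewrite addeACA -(EFinM (1 + l)) -(EFinM (1 + l^-1)) -EFinD.
apply: leeD; last exact: cab.
rewrite lee_fin slit_extD (mulrCA (1 + l)) (mulrCA (1 + l^-1)) -mulrDr.
by rewrite ler_wpM2l ?(ltW halpha)// sqr_normD_le.
Qed.

Lemma sqnZ (a : H^c) f : slice_regular f -> sqn (a *: f) = ((`|a : H| ^+ 2)%:E * sqn f)%E.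
Proof.
move=> rf; rewrite !sqnormE energyZ// slit_extZ; have f0 := energy_ge0 f.
have sq (u : H) : (0 <= (alpha * `|u| ^+ 2)%:E)%E.
  by rewrite lee_fin mulr_ge0 ?sqr_ge0 ?(ltW halpha).
move: (energy f) f0 => b b0; rewrite (ge0_muleDr _ (sq _) b0).
by rewrite -(EFinM (`|a : H| ^+ 2)) Defs.normqM exprMn (mulrCA (`|a : H| ^+ 2)) [`|a : H| ^+ 2 * _]mulrC.
Qed.

Lemma dirichlet_right_submodule : is_right_submodule D.
Proof.
have hZ (a : H^c) u : D u -> D (a *: u).
  move=> [rf hf]; split; first exact: slice_regularZ.
  by rewrite sqnZ// sqn_fin// -EFinM ltry.
have r0 := slice_regular0 R.
split; [split; first exact: r0| |exact: hZ].
  rewrite -(scale0r (0 : slit_fun R)) (sqnZ 0 r0) normr0 expr0n mul0e; exact: ltry.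
- move=> f g [rf hf] [rg hg]; split; first exact: slice_regularD.
  apply: le_lt_trans (sqnD rf rg ltr01) _.
  rewrite (sqn_fin hf) (sqn_fin hg) -!EFinM -EFinD; exact: ltry.
Qed.

Lemma dirichlet_normZ (a : H^c) f : D f -> N (a *: f) = N f * `|a : H|.
Proof.
move=> [rf hf]; rewrite /dirichlet_norm sqnZ// sqn_fin// -EFinM /=.
by rewrite -exprMn !sqrtr_sqr ger0_norm ?mulr_ge0 ?sqrtr_ge0// [RHS]mulrC ger0_norm// sqrtr_ge0.
Qed.

Lemma dirichlet_normD f g : D f -> D g -> N (f + g) <= N f + N g.
Proof.
move=> Df Dg; have [rf hf] := Df; have [rg hg] := Dg.
have [_ DD _] := dirichlet_right_submodule; have [_ hfg] := DD _ _ Df Dg.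
apply: le_add_of_sqr; rewrite ?sqrtr_ge0// => l l0.
have := sqnD rf rg l0.
by rewrite (sqn_fin hf) (sqn_fin hg) (sqn_fin hfg) -!EFinM -EFinD lee_fin.
Qed.

End DirichletNorm.

(** * Definiteness of the norm *)

Section Definiteness.
Variables (R : realType) (alpha sigma : R) (k : nat) (i : quat R).
Hypotheses (halpha : 0 < alpha) (hsigma : 0 < sigma < 1) (hk : (0 < k)%N)
  (hek : forall q : quat R, slit_ball q -> exp_trunc k.-1 (qpowR q alpha) != 0)
  (hi : imag_sphere i).
Local Notation H := (quat R).
Local Notation pt := (slice_pt i).
Local Notation fd := (frac_deriv sigma alpha k i).
Local Notation mfac := (mfac alpha sigma k i).
Local Notation intfac := (intfac alpha sigma k i).
Local Notation wfun := (wfun alpha sigma k i).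
Local Notation energy := (energy alpha sigma k i).
Implicit Types (f g : slit_fun R).

Local Notation half := ((2^-1)%:A : H).
Local Notation sqn := (dirichlet_sqnorm sigma alpha k i).
Local Notation D := (dirichlet_space sigma alpha k i).
Local Notation N := (dirichlet_norm sigma alpha k i).

(** The slit disc is star-shaped with respect to one half. *)
Lemma slit_slice_star z s : slit_slice i z -> 0 <= s <= 1 ->
  slit_slice i (half + s *: (z - half)).
Proof.
move=> hz /andP[s0 s1]; have [_ Sz] := hz; move: hz.
rewrite (slice_ptE hi Sz); move: (qre z) (imc i z) => x y /(slit_slice_ptE hi)[n1 n2].
have -> : half + s *: (pt x y - half) = pt ((1 - s) / 2 + s * x) (s * y).
  by apply: quatP => /=; ring.
apply/(slit_slice_ptE hi); split.
  have := mulr_ge0 (mulr_ge0 s0 (_ : 0 <= 1 - s))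
    (addr_ge0 (sqr_ge0 (2^-1 - x)) (sqr_ge0 y)).
  rewrite subr_ge0 => /(_ s1) h.
  rewrite (_ : ((1 - s) / 2 + s * x) ^+ 2 + (s * y) ^+ 2 = (1 - s) / 4 + s * (x ^+ 2 + y ^+ 2) -
    s * (1 - s) * ((2^-1 - x) ^+ 2 + y ^+ 2)); last by field.
  have := ler_wpM2l s0 (ltW n1); rewrite mulr1 => h2.
  have [->|s2] := eqVneq s 0; first lra.
  have : s * (x ^+ 2 + y ^+ 2) < s by rewrite gtr_pMr// lt_neqAle eq_sym s2.
  move: h; move: (s * (1 - s) * ((2^-1 - x) ^+ 2 + y ^+ 2)) (s * (x ^+ 2 + y ^+ 2)) => A B; lra.
have [->|s2] := eqVneq s 0; first by left; rewrite subr0 mul0r addr0 mul1r invr_gt0.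
have sp : 0 < s by rewrite lt_neqAle eq_sym s2.
case: n2 => [x0|y0]; [left|right]; last by rewrite mulf_neq0.
by rewrite ltr_wpDl ?mulr_gt0// divr_ge0// subr_ge0.
Qed.

(** Bisection makes the local bounds of [energy_bound] uniform along the segment
    from one half to [z], and the mean value inequality integrates them. *)
Lemma wfun_bound z : slit_slice i z -> exists2 K, 0 < K &
  forall f E, slice_regular f -> 0 < E -> (energy f <= (E ^+ 2)%:E)%E ->
    `|wfun f z - wfun f half| <= K * E.
Proof.
move=> hz; pose seg (s : R) : H := half + s *: (z - half).
have hseg s : 0 <= s <= 1 -> slit_slice i (seg s) by exact: slit_slice_star.
pose bounded (a b : R) := exists C, forall s, a <= s <= b -> forall f E, slice_regular f ->
  0 < E -> (energy f <= (E ^+ 2)%:E)%E -> `|mfac (seg s) * fd f (seg s)| <= C * E.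
have [C hC] : bounded 0 1.
  apply: (@rect_bisection R (fun a b _ _ => bounded a b) 0 1 0 0) => //.
    move=> a b c d _ ab _ _ _ _ /= [C1 h1] [C2 h2] _ _.
    exists (Num.max C1 C2) => s /andP[as_ sb] f E rf E0 hE.
    have [sm|sm] := leP s ((a + b) / 2).
      apply: le_trans (h1 s _ f E rf E0 hE) _; first by rewrite as_ sm.
      by rewrite ler_wpM2r ?(ltW E0)// le_max lexx.
    apply: le_trans (h2 s _ f E rf E0 hE) _; first by rewrite sb (ltW sm).
    by rewrite ler_wpM2r ?(ltW E0)// le_max lexx orbT.
  move=> s t hs _; have [r r0 [C C0 hC]] := energy_bound halpha hsigma hk hek hi (hseg s hs).
  have n1 : 0 < `|z - half| + 1 by rewrite ltr_wpDl.
  exists (r / (`|z - half| + 1)); first by rewrite divr_gt0.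
  move=> a b c d a0 /andP[as_ sb] b1 _ _ _ hab _; exists C => s' /andP[as' sb'] f E rf E0 hE.
  have [_ Ss] : slit_slice i (seg s').
    by apply: hseg; rewrite (le_trans a0 as') (le_trans sb' b1).
  apply: (proj2 (hC (seg s') Ss _)) => //.
  rewrite /seg opprD addrACA subrr add0r -scalerBl normrZ.
  have hs' : `|s' - s| <= b - a by rewrite ler_norml opprB !lerB.
  rewrite ltr_pdivlMr// in hab; apply: le_lt_trans hab.
  by apply: ler_pM; rewrite // lerDl.
have n1 : 0 < `|C| * `|z - half| + 1 by rewrite ltr_wpDl// mulr_ge0.
exists (`|C| * `|z - half| + 1) => // f E rf E0 hE.
have [_ Sz] := hz.
have := @mvt_slice R i (wfun f) (fun u => mfac u * fd f u) half z (`|C| * E)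
  (sliceA i _) Sz (fun s hs => holo_wfun halpha hsigma hk hek hi rf (hseg s hs)).
move=> /(_ _)/le_trans; apply; last by rewrite mulrAC ler_wpM2r ?(ltW E0)// lerDl.
move=> s hs; apply: le_trans (hC s hs f E rf E0 hE) _.
by rewrite ler_wpM2r ?(ltW E0)// ler_norm.
Qed.

(** A function of norm zero has vanishing energy, hence constant [wfun], and
    this constant is zero because of the value at one half. *)
Lemma dirichlet_norm_eq0 f : D f -> N f = 0 -> f = 0.
Proof.
move=> [rf hf] N0; have sq0 : sqn f = 0%E by rewrite sqn_fin// N0 expr0n.
have hE E : 0 < E -> (energy f <= (E ^+ 2)%:E)%E.
  by move=> E0; rewrite (le_trans (energy_le_sqn sigma k i halpha f))// sq0 lee_fin sqr_ge0.
have F0 : slit_ext f half = 0.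
  have := half_le_sqn alpha sigma k i f; rewrite sq0 lee_fin => h.
  apply/eqP; rewrite -normr_eq0 -sqrf_eq0 eq_le sqr_ge0 andbT.
  by rewrite -(pmulr_rle0 _ halpha).
apply: (slice_regular_eq0 hi rf) => z hz.
have [K K0 hK] := wfun_bound hz.
have w0 : intfac z * slit_ext f z = 0.
  rewrite -/(wfun f z); apply/eqP; rewrite -normr_le0; apply/ler_addgt0Pr => e e0; rewrite add0r.
  have := hK f (e / K) rf (divr_gt0 e0 K0) (hE _ (divr_gt0 e0 K0)).
  by rewrite (_ : wfun f half = intfac half * slit_ext f half)// F0 mulr0 subr0 mulrC divfK// gt_eqF.
by move/eqP: w0; rewrite mulq_eq0 (negbTE (intfac_neq0 _ _ _ hi _)) => /eqP.
Qed.

Lemma dirichlet_is_norm : is_norm_on D N.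
Proof.
split; [by move=> f _; exact: sqrtr_ge0|exact: dirichlet_norm_eq0| |].
  exact: dirichlet_normZ.
exact: dirichlet_normD.
Qed.

End Definiteness.

(** * Real differentiability off the real axis *)

Section RealDifferentiability.
Variable R : realType.
Local Notation H := (quat R).

Definition real_diff (f : H -> H) (q : H) :=
  exists L, [/\ real_linear L, bdd_map L & diff_within setT f q L].

Lemma real_diff_differentiable f q : real_diff f q -> differentiable f q.
Proof. by move=> [L [lL bL hL]]; exact: differentiable_diff_within hL. Qed.

Lemma real_diff_cst (c q : H) : real_diff (fun=> c) q.
Proof.
exists (fun=> 0); split; [|exact: bdd_map0|exact: diff_within_cst].
by move=> a u v; rewrite scaler0 addr0.
Qed.

Lemma real_diff_linear (L : H -> H) q : real_linear L -> bdd_map L -> real_diff L q.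
Proof.
move=> lL bL; exists L; split=> // e e0; exists 1 => // w _ _.
have -> : L w = L (w - q) + L q by have := lL 1 (w - q) q; rewrite !scale1r subrK.
by rewrite addrK subrr normr0 mulr_ge0// ltW.
Qed.

Lemma real_diff_add f g q : real_diff f q -> real_diff g q ->
  real_diff (fun w => f w + g w) q.
Proof.
move=> [L [lL bL hL]] [M [lM bM hM]]; exists (fun h => L h + M h).
split; [|exact: bdd_map_add|exact: diff_within_add].
by move=> a u v; rewrite lL lM scalerDr addrACA.
Qed.

Lemma real_diff_mul f g q : real_diff f q -> real_diff g q ->
  real_diff (fun w => f w * g w) q.
Proof.
move=> [L [lL bL hL]] [M [lM bM hM]]; exists (fun h => L h * g q + f q * M h).
split; [|apply: bdd_map_add; [exact: bdd_map_mulr|exact: bdd_map_mull]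
  |exact: diff_within_mul].
move=> a u v; rewrite lL lM mulrDl mulrDr -scalerAl -scalerAr scalerDr addrACA //.
Qed.

Lemma real_diff_comp (i : H) (f G : H -> H) (q : H) :
  (forall w, slice i (f w)) -> real_diff f q -> holomorphic_at i G (f q) ->
  real_diff (fun w => G (f w)) q.
Proof.
move=> Sf [L [lL bL hL]] [p hp]; exists (fun h => L h * p).
split; [|exact: bdd_map_mulr|exact: (diff_within_comp (fun w _ => Sf w) bL hL hp)].
by move=> a u v; rewrite lL mulrDl scalerAl.
Qed.

(** From [|a + b|^2 - |a|^2 = 2 <a, b> + |b|^2], divided by [|a + b| + |a|]. *)
Lemma norm_expand (a b : H) : a != 0 ->
  `| `|a + b| - `|a| - qre (conjq a * b) / `|a| | <= 2 * `|b| ^+ 2 / `|a|.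
Proof.
move=> a0; have na : 0 < `|a| by rewrite normr_gt0.
set d := qre _; have sE : `|a + b| ^+ 2 = `|a| ^+ 2 + 2 * d + `|b| ^+ 2.
  by rewrite !sqr_normq /d /=; ring.
have dl : `|d| <= `|a| * `|b|.
  have [h _ _ _] := normq_comps (conjq a * b).
  by rewrite -(norm_conjq a) -Defs.normqM.
have s0 : 0 < `|a + b| + `|a| by rewrite ltr_wpDl.
have tri : `| `|a + b| - `|a| | <= `|b|.
  by have := ler_dist_dist (a + b) a; rewrite addrAC subrr add0r.
move: (`|a + b|) (`|a|) (`|b|) (normr_ge0 b) (normr_ge0 (a + b)) na sE dl s0 tri.
move=> s r t t0 s1 r0 sE dl s0 tri.
have -> : s - r - d / r = (t ^+ 2 - d * (s - r) / r) / (s + r).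
  have {}sE : s ^+ 2 - r ^+ 2 = 2 * d + t ^+ 2 by rewrite sE; ring.
  have -> : t ^+ 2 = s ^+ 2 - r ^+ 2 - 2 * d by rewrite sE; ring.
  by field; rewrite !gt_eqF.
rewrite normrM normfV (gtr0_norm s0) ler_pdivrMr//.
have h1 : `|d * (s - r) / r| <= t ^+ 2.
  rewrite !normrM normfV (gtr0_norm r0) ler_pdivrMr//.
  by rewrite (le_trans (ler_pM _ _ dl tri))// expr2 [leRHS]mulrC mulrA.
rewrite (le_trans (ler_normB _ _))// ger0_norm ?sqr_ge0//.
have h2 : 2 * t ^+ 2 <= 2 * t ^+ 2 / r * (s + r).
  rewrite [leRHS]mulrDr divfK ?gt_eqF// lerDr mulr_ge0// divr_ge0 ?(ltW r0)//.
  by rewrite mulr_ge0// sqr_ge0.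
by apply: le_trans h2; lra.
Qed.

(** Only the modulus of the imaginary part needs care; off the real axis
    [norm_expand] linearizes it. The coefficients give at once the two points
    [x + i y], [x - i y] of the plane of [i] and the scalar [y]. *)
Lemma real_diff_coords (i : H) (hi : imag_sphere i) (r s t : R) (q : H) : qim q != 0 ->
  real_diff (fun w => slice_pt i (r * qre w + s * `|qim w|) (t * `|qim w|)) q.
Proof.
move=> q0; have nq : 0 < `|qim q| by rewrite normr_gt0.
pose l (h : H) := qre (conjq (qim q) * qim h) / `|qim q|.
exists (fun h => slice_pt i (r * qre h + s * l h) (t * l h)).
have lb h : `|l h| <= `|h|.
  rewrite /l normrM normfV normr_id ler_pdivrMr//.
  have [k _ _ _] := normq_comps (conjq (qim q) * qim h).
  rewrite (le_trans k)// Defs.normqM norm_conjq mulrC ler_wpM2r//.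
  exact: norm_qim_le.
split.
- move=> a u v; rewrite slice_ptZ slice_ptD; congr (slice_pt i _ _);
    by rewrite /l /=; field; rewrite gt_eqF.
- exists (`|r| + `|s| + `|t| + 1); first by rewrite ltr_wpDl// !addr_ge0.
  move=> h; have [k _ _ _] := normq_comps h.
  rewrite (le_trans (norm_slice_pt_le hi _ _))//.
  have n1 : `|r * qre h + s * l h| <= `|r| * `|h| + `|s| * `|h|.
    rewrite (le_trans (ler_normD _ _))// (normrM r) (normrM s).
    by apply: lerD; rewrite ler_wpM2l ?lb.
  have n2 : `|t * l h| <= `|t| * `|h| by rewrite (normrM t) ler_wpM2l ?lb.
  by rewrite (le_trans (lerD n1 n2))// !mulrDl mul1r lerDl.
- move=> e e0; have c0 : 0 < (`|s| + `|t|) * 2 / `|qim q| + 1.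
    by rewrite ltr_wpDl// divr_ge0// mulr_ge0// addr_ge0.
  exists (e / ((`|s| + `|t|) * 2 / `|qim q| + 1)); first by rewrite divr_gt0.
  move=> w _; rewrite ltr_pdivlMr// => hw.
  pose err := `|qim w| - `|qim q| - l (w - q).
  have herr : `|err| <= 2 * `|w - q| ^+ 2 / `|qim q|.
    have := @norm_expand (qim q) (qim (w - q)) q0.
    have -> : qim q + qim (w - q) = qim w by apply: quatP => /=; ring.
    move=> /le_trans; apply.
    rewrite ler_pM2r ?invr_gt0// ler_pM2l// ler_sqr ?nnegrE//.
    exact: norm_qim_le.
  have -> : slice_pt i (r * qre w + s * `|qim w|) (t * `|qim w|) -
      slice_pt i (r * qre q + s * `|qim q|) (t * `|qim q|) -
      slice_pt i (r * qre (w - q) + s * l (w - q)) (t * l (w - q)) =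
      slice_pt i (s * err) (t * err).
    by rewrite !slice_ptB; congr (slice_pt i _ _); rewrite /err /=; ring.
  rewrite (le_trans (norm_slice_pt_le hi _ _))// (normrM s) (normrM t) -mulrDl.
  have st : 0 <= `|s| + `|t| by rewrite addr_ge0.
  rewrite (le_trans (ler_wpM2l st herr))//.
  have -> : (`|s| + `|t|) * (2 * `|w - q| ^+ 2 / `|qim q|) =
    `|w - q| * ((`|s| + `|t|) * 2 / `|qim q|) * `|w - q| by ring.
  rewrite ler_wpM2r// (le_trans _ (ltW hw))// ler_wpM2l// lerDl//.
Qed.

End RealDifferentiability.

(** * Extension from one slice *)

Section SliceExtension.
Variable R : realType.
Local Notation H := (quat R).
Variables (i : H) (hi : imag_sphere i) (F : H -> H).
Hypothesis hF : forall z, slit_slice i z -> holomorphic_at i F z.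
Local Notation pt := (slice_pt i).

(** Half of [1 - I i], which intertwines the planes of [i] and [I]
    ([slice_projM]). *)
Definition slice_proj (I : H) : H := 2^-1 *: (1 - I * i).

(** The representation formula for slice functions. *)
Definition slice_extension (q : H) : H :=
  slice_proj (qaxis q) * F (pt (qre q) `|qim q|) +
  slice_proj (- qaxis q) * F (pt (qre q) (- `|qim q|)).

Lemma slice_projD I : slice_proj I + slice_proj (- I) = 1.
Proof. by rewrite /slice_proj; apply: quatP => /=; field. Qed.

Lemma norm_slice_proj I : imag_sphere I -> `|slice_proj I| <= 1.
Proof.
move=> [_ nI]; have [_ ni] := hi; rewrite normrZ ger0_norm//.
have := ler_normB (1 : H) (I * i : H); rewrite Defs.normqM nI ni mulr1 normq1; lra.
Qed.

Lemma slice_projM I x y : imag_sphere I ->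
  slice_pt I x y * slice_proj I = slice_proj I * pt x y.
Proof.
move=> hI; rewrite /slice_proj /slice_pt -scalerAr -scalerAl; congr (_ *: _).
rewrite mulrDl !mulrDr !mulrBl !mul1r !mulr1 -!scalerAl -!scalerAr !mul1r !mulr1.
rewrite !mulrN mulrA (sphere_sqr hI) -(mulrA I i i) (sphere_sqr hi) mulrN1 mulN1r.
by apply: quatP => /=; ring.
Qed.

Lemma slice_projNM I x y : imag_sphere I ->
  slice_pt I x y * slice_proj (- I) = slice_proj (- I) * pt x (- y).
Proof.
move=> hI; rewrite -(slice_projM _ _ (sphereN hI)); congr (_ * _).
by rewrite /slice_pt scalerN scaleNr opprK.
Qed.

Lemma slice_extension_pt I x y : imag_sphere I ->
  slice_extension (slice_pt I x y) =
  slice_proj I * F (pt x y) + slice_proj (- I) * F (pt x (- y)).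
Proof.
move=> hI; have [I0 nI] := hI; rewrite /slice_extension (qre_slice_pt hI).
rewrite (qim_slice_pt hI) normrZ nI mulr1 /qaxis (qim_slice_pt hI) normrZ nI mulr1.
have [y0|y0|->] := ltgtP y 0.
- rewrite scaler_eq0 (lt_eqF y0) -normr_eq0 nI oner_eq0 /= ltr0_norm// opprK.
  by rewrite scalerA invrN mulNr mulVf ?lt_eqF// scaleN1r opprK addrC.
- rewrite scaler_eq0 (gt_eqF y0) -normr_eq0 nI oner_eq0 /= gtr0_norm//.
  by rewrite scalerA mulVf ?gt_eqF// scale1r.
- by rewrite normr0 oppr0 -!mulrDl !slice_projD.
Qed.

(** The increments of the extension are those of [F] at two points of the
    plane of [i], seen through [slice_projM]. *)
Lemma slice_extension_expand I x y x0 y0 p p' : imag_sphere I ->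
  slice_extension (slice_pt I x y) - slice_extension (slice_pt I x0 y0)
  - (slice_pt I x y - slice_pt I x0 y0) * (slice_proj I * p + slice_proj (- I) * p') =
  slice_proj I * (F (pt x y) - F (pt x0 y0) - (pt x y - pt x0 y0) * p) +
  slice_proj (- I) * (F (pt x (- y)) - F (pt x0 (- y0)) - (pt x (- y) - pt x0 (- y0)) * p').
Proof.
move=> hI; rewrite !slice_extension_pt// !slice_ptB (mulrDr (slice_pt I _ _)).
rewrite !(mulrA (slice_pt I _ _)) (slice_projM _ _ hI) (slice_projNM _ _ hI).
rewrite -opprB opprK opprB opprD -!mulrA.
move: (slice_proj I) (slice_proj (- I)) (F _) (F _) (F _) (F _) => A B a b c d.
by rewrite !mulrBr; apply: quatP => /=; ring.
Qed.

Lemma slit_slice_rotate I x y : imag_sphere I -> slit_ball (slice_pt I x y) ->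
  slit_slice i (pt x y) /\ slit_slice i (pt x (- y)).
Proof.
move=> hI hB; have hs : slit_slice I (slice_pt I x y) by split=> //; exact: slice_slice_pt.
move/(slit_slice_ptE hI): hs => [h1 h2].
by split; apply/(slit_slice_ptE hi); rewrite ?sqrrN ?oppr_eq0.
Qed.

Lemma norm_slice_rotate I x y : imag_sphere I ->
  `|pt x y| = `|slice_pt I x y| /\ `|pt x (- y)| = `|slice_pt I x y|.
Proof.
move=> hI; split; apply/eqP; rewrite -(@eqrXn2 _ 2)//.
  by rewrite (sqr_norm_slice_pt hi) (sqr_norm_slice_pt hI).
by rewrite (sqr_norm_slice_pt hi) (sqr_norm_slice_pt hI) sqrrN.
Qed.

(** Rates that depend on [F] only, not on [I]: this uniformity gives the
    differentiability at real points, where all planes meet. *)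
Lemma slice_extension_err I x y x0 y0 p p' (e d : R) : imag_sphere I -> 0 < e ->
  (forall w, slice i w -> `|w - pt x0 y0| < d ->
     `|F w - F (pt x0 y0) - (w - pt x0 y0) * p| <= e / 2 * `|w - pt x0 y0|) ->
  (forall w, slice i w -> `|w - pt x0 (- y0)| < d ->
     `|F w - F (pt x0 (- y0)) - (w - pt x0 (- y0)) * p'| <= e / 2 * `|w - pt x0 (- y0)|) ->
  `|slice_pt I x y - slice_pt I x0 y0| < d ->
  `|slice_extension (slice_pt I x y) - slice_extension (slice_pt I x0 y0)
    - (slice_pt I x y - slice_pt I x0 y0) * (slice_proj I * p + slice_proj (- I) * p')|
  <= e * `|slice_pt I x y - slice_pt I x0 y0|.
Proof.
move=> hI e0 h h' hd; rewrite (slice_extension_expand _ _ _ _ _ _ hI).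
have [n1 n2] := norm_slice_rotate (x - x0) (y - y0) hI.
have e1 : pt x (- y) - pt x0 (- y0) = pt (x - x0) (- (y - y0)).
  by rewrite slice_ptB; congr (slice_pt i _ _); ring.
have k := h _ (slice_slice_pt i x y); have k' := h' _ (slice_slice_pt i x (- y)).
rewrite slice_ptB in hd; rewrite slice_ptB n1 in k; rewrite e1 n2 in k'.
rewrite e1 !slice_ptB; move: (k hd) (k' hd) => {}k {}k'.
rewrite (le_trans (ler_normD _ _))// !Defs.normqM.
set N := `|slice_pt I _ _|; rewrite (_ : e * N = e / 2 * N + e / 2 * N); last first.
  by rewrite -mulrDl -splitr.
apply: lerD.
  by rewrite -[leRHS]mul1r; apply: ler_pM => //; exact: norm_slice_proj.
by rewrite -[leRHS]mul1r; apply: ler_pM => //; apply: norm_slice_proj; exact: sphereN.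
Qed.

Lemma slice_extension_holo I z : imag_sphere I -> slit_slice I z ->
  holomorphic_at I slice_extension z.
Proof.
move=> hI [Bz Sz]; move: Bz; rewrite (slice_ptE hI Sz).
move: (qre z) (imc I z) => x0 y0 Bz.
have [h1 h2] := slit_slice_rotate hI Bz.
case: (hF h1) => p hp; case: (hF h2) => p' hp'.
exists (slice_proj I * p + slice_proj (- I) * p') => e e0.
have e2 : 0 < e / 2 by rewrite divr_gt0.
have [d d0 hd] := hp _ e2; have [d' d0' hd'] := hp' _ e2.
exists (Num.min d d'); first by rewrite lt_min d0.
move=> w Sw; rewrite (slice_ptE hI Sw) => wd.
apply: (@slice_extension_err I _ _ _ _ p p' e (Num.min d d')) => //.
  by move=> u Su; rewrite lt_min => /andP[ud _]; exact: hd.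
by move=> u Su; rewrite lt_min => /andP[_ ud]; exact: hd'.
Qed.

Lemma slice_extension_diff q : slit_ball q -> real_diff slice_extension q.
Proof.
move=> Bq; have [q0|q0] := eqVneq (qim q) 0.
(* every plane contains a real point, with the same derivative of [F] there *)
  have qE I : q = slice_pt I (qre q) 0.
    by rewrite slice_pt0 [LHS]qaxisE q0 normr0 slice_pt0.
  have : slit_ball (slice_pt i (qre q) 0) by rewrite -qE.
  move=> /(slit_slice_rotate hi)[/hF[p hp] _].
  exists (fun h => h * p); split; [|exact: bdd_holo|].
    by move=> a u v; rewrite mulrDl scalerAl.
  move=> e e0; have [d d0 hd] := hp _ (divr_gt0 e0 (ltr0n _ 2)); exists d => // w _.
  have hI := qaxis_sphere w; set I := qaxis w in hI.
  rewrite (qaxisE w) -/I (qE I) => wd.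
  have := @slice_extension_err I (qre w) `|qim w| (qre q) 0 p p e d hI e0.
  rewrite -mulrDl slice_projD mul1r oppr0; exact.
have Fp s : s = 1 \/ s = -1 ->
    real_diff (fun w => F (pt (1 * qre w + 0 * `|qim w|) (s * `|qim w|))) q.
  move=> hs; apply: (@real_diff_comp R i (fun w => pt (1 * qre w + 0 * `|qim w|) (s * `|qim w|))).
  - by move=> w; exact: slice_slice_pt.
  - exact: (real_diff_coords hi 1 0 s q0).
  - apply: hF; rewrite mul1r mul0r addr0.
    have : slit_ball (slice_pt (qaxis q) (qre q) `|qim q|) by rewrite -qaxisE.
    move=> /(slit_slice_rotate (qaxis_sphere q))[h1 h2].
    by case: hs => ->; rewrite ?mul1r ?mulN1r.
have inv_diff : real_diff (fun w => (pt (0 * qre w + 1 * `|qim w|) (0 * `|qim w|))^-1) q.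
  apply: (@real_diff_comp R i (fun w => pt (0 * qre w + 1 * `|qim w|) (0 * `|qim w|))
    (fun w => w^-1)).
  - by move=> w; exact: slice_slice_pt.
  - exact: (real_diff_coords hi 0 1 0 q0).
  - eexists; apply: (holo_inv hi); last exact: slice_slice_pt.
    by rewrite !mul0r add0r mul1r slice_pt0 scaler_eq0 oner_eq0 orbF normr_eq0.
have im_diff : real_diff (@qim R) q.
  apply: real_diff_linear.
    by move=> a u v; apply: quatP => /=; rewrite ?mulr0 ?addr0.
  by exists 1 => // h; rewrite mul1r norm_qim_le.
have proj_diff (s : R) : real_diff (fun w => (2^-1)%:A *
    (1 + s%:A * ((pt (0 * qre w + 1 * `|qim w|) (0 * `|qim w|))^-1 * qim w * i))) q.
  apply: real_diff_mul; first exact: real_diff_cst.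
  apply: real_diff_add; first exact: real_diff_cst.
  apply: real_diff_mul; first exact: real_diff_cst.
  by apply: real_diff_mul; [exact: real_diff_mul|exact: real_diff_cst].
have := real_diff_add (real_diff_mul (proj_diff (-1)) (Fp 1 (or_introl erefl)))
  (real_diff_mul (proj_diff 1) (Fp (-1) (or_intror erefl))).
have nq : 0 < `|qim q| by rewrite normr_gt0.
have same w : `|w - q| < `|qim q| ->
  (2^-1)%:A * (1 + (-1)%:A * ((pt (0 * qre w + 1 * `|qim w|) (0 * `|qim w|))^-1 * qim w * i)) *
    F (pt (1 * qre w + 0 * `|qim w|) (1 * `|qim w|)) +
  (2^-1)%:A * (1 + 1%:A * ((pt (0 * qre w + 1 * `|qim w|) (0 * `|qim w|))^-1 * qim w * i)) *
    F (pt (1 * qre w + 0 * `|qim w|) (-1 * `|qim w|)) = slice_extension w.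
  move=> wq; have w0 : qim w != 0.
    apply/eqP => w0; have := norm_qim_le (w - q); rewrite qimB w0 sub0r normrN => h.
    by have := le_lt_trans h wq; rewrite ltxx.
  rewrite /slice_extension /qaxis (negbTE w0) !mul0r !mul1r !add0r !addr0 mulN1r slice_pt0.
  have -> : (`|qim w|%:A)^-1 * qim w = `|qim w|^-1 *: qim w.
    by rewrite [RHS]scaleqE; congr (_ * _); apply: quatP => /=; rewrite /sqnormq/=; field; rewrite ?normr_eq0.
  by rewrite /slice_proj scaleN1r mulN1r !scale1r mul1r mulNr opprK -!scaleqE.
move=> [L [lL bL hL]]; exists L; split=> //.
apply: (diff_within_near nq _ _ hL); first by apply: same; rewrite subrr normr0.
by move=> w _; exact: same.
Qed.

(** On the plane of [I] the extension combines the values of [F] at [x + i y] and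
    [x - i y] with constant coefficients, which makes it holomorphic there. *)
Lemma slice_regular_extension : exists2 f : slit_fun R, slice_regular f &
  forall z, slit_slice i z -> slit_ext f z = F z.
Proof.
pose f : slit_fun R := fun q => slice_extension (val q).
have fE q : slit_ball q -> slit_ext f q = slice_extension q.
  by move=> /mem_set hq; rewrite slit_ext_at.
have near q : slit_ball q -> exists2 r, 0 < r & forall w, setT w ->
    `|w - q| < r -> slice_extension w = slit_ext f w.
  by move=> /slit_ball_open[r r0 hr]; exists r => // w _ /hr/fE ->.
exists f; last first.
  move=> z [Bz Sz]; rewrite fE// {1}(slice_ptE hi Sz) slice_extension_pt//.
  rewrite -(slice_ptE hi Sz) /slice_proj mulNr opprK (sphere_sqr hi) opprK subrr.
  by rewrite scaler0 mul0r addr0 (_ : 2^-1 *: (1 + 1) = 1) ?mul1r//; apply: quatP => /=; field.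
apply: holo_slice_regular => [q Bq|I hI z [Bz Sz]].
  have [r r0 hr] := near q Bq; apply: real_diff_differentiable.
  case: (slice_extension_diff Bq) => L [lL bL hL]; exists L; split=> //.
  by apply: (diff_within_near r0 _ hr hL); rewrite fE.
have [r r0 hr] := near z Bz; have [p hp] := slice_extension_holo hI (conj Bz Sz).
exists p; apply: (diff_within_near r0 _ _ hp); first by rewrite fE.
by move=> w _; exact: hr.
Qed.

End SliceExtension.

(** * Limits of holomorphic sequences *)

Section QuaternionSequences.
Variable R : realType.
Local Notation H := (quat R).

Definition tends (x : nat -> H) (l : H) :=
  forall e, 0 < e -> exists n0, forall n, (n0 <= n)%N -> `|x n - l| <= e.

Lemma real_cauchy_limit (x : nat -> R) :
  (forall e, 0 < e -> exists n0, forall m n, (n0 <= m)%N -> (n0 <= n)%N ->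
     `|x m - x n| <= e) ->
  exists l, forall e, 0 < e -> exists n0, forall n, (n0 <= n)%N -> `|x n - l| <= e.
Proof.
move=> hx; have : cvg (x @ \oo).
  apply: (@cauchy_cvg R^o); apply: cauchy_exP => e e0.
  have [n0 h0] := hx (e / 2) (divr_gt0 e0 (ltr0n _ 2)).
  exists (x n0), n0 => // n /= hn; rewrite -ball_normE /=.
  by rewrite (le_lt_trans (h0 _ _ (leqnn _) hn))// gtr_pMr// invf_lt1// ltr1n.
move=> /(@cvgrPdist_le R R^o) hl; exists (lim (x @ \oo)) => e e0.
have [n0 _ h0] := hl e e0; exists n0 => n hn; rewrite distrC; exact: h0.
Qed.

Lemma cauchy_tends (x : nat -> H) :
  (forall e, 0 < e -> exists n0, forall m n, (n0 <= m)%N -> (n0 <= n)%N ->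
     `|x m - x n| <= e) -> exists l, tends x l.
Proof.
move=> hx; have lim_comp (c : H -> R) : (forall p q, c (p - q) = c p - c q) ->
    (forall p, `|c p| <= `|p|) -> exists l, forall e, 0 < e -> exists n0, forall n,
      (n0 <= n)%N -> `|c (x n) - l| <= e.
  move=> cB cl; apply: real_cauchy_limit => e e0; have [n0 h0] := hx e e0.
  by exists n0 => m n hm hn; rewrite -cB (le_trans (cl _))// h0.
have [l1 h1] := lim_comp (@qre R) (fun _ _ => erefl) (fun p => let: And4 h _ _ _ := normq_comps p in h).
have [l2 h2] := lim_comp (@qi R) (fun _ _ => erefl) (fun p => let: And4 _ h _ _ := normq_comps p in h).
have [l3 h3] := lim_comp (@qj R) (fun _ _ => erefl) (fun p => let: And4 _ _ h _ := normq_comps p in h).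
have [l4 h4] := lim_comp (@qk R) (fun _ _ => erefl) (fun p => let: And4 _ _ _ h := normq_comps p in h).
exists (Quat l1 l2 l3 l4) => e e0; have e4 : 0 < e / 4 by rewrite divr_gt0.
have [n1 k1] := h1 _ e4; have [n2 k2] := h2 _ e4.
have [n3 k3] := h3 _ e4; have [n4 k4] := h4 _ e4.
exists (maxn (maxn n1 n2) (maxn n3 n4)) => n; rewrite !geq_max.
move=> /andP[/andP[/k1 g1 /k2 g2] /andP[/k3 g3 /k4 g4]].
rewrite (le_trans (ler_normq_comps _))//= (_ : e = e / 4 + e / 4 + e / 4 + e / 4).
  by rewrite !lerD.
by field.
Qed.

Lemma tends_le (x : nat -> H) (l b : H) (c : R) (n0 : nat) : tends x l ->
  (forall n, (n0 <= n)%N -> `|x n - b| <= c) -> `|l - b| <= c.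
Proof.
move=> hx hb; apply/ler_addgt0Pr => e e0; have [n1 h1] := hx e e0.
have := hb (maxn n0 n1) (leq_maxl _ _); have := h1 (maxn n0 n1) (leq_maxr _ _).
move: (x _) => y h2 h3; rewrite (_ : l - b = (y - b) - (y - l)).
  by rewrite (le_trans (ler_normB _ _))// lerD.
by rewrite opprB [RHS]addrC addrA subrK.
Qed.

Lemma tends_shift (x : nat -> H) (l : H) n0 : tends x l -> tends (fun n => x (n + n0)%N) l.
Proof.
move=> hx e e0; have [n1 h1] := hx e e0; exists n1 => n hn.
by apply: h1; rewrite (leq_trans hn)// leq_addr.
Qed.

Lemma tends_sub (x y : nat -> H) (l b : H) : tends x l -> tends y b ->
  tends (fun n => x n - y n) (l - b).
Proof.
move=> hx hy e e0; have e2 : 0 < e / 2 by rewrite divr_gt0.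
have [n1 h1] := hx _ e2; have [n2 h2] := hy _ e2; exists (maxn n1 n2) => n.
rewrite geq_max => /andP[/h1 g1 /h2 g2].
rewrite (_ : _ - _ = (x n - l) - (y n - b)).
  by rewrite (le_trans (ler_normB _ _))// [e]splitr lerD.
by apply: quatP => /=; ring.
Qed.

Lemma tends_mull (x : nat -> H) (l c : H) : tends x l -> tends (fun n => c * x n) (c * l).
Proof.
move=> hx e e0; have c0 : 0 < `|c| + 1 by rewrite ltr_wpDl.
have [n0 h0] := hx _ (divr_gt0 e0 c0); exists n0 => n /h0.
rewrite ler_pdivlMr// -mulrBr Defs.normqM => h; apply: le_trans h.
by rewrite mulrC ler_wpM2l// lerDl.
Qed.

Variables (i : H) (hi : imag_sphere i).

(** Weierstrass' theorem in a form that assumes uniform convergence of the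
    derivatives: the mean value inequality for [wn m - wn n] lets the expansion
    of one [wn n] pass to the limit. *)
Lemma holo_limit (wn gn : nat -> H -> H) (W : H -> H) (z0 G : H) (r : R) :
  0 < r -> slice i z0 ->
  (forall n w, slice i w -> `|w - z0| < r -> holo i (wn n) w (gn n w)) ->
  (forall e, 0 < e -> exists n0, forall m n, (n0 <= m)%N -> (n0 <= n)%N ->
     forall w, slice i w -> `|w - z0| < r -> `|gn m w - gn n w| <= e) ->
  (forall w, slice i w -> `|w - z0| < r -> tends (fun n => wn n w) (W w)) ->
  tends (fun n => gn n z0) G -> holo i W z0 G.
Proof.
move=> r0 Sz hw hg hW hG e e0; have e3 : 0 < e / 3 by rewrite divr_gt0.
have [n1 h1] := hg _ e3; have [n2 h2] := hG _ e3; pose n := maxn n1 n2.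
have [d d0 hd] := hw n z0 Sz ltac:(by rewrite subrr normr0) _ e3.
exists (Num.min d r); first by rewrite lt_min d0.
move=> w Sw; rewrite lt_min => /andP[wd wr].
have seg s : 0 <= s <= 1 -> slice i (z0 + s *: (w - z0)) /\ `|z0 + s *: (w - z0) - z0| < r.
  move=> /andP[s0 s1]; split; first by apply: sliceD => //; apply: sliceZ; exact: sliceB.
  rewrite addrC addKr normrZ ger0_norm// (le_lt_trans _ wr)//.
  by rewrite ler_piMl.
have incr m : (n1 <= m)%N -> `|(wn m w - wn m z0) - (wn n w - wn n z0)| <= e / 3 * `|w - z0|.
  move=> hm; have := @mvt_slice R i (fun u => wn m u - wn n u) (fun u => gn m u - gn n u)
    z0 w (e / 3) Sz Sw.
  rewrite (_ : wn m w - wn n w - (wn m z0 - wn n z0) = wn m w - wn m z0 - (wn n w - wn n z0));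
    last by apply: quatP => /=; ring.
  apply=> s /seg[S1 S2]; first by apply: holo_sub; exact: hw.
  by apply: h1 => //; exact: leq_maxl.
have lim1 : `|(W w - W z0) - (wn n w - wn n z0)| <= e / 3 * `|w - z0|.
  apply: (tends_le (x := fun m => wn m w - wn m z0) _ incr).
  by apply: tends_sub; apply: hW => //; rewrite subrr normr0.
have lim2 : `|(w - z0) * (gn n z0 - G)| <= e / 3 * `|w - z0|.
  by rewrite Defs.normqM mulrC ler_wpM2r// h2// leq_maxr.
have lim3 := hd w Sw wd.
rewrite (_ : _ - _ - _ = (W w - W z0 - (wn n w - wn n z0)) +
  (wn n w - wn n z0 - (w - z0) * gn n z0) + (w - z0) * (gn n z0 - G)); last first.
  by rewrite mulrBr; apply: quatP => /=; ring.
rewrite (_ : e * _ = e / 3 * `|w - z0| + e / 3 * `|w - z0| + e / 3 * `|w - z0|); last by field.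
by rewrite (le_trans (ler_normD _ _))// lerD// (le_trans (ler_normD _ _))// lerD.
Qed.

End QuaternionSequences.

(** * Completeness *)

Section Completeness.
Variables (R : realType) (alpha sigma : R) (k : nat) (i : quat R).
Hypotheses (halpha : 0 < alpha) (hsigma : 0 < sigma < 1) (hk : (0 < k)%N)
  (hek : forall q : quat R, slit_ball q -> exp_trunc k.-1 (qpowR q alpha) != 0)
  (hi : imag_sphere i).
Local Notation H := (quat R).
Local Notation pt := (slice_pt i).
Local Notation mu2 := (@lebesgue_measure R \x @lebesgue_measure R)%E.
Local Notation fd := (frac_deriv sigma alpha k i).
Local Notation mfac := (mfac alpha sigma k i).
Local Notation intfac := (intfac alpha sigma k i).
Local Notation wfun := (wfun alpha sigma k i).
Local Notation energy := (energy alpha sigma k i).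
Local Notation plane := (plane i).
Implicit Types (f g : slit_fun R).

Local Notation half := ((2^-1)%:A : H).
Local Notation sqn := (dirichlet_sqnorm sigma alpha k i).
Local Notation D := (dirichlet_space sigma alpha k i).
Local Notation N := (dirichlet_norm sigma alpha k i).

Lemma wfunB f g z : wfun (f - g) z = wfun f z - wfun g z.
Proof.
rewrite (_ : wfun (f - g) z = intfac z * slit_ext (f - g) z)//.
by rewrite slit_extB mulrBr.
Qed.

Lemma dirichletB f g : D f -> D g -> D (f - g).
Proof.
have [_ DD DZ] := dirichlet_right_submodule halpha hsigma hk hek hi.
by move=> Df Dg; rewrite -[- g]scaleN1r; exact: DD Df (DZ _ _ Dg).
Qed.

Variable u : nat -> slit_fun R.
Hypothesis Du : forall n, D (u n).
Hypothesis hu : forall e : R, 0 < e -> exists n0 : nat, forall m n : nat,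
  (n0 <= m)%N -> (n0 <= n)%N -> N (u m - u n) < e.

Let ru n : slice_regular (u n). Proof. by case: (Du n). Qed.
Let rB m n : slice_regular (u m - u n).
Proof. by apply: slice_regularB; exact: ru. Qed.

Lemma cauchy_energy e : 0 < e -> exists n0, forall m n, (n0 <= m)%N -> (n0 <= n)%N ->
  (energy (u m - u n)%R <= (e ^+ 2)%:E)%E /\
  Num.sqrt alpha * `|slit_ext (u m) half - slit_ext (u n) half| <= e.
Proof.
move=> e0; have [n0 h0] := hu e0; exists n0 => m n hm hn.
have [_ fin] := dirichletB (Du m) (Du n).
have hN : (sqn (u m - u n)%R <= (e ^+ 2)%:E)%E.
  rewrite (sqn_fin halpha fin) lee_fin ler_sqr ?nnegrE ?sqrtr_ge0 ?(ltW e0)//.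
  by apply: ltW; exact: h0.
split; first exact: le_trans (energy_le_sqn sigma k i halpha _) hN.
have := le_trans (half_le_sqn alpha sigma k i (u m - u n)) hN.
rewrite lee_fin slit_extB => h.
rewrite -ler_sqr ?nnegrE ?mulr_ge0 ?sqrtr_ge0 ?(ltW e0)//.
by rewrite exprMn sqr_sqrtr ?(ltW halpha).
Qed.

Lemma cauchy_wfun z : slit_slice i z -> exists l, tends (fun n => wfun (u n) z) l.
Proof.
move=> hz; have [K K0 hK] := wfun_bound halpha hsigma hk hek hi hz.
apply: cauchy_tends => e e0.
have sa : 0 < Num.sqrt alpha by rewrite sqrtr_gt0.
pose A := `|intfac half| / Num.sqrt alpha; have A0 : 0 <= A by rewrite divr_ge0 ?(ltW sa).
have AK : 0 < A + K by rewrite ltr_wpDl.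
have E0 : 0 < e / (A + K) by rewrite divr_gt0.
have [n0 h0] := cauchy_energy E0; exists n0 => m n hm hn.
have [h1 h2] := h0 m n hm hn; have h3 := hK _ _ (rB m n) E0 h1.
rewrite -wfunB -[wfun _ z](subrK (wfun (u m - u n) half)).
rewrite (le_trans (ler_normD _ _))// [leRHS](_ : e = K * (e / (A + K)) + A * (e / (A + K))).
  apply: lerD => //; rewrite wfunB -mulrBr Defs.normqM /A mulrAC -mulrA ler_wpM2l//.
  by rewrite ler_pdivlMr// mulrC.
by field; rewrite gt_eqF.
Qed.

Lemma cauchy_fd z0 : slit_slice i z0 -> exists2 r, 0 < r &
  (forall w, slice i w -> `|w - z0| < r -> slit_slice i w) /\
  forall e, 0 < e -> exists n0, forall m n, (n0 <= m)%N -> (n0 <= n)%N ->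
    forall w, slice i w -> `|w - z0| < r ->
      `|mfac w * fd (u m) w - mfac w * fd (u n) w| <= e.
Proof.
move=> hz; have [r r0 [C C0 hC]] := energy_bound halpha hsigma hk hek hi hz.
exists r => //; split; first by move=> w Sw wr; case: (hC w Sw wr).
move=> e e0; have E0 : 0 < e / C by rewrite divr_gt0.
have [n0 h0] := cauchy_energy E0; exists n0 => m n hm hn w Sw wr.
have [h1 _] := h0 m n hm hn; have [hw hb] := hC w Sw wr.
have := hb _ _ (rB m n) E0 h1.
by rewrite (fdB sigma halpha hk hek hi (ru m) (ru n) hw) mulrBr mulrC divfK ?gt_eqF.
Qed.

(** The limits of [wfun (u n)] are divided by the integrating factor, and the
    quotient is extended from the slice to the slit ball. *)
Lemma cauchy_limit_fun : exists2 f, slice_regular f & forall z, slit_slice i z ->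
  tends (fun n => wfun (u n) z) (wfun f z) /\ tends (fun n => fd (u n) z) (fd f z).
Proof.
have exW z : exists l, slit_slice i z -> tends (fun n => wfun (u n) z) l.
  have [hz|nz] := pselect (slit_slice i z); last by exists 0.
  by have [l hl] := cauchy_wfun hz; exists l.
have exG z : exists l, slit_slice i z -> tends (fun n => mfac z * fd (u n) z) l.
  have [hz|nz] := pselect (slit_slice i z); last by exists 0.
  have [r r0 [_ hr]] := cauchy_fd hz; have [_ Sz] := hz.
  have [l hl] : exists l, tends (fun n => mfac z * fd (u n) z) l; last by exists l.
  apply: cauchy_tends => e /hr[n0 h0]; exists n0 => m n hm hn.
  by apply: h0; rewrite // subrr normr0.
have [W hW] := choice exW; have [G hG] := choice exG.
have holoW z : slit_slice i z -> holo i W z (G z).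
  move=> hz; have [_ Sz] := hz; have [r r0 [hS hr]] := cauchy_fd hz.
  apply: (@holo_limit R i (fun n => wfun (u n)) (fun n z => mfac z * fd (u n) z) W z (G z) r) => //.
  - by move=> n w Sw wr; apply: holo_wfun => //; exact: hS.
  - by move=> w Sw wr; apply: hW; exact: hS.
  - exact: hG.
have holoF z : slit_slice i z -> holomorphic_at i (fun z => (intfac z)^-1 * W z) z.
  move=> hz; have [_ Sz] := hz; have Si := slice_intfac alpha sigma k i z.
  have [p hp] : exists p, holo i (fun w => (intfac w)^-1) z p.
    exists (((1 - sigma) / sigma)%:A * dgE i alpha k z * intfac z * - intfac z ^- 2).
    exact: (@holo_comp _ i intfac (fun w => w^-1) z _ _
      (fun w _ => slice_intfac alpha sigma k i w) (holo_intfac alpha sigma hk hi hz)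
      (holo_inv hi (intfac_neq0 alpha sigma k hi z) Si)).
  have Si' : slice i ((intfac z)^-1) by exact: sliceV.
  exists (p * W z + (intfac z)^-1 * G z).
  exact: (@holo_mul _ i hi (fun w => (intfac w)^-1) W z _ _ Sz Si' hp (holoW z hz)).
have [f rf fF] := slice_regular_extension hi holoF.
have fW z : slit_slice i z -> wfun f z = W z.
  move=> hz; rewrite (_ : wfun f z = intfac z * slit_ext f z)// fF// mulVKr//.
  by rewrite unitqE intfac_neq0.
exists f => // z hz; have [_ Sz] := hz; rewrite fW//; split; first exact: hW.
have gG : mfac z * fd f z = G z.
  have [r r0 hr] := slit_slice_open hz.
  apply: (holo_unique hi Sz (holo_wfun halpha hsigma hk hek hi rf hz)).
  apply: (diff_within_near r0 _ _ (holoW z hz)); first by rewrite fW.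
  by move=> w Sw wr; rewrite fW//; exact: hr.
have m0 := mfac_neq0 halpha hsigma hek hi hz.
have := tends_mull (mfac z)^-1 (hG z hz); rewrite -gG mulKr ?unitqE// => h e e0.
by have [n0 h0] := h e e0; exists n0 => n /h0; rewrite mulKr ?unitqE.
Qed.

(** Fatou's lemma: the energy is lower semicontinuous for pointwise limits. *)
Lemma energy_limit f (c : R) n n0 : slice_regular f ->
  (forall z, slit_slice i z -> tends (fun n => fd (u n) z) (fd f z)) ->
  (forall m, (n0 <= m)%N -> (energy (u n - u m)%R <= c%:E)%E) ->
  (energy (u n - f)%R <= c%:E)%E.
Proof.
move=> rf hf hc; have mP := measurable_plane hi.
pose g m (p : R * R) := (`|fd (u n - u (m + n0)%N)%R (pt p.1 p.2)| ^+ 2)%:E.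
have mg m : measurable_fun plane (g m).
  by apply: (measurable_sqr_fd halpha hsigma hk hek hi); exact: rB.
have g0 m p : plane p -> (0 <= g m p)%E by rewrite lee_fin sqr_ge0.
have gl p : plane p -> limn_einf (g^~ p) = (`|fd (u n - f)%R (pt p.1 p.2)| ^+ 2)%:E.
  move=> hp; suff hcv : g^~ p @ \oo --> (`|fd (u n - f)%R (pt p.1 p.2)| ^+ 2)%:E.
    by rewrite is_cvg_limn_einfE; [exact: cvg_lim hcv|apply/cvg_ex; eexists; exact: hcv].
  rewrite /g; apply: cvg_EFin; first by near=> x.
  have t : tends (fun m => fd (u n - u (m + n0)%N) (pt p.1 p.2)) (fd (u n - f) (pt p.1 p.2)).
    rewrite (fdB sigma halpha hk hek hi (ru n) rf hp) => e e0.
    have [n1 h1] := tends_shift n0 (hf _ hp) e0; exists n1 => m hm.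
    rewrite (fdB sigma halpha hk hek hi (ru n) (ru _) hp).
    by rewrite opprB addrC addrA subrK distrC h1.
  have ta : (fun m => `|fd (u n - u (m + n0)%N) (pt p.1 p.2)|) @ \oo -->
      (`|fd (u n - f) (pt p.1 p.2)| : R^o).
    apply/(@cvgrPdist_le R R^o) => e e0; have [n1 h1] := t e e0.
    exists n1 => // m hm; rewrite distrC (le_trans (ler_dist_dist _ _))//.
    exact: h1.
  exact: (cvgM ta ta).
have -> : energy (u n - f)%R = (\int[mu2]_(p in plane) limn_einf (g^~ p))%E.
  by apply: eq_integral => p /set_mem hp; rewrite gl.
apply: (le_trans (fatou mu2 mP mg g0)); rewrite limn_einf_lim.
apply: lime_le; first exact: is_cvg_einfs.
near=> m; apply: (@le_trans _ _ (energy (u n - u (m + n0)%N)%R)).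
  by apply: ereal_inf_lbound; exists m => //=.
by apply: hc; rewrite leq_addl.
Unshelve. all: by end_near.
Qed.

(** The limit belongs to the space because it differs from a term of the sequence
    by a function of finite norm. *)
Lemma cauchy_limit : exists2 f, D f & N (u n - f) @[n --> \oo] --> (0 : R).
Proof.
have [f rf hf] := cauchy_limit_fun.
have hE e : 0 < e -> exists n0, forall n, (n0 <= n)%N ->
    (sqn (u n - f)%R <= ((2 * e) ^+ 2)%:E)%E.
  move=> e0; have [n0 h0] := cauchy_energy e0; exists n0 => n hn.
  have h1 : (energy (u n - f)%R <= (e ^+ 2)%:E)%E.
    apply: (@energy_limit f (e ^+ 2) n n0 rf) => [z /hf[]//|m hm].
    by case: (h0 n m hn hm).
  have h2 : alpha * `|slit_ext (u n - f) half| ^+ 2 <= e ^+ 2.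
    have hh := half_slit_slice hi; have [tw _] := hf _ hh.
    have := tends_mull (intfac half)^-1 tw.
    rewrite (_ : wfun f half = intfac half * slit_ext f half)//.
    rewrite mulKr ?unitqE ?intfac_neq0// => tF.
    have sa : 0 < Num.sqrt alpha by rewrite sqrtr_gt0.
    rewrite -[X in X * _](sqr_sqrtr (ltW halpha)) -exprMn.
    rewrite ler_sqr ?nnegrE ?mulr_ge0 ?sqrtr_ge0 ?(ltW e0)//.
    rewrite slit_extB distrC mulrC -ler_pdivlMr//.
    apply: (tends_le tF (n0 := n0)) => m hm.
    rewrite (_ : wfun (u m) half = intfac half * slit_ext (u m) half)//.
    rewrite mulKr ?unitqE ?intfac_neq0// ler_pdivlMr// mulrC.
    by case: (h0 m n hm hn).
  rewrite sqnormE (_ : (2 * e) ^+ 2 = e ^+ 2 + (e ^+ 2 + e ^+ 2 + e ^+ 2)); last by ring.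
  rewrite EFinD leeD ?lee_fin// (le_trans h1)// lee_fin.
  by rewrite -addrA lerDl addr_ge0 ?sqr_ge0.
have regB n : slice_regular (u n - f) by apply: slice_regularB.
have Df : D f.
  have [n0 h0] := hE 1 ltr01; rewrite -[f](subKr (u n0)).
  by apply: dirichletB => //; split=> //; exact: le_lt_trans (h0 n0 (leqnn _)) (ltry _).
exists f => //; apply/(@cvgrPdist_le R R^o) => e e0.
have [n0 h0] := hE _ (divr_gt0 e0 (ltr0n _ 2)); exists n0 => // n hn.
rewrite sub0r normrN ger0_norm ?sqrtr_ge0//; have := h0 n hn.
have [_ fin] := dirichletB (Du n) Df.
rewrite (sqn_fin halpha fin) lee_fin ler_sqr ?nnegrE ?sqrtr_ge0//.
  by rewrite mulrC divfK.
by rewrite mulr_ge0// divr_ge0// ltW.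
Qed.

End Completeness.

Theorem proposition5p10 (R : realType) (alpha sigma : R) (k : nat) (i : quat R)
  (halpha : 0 < alpha <= 1) (hsigma : 0 < sigma < 1) (hk : (1 <= k)%N)
  (hek : forall q : quat R, slit_ball q -> exp_trunc k.-1 (qpowR q alpha) != 0)
  (hi : imag_sphere i) :
  quaternionic_banach_right_module
    (dirichlet_space sigma alpha k i) (dirichlet_norm sigma alpha k i).
Proof.
have /andP[a0 _] := halpha.
split; [exact: dirichlet_right_submodule|exact: dirichlet_is_norm|].
by move=> u Du hu; exact: cauchy_limit.
Qed.
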